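(* Let $Q$ be a probability distribution on $\mathbb{R}$ with $\int x\,Q(dx)=0$, $\int x^2\,Q(dx)=1/2$ and $\int x^4\,Q(dx)<\infty$. For each $N\ge 1$ let $X_N$ be the $N\times N$ Hermitian Wigner matrix associated with $Q$, let $D_N(\lambda):=\det(X_N-\lambda)$, and for $\mu,\nu\in\mathbb{R}$ let $$\sigma_N(\mu,\nu):=\frac{\mathbb{E}\big((D_N(\mu)-\mathbb{E}D_N(\mu))(D_N(\nu)-\mathbb{E}D_N(\nu))\big)}{\sqrt{\mathbb{E}(D_N(\mu)-\mathbb{E}D_N(\mu))^2}\,\sqrt{\mathbb{E}(D_N(\nu)-\mathbb{E}D_N(\nu))^2}}.$$ Then for all $\mu,\nu\in\mathbb{R}$, $$\lim_{N\to\infty}\sigma_N\!\left(2\sqrt N+\mu/N^{1/6},\,2\sqrt N+\nu/N^{1/6}\right)=\frac{\mathbb{A}(\mu,\nu)}{\sqrt{\mathbb{A}(\mu,\mu)}\,\sqrt{\mathbb{A}(\nu,\nu)}},$$ where $$\mathbb{A}(\mu,\nu):=\frac{\mathrm{Ai}(\mu)\,\mathrm{Ai}'(\nu)-\mathrm{Ai}'(\mu)\,\mathrm{Ai}(\nu)}{\mu-\nu},$$ understood by continuous extension when $\mu=\nu$.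
   Context: The $N\times N$ Hermitian Wigner matrix $X_N=(X_{ij})_{i,j=1,\dots,N}$ associated with $Q$ is defined by $X_{ij}:=X^{\mathrm{Re}}_{ij}+\mathrm{i}X^{\mathrm{Im}}_{ij}$ for $i<j$, $X_{ii}:=\sqrt2\,X^{\mathrm{Re}}_{ii}$, and $X_{ij}:=X^{\mathrm{Re}}_{ji}-\mathrm{i}X^{\mathrm{Im}}_{ji}$ for $i>j$, where $\{X^{\mathrm{Re}}_{ij}: i\le j\}\cup\{X^{\mathrm{Im}}_{ij}: i<j\}$ is a collection of i.i.d. real random variables with distribution $Q$. Here $\det(X_N-\lambda)$ means $\det(X_N-\lambda I_N)$, $\mathbb{E}$ denotes expectation, and $\mathrm{Ai}$ denotes the Airy function. The correlation coefficient $\sigma_N(\mu,\nu)$ is defined whenever its denominator is nonzero. *)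

(* Defs.v *)
From HB Require Import structures.
From mathcomp Require Import all_boot all_order all_algebra.
From mathcomp Require Import all_classical all_reals all_analysis.
From mathcomp Require Import complex.

Set Implicit Arguments.
Unset Strict Implicit.
Unset Printing Implicit Defensive.

Import Order.TTheory GRing.Theory Num.Theory.
Import numFieldNormedType.Exports.

Local Open Scope classical_set_scope.
Local Open Scope ring_scope.
Local Open Scope complex_scope.

(* Mutual independence of the subfamily of X indexed by D (the library has no
   independence of random variables): the product rule over all finite
   J included in D. *)
Definition mutually_independent (d : measure_display) (T : measurableType d)
    (R : realType) (P : probability T R) (I : finType) (D : {pred I})
    (X : I -> {RV P >-> R}) : Prop :=
  forall (J : {set I}) (A : I -> set R),
    {subset J <= D} -> (forall i, measurable (A i)) ->
    P (\bigcap_(i in [set` J]) (X i @^-1` A i)) =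
    (\prod_(i in J) P (X i @^-1` A i))%E.

(* The family {XRe i j : i <= j} U {XIm i j : i < j}, with inl (i, j) indexing
   XRe i j and inr (i, j) indexing XIm i j. The values of XRe and XIm at other
   pairs are unconstrained and are never used. *)
Definition wigner_index (N : nat) : {pred 'I_N * 'I_N + 'I_N * 'I_N} :=
  fun k => match k with
           | inl (i, j) => (i <= j)%N
           | inr (i, j) => (i < j)%N
           end.

Definition wigner_family (N : nat) (V : Type) (XRe XIm : 'I_N -> 'I_N -> V)
    (k : 'I_N * 'I_N + 'I_N * 'I_N) : V :=
  match k with
  | inl (i, j) => XRe i j
  | inr (i, j) => XIm i j
  end.

Definition wigner_iid (d : measure_display) (T : measurableType d)
    (R : realType) (P : probability T R) (Q : probability R R) (N : nat)
    (XRe XIm : 'I_N -> 'I_N -> {RV P >-> R}) : Prop :=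
  mutually_independent (@wigner_index N) (wigner_family XRe XIm) /\
  (forall k, k \in @wigner_index N -> forall A : set R, measurable A ->
     distribution P (wigner_family XRe XIm k) A = Q A).

Definition wigner_mx (R : realType) (T : Type) (N : nat)
    (XRe XIm : 'I_N -> 'I_N -> T -> R) (w : T) : 'M[R[i]]_N :=
  \matrix_(i, j)
    if (i < j)%N then XRe i j w +i* XIm i j w
    else if i == j then (Num.sqrt 2 * XRe i i w)%:C
    else XRe j i w -i* XIm j i w.

(* The matrix being Hermitian, the determinant is real (wigner_det_real), and
   char_det is its value as an element of R. *)
Definition char_det (R : realType) (T : Type) (N : nat)
    (XRe XIm : 'I_N -> 'I_N -> T -> R) (lambda : R) (w : T) : R :=
  complex.Re (\det (wigner_mx XRe XIm w - (lambda%:C)%:M)).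

Lemma wigner_det_real (R : realType) (T : Type) (N : nat)
    (XRe XIm : 'I_N -> 'I_N -> T -> R) (lambda : R) (w : T) :
  \det (wigner_mx XRe XIm w - (lambda%:C)%:M) =
  (char_det XRe XIm lambda w)%:C.
Proof.
set M := _ - _.
have MH : map_mx (@conjc R) M = M^T.
  apply/matrixP => i j; rewrite !mxE rmorphB rmorphMn [X in _ - X *+ _]conjc_real.
  rewrite [j == i]eq_sym; congr (_ - _).
  have [ij|ji|/val_inj ->] := ltngtP i j.
  - by rewrite /=; case: eqP => // e; rewrite e ltnn in ij.
  - by case: eqP => [e|_]; [rewrite e ltnn in ji | rewrite /= opprK].
  - by rewrite !eqxx /= oppr0.
have : (\det M)^* = \det M by rewrite -det_map_mx MH det_tr.
rewrite /char_det -/M; case: (\det M) => a b [] /eqP.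
by rewrite eqNr => /eqP ->.
Qed.

(* covariance P X Y is E((X - E X)(Y - E Y)) and 'V_P[X] is covariance P X X. *)
Definition correlation (d : measure_display) (T : measurableType d)
    (R : realType) (P : probability T R) (X Y : T -> R) : R :=
  fine (covariance P X Y) /
  (Num.sqrt (fine 'V_P[X]) * Num.sqrt (fine 'V_P[Y])).

(* Airy function on the real line, as the improper (conditionally convergent)
   integral pi^-1 * int_0^oo cos (t^3 / 3 + x t) dt. *)
Definition airy (R : realType) (x : R) : R :=
  pi^-1 * lim ((\int[lebesgue_measure]_(t in `[0, u])
                  cos (t ^+ 3 / 3 + x * t))%R @[u --> +oo]).

Definition airy_quotient (R : realType) (p : R * R) : R :=
  (airy p.1 * derive1 (@airy R) p.2 - derive1 (@airy R) p.1 * airy p.2) /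
  (p.1 - p.2).

(* On the diagonal, the continuous extension of airy_quotient from
   {(x, y) | x != y} to the plane. *)
Definition airy_kernel (R : realType) (mu nu : R) : R :=
  if mu == nu then
    lim (airy_quotient p @[p --> within [set p : R * R | p.1 != p.2]
                                        (nbhs (mu, nu))])
  else airy_quotient (mu, nu).

Definition edge_point (R : realType) (N : nat) (mu : R) : R :=
  2 * Num.sqrt N%:R + mu / (N%:R `^ (6^-1)).

(* Main.v *)
(** Only the first four moments of Q matter: an entry of the matrix has degree at
    most two in a determinant, so the mean of D_N(x) D_N(y) may be computed with
    signed weights on five nodes having those moments.  Bordering the matrix by
    one row then gives a recursion in N, solved by
      E D_N(x) D_N(y) = N! sum_m (c^m / m!) S_{N-2m}(x, y),
      S_n(x, y) = sum_{k <= n} He_k(x) He_k(y) / k!,   c = int x^4 dQ - 3/4,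
    while E D_N = (-1)^N He_N.

    In the coordinate x = 2 sqrt N + s N^{-1/6} the Hermite function
    He_N(x) e^{-x^2/4} is a bounded solution of v'' = (s + o(1)) v.  Its Wronskian
    with Ai is nearly constant and decays, so the two are nearly proportional at
    a fixed s0, hence, by Gronwall, on compact subsets of s <= s0.  Through the
    Christoffel-Darboux formula, N! N^{-1/3} S_{N-j}, normalized by the gaussian
    factors and the square of the proportionality constant, tends to A(mu, nu)
    for every fixed j.  By dominated summation over m the normalized covariance
    tends to e^c A(mu, nu), and e^c cancels in the correlation.  Finally
    A(mu, mu) > 0, its derivative being - Ai(mu)^2. *)

Require Import Defs.
From HB Require Import structures.
From mathcomp Require Import all_boot all_order all_algebra perm.
From mathcomp Require Import all_classical all_reals all_analysis.
From mathcomp Require Import measurable_realfun complex ring lra.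

Set Implicit Arguments.
Unset Strict Implicit.
Unset Printing Implicit Defensive.

Import Order.TTheory GRing.Theory Num.Theory.
Import numFieldNormedType.Exports.

Local Open Scope classical_set_scope.
Local Open Scope ring_scope.

(** * Calculus on the real line *)

(** The recursion in N divides by x - y, differentiates in x and y, and compares polynomials. Over a
    finite signed configuration space every mean is a finite sum, so all this is polynomial algebra,
    and measure theory is confined to transferring monomials. The recursion closes because traces of
    adjugates are derivatives of the characteristic polynomial (Jacobi), tr(adj(x) adj(y)) is a
    difference quotient (resolvent identity), and diagonal adjugate entries are characteristic
    polynomials of minors; these last, weighted by c, make the recursion two-step and produce the
    factor e^{c t^2} in the generating function of the solution. The constant 3/4 is the fourth
    moment of the centered Gaussian of variance 1/2. A correlation ignores normalizations, so
    Plancherel-Rotach constants are not computed: it suffices that Hermite functions approach some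
    multiple of Ai, and decay at +oo singles out Ai among the solutions. The Airy integral converges
    only conditionally, and its formal second derivative does not converge; the Airy equation is
    therefore derived from inequalities for truncated integrals with boundary terms. *)

Section Calculus.
Variable R : realType.
Implicit Types f g u v : R -> R.

(* Not a class: derivatives are computed only by the rules below. *)
Definition has_deriv (f : R -> R) (x l : R) : Prop := is_derive x 1 f l.

Lemma has_deriv_eq f (x a b : R) : has_deriv f x a -> a = b -> has_deriv f x b.
Proof. by move=> fa <-. Qed.

Lemma derive_add f g (x a b : R) : has_deriv f x a -> has_deriv g x b ->
  has_deriv (fun y => f y + g y) x (a + b).
Proof. exact: is_deriveD. Qed.

Lemma derive_sub f g (x a b : R) : has_deriv f x a -> has_deriv g x b ->
  has_deriv (fun y => f y - g y) x (a - b).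
Proof. exact: is_deriveB. Qed.

Lemma derive_opp f (x a : R) : has_deriv f x a ->
  has_deriv (fun y => - f y) x (- a).
Proof. exact: is_deriveN. Qed.

Lemma derive_mul f g (x a b : R) : has_deriv f x a -> has_deriv g x b ->
  has_deriv (fun y => f y * g y) x (a * g x + f x * b).
Proof.
move=> fa gb; apply: is_derive_eq (is_deriveM fa gb) _.
by rewrite /GRing.scale /= addrC [g x * a]mulrC.
Qed.

Lemma derive_pow f n (x a : R) : has_deriv f x a ->
  has_deriv (fun y => f y ^+ n) x (n%:R * f x ^+ n.-1 * a).
Proof.
move=> fa; have -> : (fun y => f y ^+ n) = f ^+ n by apply/funext => y; rewrite exprfctE.
exact: is_deriveX.
Qed.

Lemma derive_inv f (x a : R) : f x != 0 -> has_deriv f x a ->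
  has_deriv (fun y => (f y)^-1) x (- a / f x ^+ 2).
Proof.
move=> f0 fa; apply: is_derive_eq (is_deriveV f0 fa) _.
by rewrite /GRing.scale /= mulNr mulrC mulNr.
Qed.

Lemma derive_comp f g (x a b : R) : has_deriv f (g x) a ->
  has_deriv g x b -> has_deriv (fun y => f (g y)) x (a * b).
Proof. exact: is_derive1_comp. Qed.

Lemma derive_sin g (x b : R) : has_deriv g x b ->
  has_deriv (fun y => sin (g y)) x (cos (g x) * b).
Proof. by apply: derive_comp; exact: is_derive_sin. Qed.

Lemma derive_cos g (x b : R) : has_deriv g x b ->
  has_deriv (fun y => cos (g y)) x (- sin (g x) * b).
Proof. by apply: derive_comp; exact: is_derive_cos. Qed.

Lemma derive_exp g (x b : R) : has_deriv g x b ->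
  has_deriv (fun y => expR (g y)) x (expR (g x) * b).
Proof. by apply: derive_comp; exact: is_derive_expR. Qed.

Lemma derive_var (x : R) : has_deriv (fun y : R => y) x 1.
Proof. exact: is_derive_id. Qed.

Lemma derive_const (c x : R) : has_deriv (fun=> c) x 0.
Proof. exact: is_derive_cst. Qed.

Lemma derive_continuous f (x a : R) : has_deriv f x a ->
  {for x, continuous f}.
Proof. by case=> fa _; exact/differentiable_continuous/derivable1_diffP. Qed.

Lemma mean_value f f' (a b : R) : a <= b ->
  (forall x, a <= x <= b -> has_deriv f x (f' x)) ->
  exists2 c, a <= c <= b & f b - f a = f' c * (b - a).
Proof.
move=> ab fd.
have fi x : x \in `]a, b[%R -> has_deriv f x (f' x).
  by rewrite in_itv /= => /andP[/ltW ax /ltW xb]; apply: fd; rewrite ax.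
have fc : {within `[a, b], continuous f}.
  apply: derivable_within_continuous => x; rewrite in_itv /= => xab.
  by case: (fd x xab).
by have [c cab e] := MVT_segment ab fi fc; exists c => //; move: cab; rewrite in_itv.
Qed.

Lemma derive_ge0_le f f' (a b : R) : a <= b ->
  (forall x, a <= x <= b -> has_deriv f x (f' x)) ->
  (forall x, a <= x <= b -> 0 <= f' x) -> f a <= f b.
Proof.
move=> ab fd f0; have [c cab e] := mean_value ab fd.
by rewrite -subr_ge0 e mulr_ge0 ?subr_ge0 ?f0.
Qed.

(** Both g + f and g - f are nondecreasing. This replaces bounds on integrals: [g] is a primitive of
    the bound on the integrand. *)
Lemma derive_dominated f f' g g' (a b : R) : a <= b ->
  (forall x, a <= x <= b -> has_deriv f x (f' x)) ->
  (forall x, a <= x <= b -> has_deriv g x (g' x)) ->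
  (forall x, a <= x <= b -> `|f' x| <= g' x) -> `|f b - f a| <= g b - g a.
Proof.
move=> ab fd gd le; rewrite ler_norml; apply/andP; split.
  suff : g a + f a <= g b + f b by lra.
  apply: (@derive_ge0_le (fun x => g x + f x) (fun x => g' x + f' x)) => // x xab.
    by apply: derive_add; [exact: gd | exact: fd].
  by have := le x xab; rewrite ler_norml; lra.
suff : g a - f a <= g b - f b by lra.
apply: (@derive_ge0_le (fun x => g x - f x) (fun x => g' x - f' x)) => // x xab.
  by apply: derive_sub; [exact: gd | exact: fd].
by have := le x xab; rewrite ler_norml; lra.
Qed.

Lemma mean_value_dist f f' (x y : R) :
  (forall z, `|z - x| <= `|y - x| -> has_deriv f z (f' z)) ->
  exists2 c, `|c - x| <= `|y - x| & f y - f x = f' c * (y - x).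
Proof.
move=> fd; have [xy|yx] := leP x y.
  have [z zxy|c cxy e] := @mean_value f f' x y xy.
    by apply: fd; rewrite !ger0_norm; lra.
  by exists c => //; rewrite !ger0_norm; lra.
have [z zxy|c cxy e] := @mean_value f f' y x (ltW yx).
  by apply: fd; rewrite !ler0_norm; lra.
by exists c; [rewrite !ler0_norm; lra | lra].
Qed.

Lemma taylor2_le f f1 f2 (M x y : R) :
  (forall z, `|z - x| <= `|y - x| -> has_deriv f z (f1 z)) ->
  (forall z, `|z - x| <= `|y - x| -> has_deriv f1 z (f2 z)) ->
  (forall z, `|z - x| <= `|y - x| -> `|f2 z| <= M) ->
  `|f y - f x - (y - x) * f1 x| <= M * (y - x) ^+ 2.
Proof.
move=> d1 d2 le; have [c cxy ->] := mean_value_dist d1.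
have [z zxc|e exc ec] := @mean_value_dist f1 f2 x c.
  by apply: d2; exact: le_trans cxy.
have -> : f1 c * (y - x) - (y - x) * f1 x = f2 e * ((c - x) * (y - x)).
  by rewrite mulrA -ec; ring.
rewrite !normrM ler_pM ?mulr_ge0 ?le ?(le_trans exc)//.
by rewrite -real_normK ?num_real// expr2 ler_wpM2r.
Qed.

(** A quadratic error bound survives pointwise limits, so limits of parameter integrals can be
    differentiated through it without a theorem on uniform convergence. *)
Lemma derive_quadratic f (C x l : R) :
  (forall y, `|y - x| <= 1 -> `|f y - f x - (y - x) * l| <= C * (y - x) ^+ 2) ->
  has_deriv f x l.
Proof.
move=> le; suff : h^-1 *: (f (h *: 1 + x) - f x) @[h --> 0^'] --> l.
  by move=> fl; split; [apply/cvg_ex; exists l | exact/cvg_lim].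
apply/cvgrPdist_le => e e0.
near=> h.
have h0 : h != 0 by near: h; exact: nbhs_dnbhs_neq.
have hx : h *: 1 + x - x = h by rewrite addrK /GRing.scale /= mulr1.
have : `|h *: 1 + x - x| <= 1.
  rewrite hx; near: h; apply: (@dnbhs0_le _ _ 1); exact: ltr01.
move=> /le; rewrite hx => lC.
rewrite -(@ler_pM2l _ `|h|) ?normr_gt0// -normrM mulrBr distrC.
rewrite /GRing.scale /= mulVKf//; apply: (le_trans lC).
rewrite -(@real_normK _ h) ?num_real// expr2 mulrA [leRHS]mulrC.
rewrite ler_wpM2r//.
have C1 : 0 < `|C| + 1 by rewrite ltr_wpDl.
apply: (@le_trans _ _ ((`|C| + 1) * `|h|)).
  by rewrite ler_wpM2r//; have := ler_norm C; lra.
rewrite mulrC -ler_pdivlMr//.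
by near: h; apply: dnbhs0_le; rewrite divr_gt0.
Unshelve. all: by end_near. Qed.

End Calculus.

(* The goal left identifies the computed derivative with the stated one. *)
Ltac derive_step := first
  [ exact: derive_const | exact: derive_var | eassumption
  | apply: derive_add | apply: derive_sub | apply: derive_opp
  | apply: derive_mul | apply: derive_pow | apply: derive_sin
  | apply: derive_cos | apply: derive_exp
  | apply: derive_inv ].
Ltac derive_tac := eapply has_deriv_eq; [repeat derive_step | cbv beta].

(** * The Airy function as an oscillatory integral *)

Section Airy.
Variable R : realType.
Implicit Types x y t u v : R.
Local Notation mu := (@lebesgue_measure R).

(* Starting at -1 makes the primitive differentiable at 0. *)
Definition primitive (f : R -> R) (u : R) : R :=
  (\int[mu]_(t in `[(-1), u]) f t - \int[mu]_(t in `[(-1), 0]) f t)%R.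

Lemma primitive0 f : primitive f 0 = 0.
Proof. by rewrite /primitive subrr. Qed.

Lemma continuous_integrable_itv (f : R -> R) (a b : R) :
  continuous f -> mu.-integrable `[a, b] (EFin \o f).
Proof.
move=> fc; apply: continuous_compact_integrable; first exact: segment_compact.
exact: continuous_subspaceT.
Qed.

Lemma primitive_derive (f : R -> R) (u : R) : continuous f -> -1 < u ->
  has_deriv (primitive f) u (f u).
Proof.
move=> fc u1; rewrite -[f u]subr0 /primitive.
apply: derive_sub; last exact: derive_const.
have uu : u < u + 1 by rewrite ltrDl.
have fi := @continuous_integrable_itv f (-1) (u + 1) fc.
have [fd fE] := continuous_FTC1_closed uu fi u1 (fc u).
by split; [exact: fd | rewrite -derive1E fE].
Qed.

Lemma primitive_integral (f : R -> R) (u : R) : continuous f -> 0 <= u ->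
  primitive f u = \int[mu]_(t in `[0, u]) f t.
Proof.
move=> fc u0; rewrite /primitive Rintegral_itvB.
- rewrite Rintegral_itv_obnd_cbnd//.
  apply: integrableS (@continuous_integrable_itv f 0 u fc) => //.
  by apply: subset_itvr; rewrite bnd_simp.
- exact: continuous_integrable_itv.
- by rewrite bnd_simp lerN10.
- by rewrite bnd_simp.
Qed.

Definition phase (x t : R) := t ^+ 3 / 3 + x * t.

Lemma phase_derive x t : has_deriv (phase x) t (t ^+ 2 + x).
Proof. by rewrite /phase; derive_tac; rewrite /=; field. Qed.

Lemma phaseB x y t : phase y t - phase x t = (y - x) * t.
Proof. by rewrite /phase; ring. Qed.

(** The truncated Airy integral, followed by its formal first and second derivatives in x under the
    integral sign. *)
Definition osc0 x := primitive (fun t => cos (phase x t)).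
Definition osc1 x := primitive (fun t => - (t * sin (phase x t))).
Definition osc2 x := primitive (fun t => - (t ^+ 2 * cos (phase x t))).

Lemma osc0_derive x u : -1 < u ->
  has_deriv (osc0 x) u (cos (phase x u)).
Proof.
move=> u1; apply: (@primitive_derive (fun t => cos (phase x t))) => // t.
by apply: derive_continuous; apply: derive_cos; exact: phase_derive.
Qed.

Lemma osc1_derive x u : -1 < u ->
  has_deriv (osc1 x) u (- (u * sin (phase x u))).
Proof.
move=> u1; apply: (@primitive_derive (fun t => - (t * sin (phase x t)))) => // t.
apply: derive_continuous; apply: derive_opp; apply: derive_mul.
  exact: derive_var.
by apply: derive_sin; exact: phase_derive.
Qed.

Lemma osc2_derive x u : -1 < u ->
  has_deriv (osc2 x) u (- (u ^+ 2 * cos (phase x u))).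
Proof.
move=> u1; apply: (@primitive_derive (fun t => - (t ^+ 2 * cos (phase x t)))) => // t.
apply: derive_continuous; apply: derive_opp; apply: derive_mul.
  by apply: derive_pow; exact: derive_var.
by apply: derive_cos; exact: phase_derive.
Qed.

Lemma cos_taylor (a b : R) : `|cos b - cos a + (b - a) * sin a| <= (b - a) ^+ 2.
Proof.
have := @taylor2_le R (@cos R) (fun x => - sin x) (fun x => - cos x) 1 a b.
rewrite mul1r mulrN opprK; apply=> // z _.
- exact: is_derive_cos.
- by apply: derive_opp; exact: is_derive_sin.
- by rewrite normrN cos_max.
Qed.

Lemma sin_taylor (a b : R) : `|sin b - sin a - (b - a) * cos a| <= (b - a) ^+ 2.
Proof.
have := @taylor2_le R (@sin R) (@cos R) (fun x => - sin x) 1 a b.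
rewrite mul1r; apply=> // z _.
- exact: is_derive_sin.
- exact: is_derive_cos.
- by rewrite normrN sin_max.
Qed.

(** The first-order Taylor error in x is viewed as a function of the upper endpoint. The pointwise
    bound t^2 (y - x)^2 on its derivative integrates to u^3 / 3 (y - x)^2. *)
Lemma osc0_derive_param x u : 0 <= u ->
  has_deriv (osc0 ^~ u) x (osc1 x u).
Proof.
move=> u0; apply: (@derive_quadratic _ _ (u ^+ 3 / 3)) => y _.
set f := fun t => osc0 y t - osc0 x t - (y - x) * osc1 x t.
set g := fun t : R => t ^+ 3 / 3 * (y - x) ^+ 2.
have := @derive_dominated R f (fun t => cos (phase y t) - cos (phase x t)
  - (y - x) * - (t * sin (phase x t))) g (fun t => t ^+ 2 * (y - x) ^+ 2) 0 u u0.
have -> : f u - f 0 = osc0 y u - osc0 x u - (y - x) * osc1 x u.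
  by rewrite /f /osc0 /osc1 !primitive0 mulr0 !subr0.
have -> : g u - g 0 = u ^+ 3 / 3 * (y - x) ^+ 2 by rewrite /g; field.
apply => t /andP[t0 _].
- have t1 : -1 < t by lra.
  have := osc0_derive y t1; have := osc0_derive x t1; have := osc1_derive x t1.
  by move=> ? ? ?; rewrite /f; derive_tac; ring.
- by rewrite /g; derive_tac; rewrite /=; field.
- have := cos_taylor (phase x t) (phase y t).
  rewrite phaseB exprMn [leRHS]mulrC.
  by rewrite (_ : (y - x) * t * _ = - ((y - x) * - (t * sin (phase x t)))) //; ring.
Qed.

Lemma osc1_derive_param x u : 0 <= u ->
  has_deriv (osc1 ^~ u) x (osc2 x u).
Proof.
move=> u0; apply: (@derive_quadratic _ _ (u ^+ 4 / 4)) => y _.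
set f := fun t => osc1 y t - osc1 x t - (y - x) * osc2 x t.
set g := fun t : R => t ^+ 4 / 4 * (y - x) ^+ 2.
have := @derive_dominated R f (fun t => - (t * sin (phase y t)) - - (t * sin (phase x t))
  - (y - x) * - (t ^+ 2 * cos (phase x t))) g (fun t => t ^+ 3 * (y - x) ^+ 2) 0 u u0.
have -> : f u - f 0 = osc1 y u - osc1 x u - (y - x) * osc2 x u.
  by rewrite /f /osc2 /osc1 !primitive0 mulr0 !subr0.
have -> : g u - g 0 = u ^+ 4 / 4 * (y - x) ^+ 2 by rewrite /g; field.
apply => t /andP[t0 _].
- have t1 : -1 < t by lra.
  have := osc1_derive y t1; have := osc1_derive x t1; have := osc2_derive x t1.
  by move=> ? ? ?; rewrite /f; derive_tac; ring.
- by rewrite /g; derive_tac; rewrite /=; field.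
- have := sin_taylor (phase x t) (phase y t); rewrite phaseB => le.
  have -> : - (t * sin (phase y t)) - - (t * sin (phase x t))
    - (y - x) * - (t ^+ 2 * cos (phase x t))
    = - t * (sin (phase y t) - sin (phase x t) - (y - x) * t * cos (phase x t)) by ring.
  rewrite normrM normrN (ger0_norm t0) [leRHS](_ : _ = t * ((y - x) * t) ^+ 2); last by ring.
  by rewrite ler_wpM2l.
Qed.

(** The Airy equation before the limit: (t^2 + x) cos(phase) is the derivative of sin(phase). The
    boundary term keeps oscillating as u grows. *)
Lemma osc2E x u : 0 <= u -> osc2 x u = x * osc0 x u - sin (phase x u).
Proof.
move=> u0; apply/eqP; rewrite -subr_eq0 -normr_le0.
set f := fun t => osc2 x t - (x * osc0 x t - sin (phase x t)).
have f0 : f 0 = 0.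
  by rewrite /f /osc2 /osc0 !primitive0 /phase expr0n /= mul0r !mulr0 addr0 sin0 !subr0.
have := @derive_dominated R f (fun=> 0) (fun=> 0) (fun=> 0) 0 u u0.
rewrite f0 subrr subr0; apply => t /andP[t0 _].
- have t1 : -1 < t by lra.
  have := osc0_derive x t1; have := osc2_derive x t1; have := phase_derive x t.
  by move=> ? ? ?; rewrite /f; derive_tac; ring.
- exact: derive_const.
- by rewrite normr0.
Qed.

Lemma phase_slope_ge x u t : 1 <= u -> 2 * `|x| <= u ^+ 2 -> u <= t ->
  t ^+ 2 / 2 <= t ^+ 2 + x.
Proof.
move=> u1 xu ut.
have : u ^+ 2 <= t ^+ 2 by rewrite ler_sqr ?nnegrE; lra.
have := ler_norm (- x); rewrite normrN; lra.
Qed.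

Lemma phase_slope_gt0 x u t : 1 <= u -> 2 * `|x| <= u ^+ 2 -> u <= t ->
  0 < t ^+ 2 + x.
Proof.
move=> u1 xu ut; apply: lt_le_trans (phase_slope_ge u1 xu ut).
by rewrite divr_gt0// exprn_gt0//; lra.
Qed.

Lemma phase_slope_sqr_ge x u t : 1 <= u -> 2 * `|x| <= u ^+ 2 -> u <= t ->
  2 * t ^+ 2 <= 8 / t ^+ 2 * (t ^+ 2 + x) ^+ 2.
Proof.
move=> u1 xu ut; have t0 : 0 < t by lra.
have -> : 8 / t ^+ 2 * (t ^+ 2 + x) ^+ 2 = 8 * ((t ^+ 2 + x) / t) ^+ 2.
  by field; rewrite lt0r_neq0.
have : t / 2 <= (t ^+ 2 + x) / t.
  by rewrite ler_pdivlMr// mulrAC -expr2 (phase_slope_ge u1 xu ut).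
rewrite -ler_sqr ?nnegrE ?divr_ge0 ?(ltW (phase_slope_gt0 u1 xu ut)) ?(ltW t0)//.
by rewrite expr_div_n; lra.
Qed.

Lemma phase_slope_div_le x u t : 1 <= u -> 2 * `|x| <= u ^+ 2 -> u <= t ->
  t / (t ^+ 2 + x) <= 2 / t.
Proof.
move=> u1 xu ut; have t0 : 0 < t by lra.
rewrite ler_pdivrMr ?(phase_slope_gt0 u1 xu ut)// mulrAC ler_pdivlMr//.
by have := phase_slope_ge u1 xu ut; rewrite -expr2; lra.
Qed.

(** Integration by parts: [h] is the boundary term and what remains has a derivative of order 1 /
    t^2, with primitive - 8 / t. The two boundary values add at most 4 / u, so 12 is generous. *)
Lemma tail_bound (f f' h : R -> R) u v : 1 <= u -> u <= v ->
  (forall t, u <= t -> has_deriv (fun t => f t - h t) t (f' t)) ->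
  (forall t, u <= t -> `|f' t| <= 8 / t ^+ 2) ->
  (forall t, u <= t -> `|h t| <= 2 / t) ->
  `|f v - f u| <= 12 / u.
Proof.
move=> u1 uv fd fle hle.
have : `|(f v - h v) - (f u - h u)| <= - (8 / v) - - (8 / u).
  apply: (@derive_dominated R (fun t => f t - h t) f' (fun t => - (8 / t))
    (fun t => 8 / t ^+ 2) u v uv) => t /andP[ut _].
  - exact: fd.
  - by have t0 : t != 0 by [rewrite gt_eqF//; lra]; derive_tac => //; field.
  - exact: fle.
have := hle _ (lexx u); have := hle _ uv.
have : 2 / v <= 2 / u by rewrite ler_pM2l// lef_pV2// posrE; lra.
have -> : 8 / v = 4 * (2 / v) by ring.
have -> : 8 / u = 4 * (2 / u) by ring.
have -> : 12 / u = 6 * (2 / u) by ring.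
move=> huv hv hu; move: hv hu; rewrite !ler_norml.
have : 0 < 2 / v by rewrite divr_gt0//; lra.
lra.
Qed.

Lemma osc0_tail x u v : 1 <= u -> 2 * `|x| <= u ^+ 2 -> u <= v ->
  `|osc0 x v - osc0 x u| <= 12 / u.
Proof.
move=> u1 xu uv; apply: (@tail_bound (osc0 x)
  (fun t => sin (phase x t) * (2 * t / (t ^+ 2 + x) ^+ 2))
  (fun t => sin (phase x t) / (t ^+ 2 + x))) => // t ut;
  have q0 := phase_slope_gt0 u1 xu ut.
- have t1 : -1 < t by lra.
  have := osc0_derive x t1; have := phase_derive x t => ? ?.
  by have q1 := lt0r_neq0 q0; derive_tac => //; field.
- have t0 : 0 < t by lra.
  rewrite normrM -[leRHS]mul1r ler_pM// ?sin_max//.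
  rewrite ger0_norm ?divr_ge0 ?sqr_ge0//; last by lra.
  rewrite ler_pdivrMr ?exprn_gt0//; apply: le_trans (phase_slope_sqr_ge u1 xu ut).
  by rewrite ler_pM2l// expr2 ler_peMr//; lra.
- have t0 : 0 < t by lra.
  rewrite normrM normfV (ger0_norm (ltW q0)).
  apply: le_trans (phase_slope_div_le u1 xu ut); rewrite ler_pM2r ?invr_gt0//.
  by apply: le_trans (sin_max _) _; lra.
Qed.

Lemma osc1_tail x u v : 1 <= u -> 2 * `|x| <= u ^+ 2 -> u <= v ->
  `|osc1 x v - osc1 x u| <= 12 / u.
Proof.
move=> u1 xu uv; apply: (@tail_bound (osc1 x)
  (fun t => cos (phase x t) * ((t ^+ 2 - x) / (t ^+ 2 + x) ^+ 2))
  (fun t => t * cos (phase x t) / (t ^+ 2 + x))) => // t ut;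
  have q0 := phase_slope_gt0 u1 xu ut.
- have t1 : -1 < t by lra.
  have := osc1_derive x t1; have := phase_derive x t => ? ?.
  by have q1 := lt0r_neq0 q0; derive_tac => //; field.
- have t0 : 0 < t by lra.
  have tx : 0 <= t ^+ 2 - x <= 2 * t ^+ 2.
    have : u ^+ 2 <= t ^+ 2 by rewrite ler_sqr ?nnegrE//; lra.
    move: xu; have := ler_norm x; have := ler_norm (- x); rewrite normrN.
    have := sqr_ge0 t; lra.
  case/andP: tx => tx0 tx.
  rewrite normrM -[leRHS]mul1r ler_pM// ?cos_max//.
  rewrite ger0_norm ?divr_ge0 ?sqr_ge0//.
  by rewrite ler_pdivrMr ?exprn_gt0//; apply: le_trans (phase_slope_sqr_ge u1 xu ut).
- have t0 : 0 < t by lra.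
  rewrite mulrAC normrM ger0_norm; last by rewrite divr_ge0//; lra.
  rewrite -[leRHS]mulr1 ler_pM ?cos_max ?(phase_slope_div_le u1 xu ut)//.
  by rewrite divr_ge0//; lra.
Qed.

Lemma osc0_le x u : 0 <= u -> `|osc0 x u| <= u.
Proof.
move=> u0; have := @derive_dominated R (osc0 x) (fun t => cos (phase x t))
  id (fun=> 1) 0 u u0.
rewrite /osc0 primitive0 !subr0; apply => t /andP[t0 _].
- by apply: osc0_derive; lra.
- exact: derive_var.
- exact: cos_max.
Qed.

Lemma osc1_le x u : 0 <= u -> `|osc1 x u| <= u ^+ 2.
Proof.
move=> u0; have := @derive_dominated R (osc1 x) (fun t => - (t * sin (phase x t)))
  (fun t => t ^+ 2) (fun t => 2 * t) 0 u u0.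
rewrite /osc1 primitive0 expr0n !subr0; apply => t /andP[t0 _].
- by apply: osc1_derive; lra.
- by derive_tac; rewrite /=; ring.
- rewrite normrN normrM (ger0_norm t0) mulrC ler_wpM2r//.
  by apply: le_trans (sin_max _) _; lra.
Qed.

(** For x > 0 the phase has no stationary point, so the integration by parts of the tail can start
    at 0, where its boundary term vanishes. *)
Lemma osc0_decay x u : 0 < x -> 0 <= u -> `|osc0 x u| <= 1 / x.
Proof.
move=> x0 u0.
have q0 t : 0 < t ^+ 2 + x by rewrite ltr_wpDl ?sqr_ge0.
pose f t := osc0 x t - sin (phase x t) / (t ^+ 2 + x).
have f0 : f 0 = 0.
  by rewrite /f /osc0 primitive0 /phase expr0n /= mul0r mulr0 !add0r sin0 mul0r ?oppr0 ?subr0.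
have : `|f u - f 0| <= - (u ^+ 2 + x)^-1 - - (0 ^+ 2 + x)^-1.
  apply: (@derive_dominated R f
    (fun t => sin (phase x t) * (2 * t / (t ^+ 2 + x) ^+ 2))
    (fun t => - (t ^+ 2 + x)^-1) (fun t => 2 * t / (t ^+ 2 + x) ^+ 2) 0 u u0) => t /andP[t0 _].
  - have t1 : -1 < t by lra.
    have := osc0_derive x t1; have := phase_derive x t => ? ?.
    by rewrite /f; derive_tac; rewrite ?lt0r_neq0//; field; rewrite lt0r_neq0.
  - by derive_tac; rewrite ?lt0r_neq0//; field; rewrite lt0r_neq0.
  - rewrite normrM -[leRHS]mul1r ler_pM// ?sin_max//.
    by rewrite ger0_norm// divr_ge0 ?sqr_ge0//; lra.
rewrite f0 expr0n add0r subr0 /f.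
have : `|sin (phase x u) / (u ^+ 2 + x)| <= (u ^+ 2 + x)^-1.
  by rewrite normrM normfV (gtr0_norm (q0 u)) ler_piMl ?sin_max// invr_ge0 ltW.
by rewrite div1r !ler_norml; lra.
Qed.

Lemma cvg_pinfty_tail (f : R -> R) (a C : R) : 1 <= a -> 0 <= C ->
  (forall u v, a <= u -> u <= v -> `|f v - f u| <= C / u) ->
  f u @[u --> +oo] --> lim (f u @[u --> +oo]) /\
  forall u, a <= u -> `|lim (f u @[u --> +oo]) - f u| <= C / u.
Proof.
move=> a1 C0 le.
have fc : f u @[u --> +oo] --> lim (f u @[u --> +oo]).
  apply/cauchy_cvgP/cauchy_exP => e e0.
  pose u := Num.max a (C / e + 1).
  have ua : a <= u by rewrite le_max lexx.
  have ue : C / e + 1 <= u by rewrite le_max lexx orbT.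
  exists (f u); rewrite /= nbhs_filterE.
  near=> v; rewrite /ball /= distrC; apply: le_lt_trans (le u v ua _) _.
    by near: v; apply: nbhs_pinfty_ge; exact: num_real.
  rewrite ltr_pdivrMr; last by lra.
  by rewrite mulrC -ltr_pdivrMr//; lra.
split=> // u ua; apply/ler_addgt0Pl => e e0.
have {}fc := fc; move/cvgrPdist_le : fc => /(_ _ e0) fe.
near (pinfty_nbhs R) => v; rewrite -[X in `|X|](subrKA (f v)).
apply: le_trans (ler_normD _ _) _; rewrite lerD//.
  by near: v.
by apply: le => //; near: v; apply: nbhs_pinfty_ge; exact: num_real.
Unshelve. all: by end_near. Qed.

(** Lets u tend to infinity in an estimate with error D / u; all truncations are removed this
    way. *)
Lemma le_of_tail (s C D a : R) : 1 <= a ->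
  (forall u, a <= u -> s <= C + D / u) -> s <= C.
Proof.
move=> a1 le; apply/ler_addgt0Pr => e e0.
pose u := Num.max a (`|D| / e).
have ua : a <= u by rewrite le_max lexx.
have ue : `|D| / e <= u by rewrite le_max lexx orbT.
apply: le_trans (le u ua) _; rewrite lerD2l ler_pdivrMr; last by lra.
by move: ue; rewrite ler_pdivrMr// mulrC; apply: le_trans; exact: ler_norm.
Qed.

Definition osc0_lim x := lim (osc0 x u @[u --> +oo]).
Definition osc1_lim x := lim (osc1 x u @[u --> +oo]).

(* Beyond this point the phase has no stationary point, for all parameters
   within distance 1 of x. *)
Definition osc_cut x : R := 2 * `|x| + 3.

Lemma osc_cut_ge1 x : 1 <= osc_cut x.
Proof. by rewrite /osc_cut; have := normr_ge0 x; lra. Qed.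

Lemma osc_cutP x z u : `|z - x| <= 1 -> osc_cut x <= u -> 2 * `|z| <= u ^+ 2.
Proof.
move=> zx; rewrite /osc_cut => xu.
have : `|z| <= `|z - x| + `|x| by rewrite -[in leLHS](subrK x z) ler_normD.
have := normr_ge0 x; nra.
Qed.

Lemma osc0_limP x z u : `|z - x| <= 1 -> osc_cut x <= u ->
  `|osc0_lim z - osc0 z u| <= 12 / u.
Proof.
move=> zx xu; apply: (@cvg_pinfty_tail (osc0 z) (osc_cut x) 12 _ _ _).2 => //.
- exact: osc_cut_ge1.
- move=> u' v ? ?; apply: osc0_tail => //; last exact: osc_cutP zx _.
  by have := osc_cut_ge1 x; lra.
Qed.

Lemma osc1_limP x z u : `|z - x| <= 1 -> osc_cut x <= u ->
  `|osc1_lim z - osc1 z u| <= 12 / u.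
Proof.
move=> zx xu; apply: (@cvg_pinfty_tail (osc1 z) (osc_cut x) 12 _ _ _).2 => //.
- exact: osc_cut_ge1.
- move=> u' v ? ?; apply: osc1_tail => //; last exact: osc_cutP zx _.
  by have := osc_cut_ge1 x; lra.
Qed.

Lemma osc0_cvg x : osc0 x u @[u --> +oo] --> osc0_lim x.
Proof.
apply: (@cvg_pinfty_tail (osc0 x) (osc_cut x) 12 _ _ _).1 => //.
- exact: osc_cut_ge1.
- move=> u' v ? ?; apply: osc0_tail => //.
    by have := osc_cut_ge1 x; lra.
  by apply: (@osc_cutP x) => //; rewrite subrr normr0.
Qed.

Lemma osc0_bounded x z u : `|z - x| <= 1 -> osc_cut x <= u ->
  `|osc0 z u| <= osc_cut x + 12.
Proof.
move=> zx xu; have x1 := osc_cut_ge1 x.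
have := osc0_tail x1 (osc_cutP zx (lexx _)) xu.
have : `|osc0 z (osc_cut x)| <= osc_cut x by apply: osc0_le; lra.
have : 12 / osc_cut x <= 12 by rewrite ler_pdivrMr; lra.
by rewrite !ler_norml; lra.
Qed.

Lemma osc1_bounded x z u : `|z - x| <= 1 -> osc_cut x <= u ->
  `|osc1 z u| <= osc_cut x ^+ 2 + 12.
Proof.
move=> zx xu; have x1 := osc_cut_ge1 x.
have := osc1_tail x1 (osc_cutP zx (lexx _)) xu.
have : `|osc1 z (osc_cut x)| <= osc_cut x ^+ 2 by apply: osc1_le; lra.
have : 12 / osc_cut x <= 12 by rewrite ler_pdivrMr; lra.
by rewrite !ler_norml; lra.
Qed.

Lemma phase_derive_param z u : has_deriv (phase ^~ u) z u.
Proof. by rewrite /phase; derive_tac; ring. Qed.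

(* The boundary terms remove the parts of the partial integrals that oscillate
   without decaying after differentiation. *)
Lemma osc0_reg_derive z u : 1 <= u ->
  has_deriv (fun z => osc0 z u - sin (phase z u) / u ^+ 2) z
    (osc1 z u - cos (phase z u) / u).
Proof.
move=> u1; have := phase_derive_param z u => ?.
have u0 : 0 <= u by lra.
have := osc0_derive_param z u0 => ?.
by derive_tac; field; rewrite gt_eqF//; lra.
Qed.

Lemma osc1_reg_derive z u : 1 <= u ->
  has_deriv (fun z => osc1 z u - cos (phase z u) / u) z (z * osc0 z u).
Proof.
move=> u1; have := phase_derive_param z u => ?.
have u0 : 0 <= u by lra.
have := osc1_derive_param z u0 => ?.
by derive_tac; rewrite osc2E//; field; rewrite gt_eqF//; lra.
Qed.

Lemma osc2_reg_derive z u : 0 <= u ->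
  has_deriv (fun z => z * osc0 z u) z (osc0 z u + z * osc1 z u).
Proof. by move=> u0; have := osc0_derive_param z u0 => ?; derive_tac; ring. Qed.

Lemma ler_norm_dist1 x y z : `|y - x| <= 1 -> `|z - x| <= `|y - x| ->
  `|z - x| <= 1 /\ `|z| <= `|x| + 1.
Proof.
move=> yx zx; have zx1 := le_trans zx yx; split=> //.
have : `|z| <= `|z - x| + `|x| by rewrite -[in leLHS](subrK x z) ler_normD.
lra.
Qed.

(** Taylor's bound is applied at finite u to the functions corrected by boundary terms, whose second
    derivative z * osc0 z u is bounded uniformly in u. *)
Lemma osc0_lim_derive x : has_deriv osc0_lim x (osc1_lim x).
Proof.
apply: (@derive_quadratic _ _ ((`|x| + 1) * (osc_cut x + 12))) => y yx.
(* 39 counts three truncation errors of 12 / u and three boundary terms of at most 1 / u. *)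
apply: (@le_of_tail _ _ 39 (osc_cut x)) => [|u xu]; first exact: osc_cut_ge1.
have u1 : 1 <= u by have := osc_cut_ge1 x; lra.
pose G z := osc0 z u - sin (phase z u) / u ^+ 2.
pose G1 z := osc1 z u - cos (phase z u) / u.
have le : `|G y - G x - (y - x) * G1 x| <=
    (`|x| + 1) * (osc_cut x + 12) * (y - x) ^+ 2.
  apply: (@taylor2_le _ G G1 (fun z => z * osc0 z u)) => z zx.
  - exact: osc0_reg_derive.
  - exact: osc1_reg_derive.
  - have [zx1 zx2] := ler_norm_dist1 yx zx.
    by rewrite normrM ler_pM ?(osc0_bounded zx1).
have xx : `|x - x| <= 1 by rewrite subrr normr0.
have ly := osc0_limP yx xu; have lx := osc0_limP xx xu.
have l1 : `|(y - x) * (osc1_lim x - osc1 x u)| <= 12 / u.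
  by rewrite normrM -[leRHS]mul1r ler_pM// (osc1_limP xx).
have sle z : `|sin (phase z u) / u ^+ 2| <= 1 / u.
  rewrite normrM -[1]mulr1 -mulrA ler_pM ?sin_max// mul1r.
  rewrite ger0_norm ?invr_ge0 ?sqr_ge0//.
  by rewrite lef_pV2 ?posrE ?exprn_gt0//; nra.
have cle : `|(y - x) * (cos (phase x u) / u)| <= 1 / u.
  rewrite normrM -[1]mulr1 -mulrA ler_pM// mul1r normrM -[leRHS]mul1r.
  by rewrite ler_pM ?cos_max// normfV ger0_norm//; lra.
have sy := sle y; have sx := sle x.
have -> : 39 / u = 3 * (12 / u) + 3 * (1 / u) by ring.
move: le ly lx l1 sy sx cle; rewrite /G /G1 !mulrBr !ler_norml; lra.
Qed.

Lemma osc1_lim_derive x : has_deriv osc1_lim x (x * osc0_lim x).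
Proof.
apply: (@derive_quadratic _ _
  (osc_cut x + 12 + (`|x| + 1) * (osc_cut x ^+ 2 + 12))) => y yx.
(* Two truncation errors of 12 / u, two boundary terms of at most 1 / u, and the error of x *
   osc0. *)
apply: (@le_of_tail _ _ (26 + `|x| * 12) (osc_cut x)) => [|u xu].
  exact: osc_cut_ge1.
have u1 : 1 <= u by have := osc_cut_ge1 x; lra.
pose G z := osc1 z u - cos (phase z u) / u.
have le : `|G y - G x - (y - x) * (x * osc0 x u)| <=
    (osc_cut x + 12 + (`|x| + 1) * (osc_cut x ^+ 2 + 12)) * (y - x) ^+ 2.
  apply: (@taylor2_le _ G (fun z => z * osc0 z u)
    (fun z => osc0 z u + z * osc1 z u)) => z zx.
  - exact: osc1_reg_derive.
  - by apply: osc2_reg_derive; lra.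
  - have [zx1 zx2] := ler_norm_dist1 yx zx.
    apply: le_trans (ler_normD _ _) _; rewrite lerD ?(osc0_bounded zx1)//.
    by rewrite normrM ler_pM ?(osc1_bounded zx1).
have xx : `|x - x| <= 1 by rewrite subrr normr0.
have ly := osc1_limP yx xu; have lx := osc1_limP xx xu.
have l1 : `|(y - x) * (x * (osc0_lim x - osc0 x u))| <= `|x| * (12 / u).
  rewrite normrM -[leRHS]mul1r ler_pM// normrM ler_wpM2l//.
  exact: (osc0_limP xx).
have cle z : `|cos (phase z u) / u| <= 1 / u.
  rewrite normrM ler_pM ?cos_max// normfV ger0_norm//; lra.
have cy := cle y; have cx := cle x.
have -> : (26 + `|x| * 12) / u = 2 * (12 / u) + 2 * (1 / u) + `|x| * (12 / u) by ring.
move: le ly lx l1 cy cx; rewrite /G !mulrBr !ler_norml; lra.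
Qed.

Lemma osc0_lim_decay x : 0 < x -> `|osc0_lim x| <= 1 / x.
Proof.
move=> x0; apply: (@le_of_tail _ _ 12 (osc_cut x)) => [|u xu].
  exact: osc_cut_ge1.
have u0 : 0 <= u by have := osc_cut_ge1 x; lra.
have xx : `|x - x| <= 1 by rewrite subrr normr0.
have := osc0_decay x0 u0; have := osc0_limP xx xu.
by rewrite !ler_norml; lra.
Qed.

(* -osc1 0 u = int_0^u t sin(t^3/3) dt, and integrating by parts against
   (1 - cos(t^3/3))' exhibits it as an increasing function up to O(1/u). *)
Lemma osc1_lim0_lt0 : osc1_lim 0 < 0.
Proof.
pose M u := - osc1 0 u - (1 - cos (phase 0 u)) / u.
pose M' u := (1 - cos (phase 0 u)) / u ^+ 2.
have Md u : 0 < u -> has_deriv M u (M' u).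
  move=> u0; have u1 : -1 < u by lra.
  have := osc1_derive 0 u1; have := phase_derive 0 u => ? ?.
  by rewrite /M /M'; derive_tac; rewrite ?lt0r_neq0//; field; rewrite lt0r_neq0.
have M'ge0 u : 0 <= M' u by rewrite divr_ge0 ?sqr_ge0// subr_ge0 cos_le1.
have Mle u v : 0 < u -> u <= v -> M u <= M v.
  move=> u0 uv; apply: (@derive_ge0_le _ M M') => // x /andP[ux _].
  by apply: Md; lra.
(* [M] has its limit 0 at 0, where its formula is singular; monotonicity is therefore applied from a
   small t, with M t >= - 2 t. *)
have M1 : 0 <= M 1.
  apply/ler_addgt0Pr => e e0.
  pose t := Num.min 1 (e / 2).
  have t1 : t <= 1 by rewrite ge_min lexx.
  have te : t <= e / 2 by rewrite ge_min lexx orbT.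
  have t0 : 0 < t by rewrite lt_min; apply/andP; split; lra.
  suff : - (2 * t) <= M t by have := Mle t 1 t0 t1; lra.
  have /ler_normlP[_] := osc1_le 0 (ltW t0) => osc1t.
  have := cos_taylor 0 (phase 0 t); rewrite sin0 mulr0 addr0 cos0 subr0.
  move=> /ler_normlP[ct _].
  have pt : (phase 0 t) ^+ 2 <= t ^+ 2.
    have -> : phase 0 t = t * (t * t) / 3 by rewrite /phase; ring.
    have tt : t * t <= 1 by rewrite mulr_ile1// ltW.
    have tt0 : 0 <= t * t by rewrite mulr_ge0// ltW.
    rewrite ler_sqr ?nnegrE ?divr_ge0 ?mulr_ge0 ?(ltW t0)//.
    rewrite ler_pdivrMr// ler_pM2l//; lra.
  have : (1 - cos (phase 0 t)) / t <= t.
    rewrite ler_pdivrMr// -expr2; lra.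
  by rewrite /M; nra.
(* Strictness is gained on [1, 3/2], where the phase lies in (0, 2], hence in (0, pi], and the
   cosine is below 1. *)
have M2 : 0 < M (3 / 2).
  have h13 : 1 <= 3 / 2 :> R by lra.
  have [|c c13] := @mean_value R M M' 1 (3 / 2) h13.
    by move=> x /andP[x1 _]; apply: Md; lra.
  suff : 0 < M' c by lra.
  have c0 : 0 < c by lra.
  rewrite divr_gt0 ?exprn_gt0// subr_gt0 -[ltRHS]cos0.
  have cp : 0 < phase 0 c <= 2.
    rewrite /phase mul0r addr0 divr_gt0 ?exprn_gt0//= ler_pdivrMr//.
    have : c ^+ 3 <= (3 / 2) ^+ 3 by rewrite lerXn2r ?nnegrE//; lra.
    by lra.
  have p2 := pi_ge2 R.
  by rewrite ltr_cos ?in_itv//=; lra.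
suff : M (3 / 2) <= - osc1_lim 0 by lra.
apply: (@le_of_tail _ _ 12 (osc_cut 0)) => [|u xu]; first exact: osc_cut_ge1.
have u0 : 3 / 2 <= u by move: xu; rewrite /osc_cut normr0; lra.
have xx : `|0 - 0 : R| <= 1 by rewrite subrr normr0.
have := osc1_limP xx xu; rewrite ler_norml => /andP[_ ou].
have h : 0 < 3 / 2 :> R by lra.
have := Mle _ _ h u0; rewrite {2}/M.
have : 0 <= (1 - cos (phase 0 u)) / u.
  by rewrite divr_ge0 ?subr_ge0 ?cos_le1//; lra.
lra.
Qed.

Lemma airyE x : airy x = pi^-1 * osc0_lim x.
Proof.
rewrite /airy; congr (_ * _); apply/cvg_lim => //.
apply: cvg_trans (@osc0_cvg x); apply: near_eq_cvg.
near=> u; have u0 : 0 <= u by near: u; apply: nbhs_pinfty_ge; exact: num_real.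
rewrite /osc0 primitive_integral//.
by move=> t; apply: derive_continuous; apply: derive_cos; exact: phase_derive.
Unshelve. all: by end_near. Qed.

Definition airy1 x : R := pi^-1 * osc1_lim x.

Lemma airy_derive x : has_deriv (@airy R) x (airy1 x).
Proof.
have := osc0_lim_derive x => ?.
have -> : @airy R = fun x => pi^-1 * osc0_lim x by apply/funext => y; rewrite airyE.
by derive_tac; rewrite /airy1; ring.
Qed.

Lemma airy1_derive x : has_deriv airy1 x (x * airy x).
Proof.
have := osc1_lim_derive x => ?.
by rewrite /airy1; derive_tac; rewrite airyE; ring.
Qed.

(** Far from the true exponential decay, but enough to distinguish Ai from the growing solutions. *)
Lemma airy_decay x : 0 < x -> `|airy x| <= 1 / x.
Proof.
move=> x0; rewrite airyE normrM -[leRHS]mul1r ler_pM ?osc0_lim_decay//.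
rewrite ger0_norm ?invr_ge0 ?pi_ge0// invf_le1 ?pi_gt0//.
by have := pi_ge2 R; lra.
Qed.

(** Shows that Ai is not the zero solution; all later nonvanishing of (Ai, Ai') comes from this
    value. *)
Lemma airy1_0_neq0 : airy1 0 != 0.
Proof.
rewrite /airy1 mulf_neq0//; last by rewrite lt_eqF// osc1_lim0_lt0.
by rewrite invr_eq0 gt_eqF// pi_gt0.
Qed.

End Airy.

(** * Perturbations of the Airy equation *)

Section AiryEquation.
Variable R : realType.
Implicit Types (u v V r : R -> R) (s t al e a b L : R).

(** The product u u' has derivative u'^2 + V u^2 >= 0. Once positive it stays so, and u^2 then grows
    at least linearly, against boundedness. *)
Lemma bounded_solution_nincr (u u1 V : R -> R) (s0 B : R) :
  (forall s, has_deriv u s (u1 s)) -> (forall s, has_deriv u1 s (V s * u s)) ->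
  (forall s, s0 <= s -> 0 <= V s) -> (forall s, s0 <= s -> `|u s| <= B) ->
  forall s, s0 <= s -> u s * u1 s <= 0.
Proof.
move=> du du1 V0 uB s1 s01; rewrite leNgt; apply/negP => pos.
set d := u s1 * u1 s1 in pos.
have grow s : s1 <= s -> d <= u s * u1 s.
  move=> s1s; apply: (@derive_ge0_le _ (fun s => u s * u1 s)
    (fun s => u1 s ^+ 2 + V s * u s ^+ 2)) => // t /andP[st _].
    by have := du t; have := du1 t => ? ?; derive_tac; ring.
  by rewrite addr_ge0 ?sqr_ge0// mulr_ge0 ?sqr_ge0// V0// (le_trans s01).
(* Up to this point u^2 has grown by at least 2 (B^2 + 1). *)
pose s := s1 + (B ^+ 2 + 1) / d.
have s1s : s1 <= s by rewrite lerDl divr_ge0 ?addr_ge0 ?sqr_ge0// ltW.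
have : u s1 ^+ 2 - 2 * d * s1 <= u s ^+ 2 - 2 * d * s.
  apply: (@derive_ge0_le _ (fun s => u s ^+ 2 - 2 * d * s)
    (fun s => 2 * (u s * u1 s - d))) => // t /andP[st _].
    by have := du t => ?; derive_tac; rewrite /=; ring.
  by rewrite mulr_ge0// subr_ge0 grow.
have -> : u s ^+ 2 - 2 * d * s = u s ^+ 2 - 2 * d * s1 - 2 * (B ^+ 2 + 1).
  by rewrite /s; field; rewrite gt_eqF.
have : u s ^+ 2 <= B ^+ 2.
  have uBs := uB s (le_trans s01 s1s).
  by rewrite -(real_normK (num_real (u s))) lerXn2r ?nnegrE// (le_trans _ uBs).
have := sqr_ge0 (u s1); have := sqr_ge0 B; lra.
Qed.

(** The squares u^2 and u'^2 have derivatives 2 u u' and 2 V u u', both nonpositive. *)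
Lemma decaying_solution_sqr_le (u u1 V : R -> R) (s0 a b : R) :
  (forall s, has_deriv u s (u1 s)) -> (forall s, has_deriv u1 s (V s * u s)) ->
  (forall s, s0 <= s -> 0 <= V s) -> (forall s, s0 <= s -> u s * u1 s <= 0) ->
  s0 <= a -> a <= b -> `|u b| <= `|u a| /\ `|u1 b| <= `|u1 a|.
Proof.
move=> du du1 V0 u0 sa ab.
rewrite -!(ler_sqr (normr_ge0 _) (normr_ge0 _)) !real_normK ?num_real//; split.
  rewrite -lerN2; apply: (@derive_ge0_le _ (fun s => - u s ^+ 2)
    (fun s => - (2 * (u s * u1 s)))) => // t /andP[st _].
    by have := du t => ?; derive_tac; rewrite /=; ring.
  by have := u0 t (le_trans sa st); lra.
rewrite -lerN2; apply: (@derive_ge0_le _ (fun s => - u1 s ^+ 2)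
  (fun s => - (2 * (V s * (u s * u1 s))))) => // t /andP[st _].
  by have := du1 t => ?; derive_tac; rewrite /=; ring.
by rewrite oppr_ge0 pmulr_rle0// mulr_ge0_le0 ?V0 ?u0// (le_trans sa).
Qed.

(** The energy u^2 + u'^2 + h^2 with an exponential weight is nondecreasing; including h^2 absorbs
    the forcing. It runs backward because solutions are matched at the right end. *)
Lemma gronwall_backward (u u1 V r : R -> R) (a b B h : R) : a <= b ->
  (forall s, a <= s <= b -> has_deriv u s (u1 s)) ->
  (forall s, a <= s <= b -> has_deriv u1 s (V s * u s + r s)) ->
  (forall s, a <= s <= b -> `|V s| <= B) ->
  (forall s, a <= s <= b -> `|r s| <= h) ->
  u a ^+ 2 + u1 a ^+ 2 <=
    expR ((2 + B) * (b - a)) * (u b ^+ 2 + u1 b ^+ 2 + h ^+ 2).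
Proof.
move=> ab du du1 VB rh.
pose E s := expR ((2 + B) * (s - a)) * (u s ^+ 2 + u1 s ^+ 2 + h ^+ 2).
suff : E a <= E b.
  by rewrite /E subrr mulr0 expR0 mul1r; have := sqr_ge0 h; lra.
apply: (@derive_ge0_le _ E (fun s => expR ((2 + B) * (s - a)) *
  ((2 + B) * (u s ^+ 2 + u1 s ^+ 2 + h ^+ 2) +
   (2 * u s * u1 s + 2 * u1 s * (V s * u s + r s))))) => [|s sab|s sab].
- exact: ab.
- by have := du s sab; have := du1 s sab => ? ?; rewrite /E; derive_tac; rewrite /=; ring.
rewrite mulr_ge0 ?expR_ge0//.
have := VB s sab; have := rh s sab => rhs VBs.
have B0 : 0 <= B by apply: le_trans VBs.
have r2 : - (h ^+ 2 + u1 s ^+ 2) <= 2 * u1 s * r s.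
  have : r s ^+ 2 <= h ^+ 2.
    by rewrite -(real_normK (num_real (r s))) lerXn2r ?nnegrE// (le_trans _ rhs).
  by have := sqr_ge0 (u1 s + r s); lra.
have uu : - (u s ^+ 2 + u1 s ^+ 2) <= 2 * u s * u1 s.
  by have := sqr_ge0 (u1 s + u s); lra.
have uV : - (B * (u s ^+ 2 + u1 s ^+ 2)) <= V s * (2 * u s * u1 s).
  have : `|V s * (2 * u s * u1 s)| <= B * (u s ^+ 2 + u1 s ^+ 2).
    rewrite normrM ler_pM// ler_norml uu andTb.
    by have := sqr_ge0 (u1 s - u s); lra.
  by rewrite ler_norml => /andP[].
have Bh : 0 <= B * h ^+ 2 by rewrite mulr_ge0 ?sqr_ge0.
have h0 := sqr_ge0 h.
have -> : 2 * u1 s * (V s * u s + r s) = V s * (2 * u s * u1 s) + 2 * u1 s * r s by ring.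
rewrite mulrDl mulrDr; have := sqr_ge0 (u s); have := sqr_ge0 (u1 s); lra.
Qed.

Lemma airy_le1 s : 1 <= s -> `|airy s| <= 1.
Proof.
move=> s1; have s0 : 0 < s by lra.
by apply: le_trans (airy_decay s0) _; rewrite ler_pdivrMr; lra.
Qed.

Lemma airy_decreasing s : 1 <= s -> airy s * airy1 s <= 0.
Proof.
apply: (@bounded_solution_nincr _ _ id 1 1).
- exact: airy_derive.
- exact: airy1_derive.
- by move=> t t1; lra.
- exact: airy_le1.
Qed.

Lemma airy1_norm_le a b : 1 <= a -> a <= b -> `|airy1 b| <= `|airy1 a| :> R.
Proof.
move=> a1 ab.
apply: (@decaying_solution_sqr_le (@airy R) (@airy1 R) id 1 a b _ _ _ _ a1 ab).2.
- exact: airy_derive.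
- exact: airy1_derive.
- by move=> s s1; lra.
- exact: airy_decreasing.
Qed.

(** The mean value theorem makes Ai' small somewhere in [s, s + 1], and |Ai'| is nonincreasing from
    there on. *)
Lemma airy1_decay s : 1 <= s -> `|airy1 (s + 1)| <= 2 / s.
Proof.
move=> s1; have s0 : 0 < s by lra.
have ss : s <= s + 1 by lra.
have [|c /andP[sc c1]] := @mean_value R (@airy R) (@airy1 R) s (s + 1) ss.
  by move=> *; exact: airy_derive.
rewrite (addrC s) addrK mulr1 addrC => e.
have c1' : 1 <= c by lra.
apply: (le_trans (airy1_norm_le c1' c1)); rewrite -e.
have s10 : 0 < s + 1 by lra.
have := airy_decay s0; have := airy_decay s10.
have : 1 / (s + 1) <= 1 / s by rewrite ler_pM2l// lef_pV2// posrE; lra.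
have -> : 2 / s = 1 / s + 1 / s by field; rewrite gt_eqF.
by rewrite !ler_norml; lra.
Qed.

(** A common zero of Ai and Ai' would propagate back to 0 by the Gronwall estimate without forcing,
    against Ai'(0) != 0. *)
Lemma airy_sqr_gt0 s : 0 <= s -> 0 < airy s ^+ 2 + airy1 s ^+ 2.
Proof.
move=> s0; rewrite lt_neqAle addr_ge0 ?sqr_ge0// andbT; apply/eqP => e.
have := @gronwall_backward (@airy R) (@airy1 R) id (fun=> 0) 0 s s 0 s0.
rewrite -e expr0n addr0 mulr0 => /(_ _ _ _ _)le.
have : airy 0 ^+ 2 + airy1 0 ^+ 2 <= 0 :> R.
  apply: le => t /andP[t0 ts].
  - exact: airy_derive.
  - by rewrite addr0; exact: airy1_derive.
  - by rewrite ger0_norm.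
  - by rewrite normr0.
have : 0 < airy1 0 ^+ 2 :> R.
  by rewrite lt_neqAle sqr_ge0 andbT eq_sym expf_eq0 airy1_0_neq0.
have := sqr_ge0 (@airy R 0); lra.
Qed.

(** What is left of al^2 (x^2 / 4 - N - 1/2), the rescaled potential of the Hermite function at x =
    2 sqrt N + s al, after subtracting s. *)
Definition edge_defect al s : R := al ^+ 4 / 4 * s ^+ 2 - al ^+ 2 / 2.

(* The equation satisfied by Hermite functions in edge coordinates; the defect
   vanishes as al = N^{-1/6} tends to 0. *)
Definition edge_solution al (v v1 : R -> R) : Prop :=
  [/\ forall s, has_deriv v s (v1 s),
      forall s, has_deriv v1 s ((s + edge_defect al s) * v s) &
      exists B, forall s, 1 <= s -> `|v s| <= B].

Lemma edge_defect_le al s L : 0 < al <= 1 -> `|s| <= L ->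
  `|edge_defect al s| <= al ^+ 2 * (L ^+ 2 + 1).
Proof.
move=> /andP[al0 al1] sL.
have s2 : s ^+ 2 <= L ^+ 2.
  by rewrite -(real_normK (num_real s)) lerXn2r ?nnegrE// (le_trans _ sL).
have a20 := sqr_ge0 al.
have a21 : al ^+ 2 <= 1 by rewrite expr_le1// ltW.
have s0 := sqr_ge0 s.
rewrite /edge_defect (_ : al ^+ 4 = al ^+ 2 * al ^+ 2); last by rewrite -exprD.
have : al ^+ 2 * al ^+ 2 * s ^+ 2 <= al ^+ 2 * L ^+ 2.
  by rewrite -mulrA ler_wpM2l//; apply: le_trans s2; rewrite ler_piMl.
have : 0 <= al ^+ 2 * al ^+ 2 * s ^+ 2 by apply: mulr_ge0 => //; apply: mulr_ge0.
by rewrite ler_norml mulrDr; lra.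
Qed.

Lemma edge_potential_ge0 al s : 0 < al <= 1 -> 1 <= s ->
  0 <= s + edge_defect al s.
Proof.
move=> /andP[al0 al1] s1.
have : al ^+ 2 <= 1 by rewrite expr_le1// ltW.
have : 0 <= al ^+ 4 / 4 * s ^+ 2 by rewrite mulr_ge0 ?sqr_ge0// divr_ge0// exprn_ge0// ltW.
by rewrite /edge_defect; lra.
Qed.

Lemma edge_solution_le al v v1 a b : 0 < al <= 1 -> edge_solution al v v1 ->
  1 <= a -> a <= b -> `|v b| <= `|v a| /\ `|v1 b| <= `|v1 a|.
Proof.
move=> al01 [dv dv1 [B vB]].
apply: (@decaying_solution_sqr_le v v1 (fun s => s + edge_defect al s) 1) => //.
- by move=> s; exact: edge_potential_ge0.
- apply: (@bounded_solution_nincr v v1 (fun s => s + edge_defect al s) 1 B) => //.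
  by move=> s; exact: edge_potential_ge0.
Qed.

Lemma le_div_half (x k c : R) : 0 < c -> x <= k / (2 * c) -> x * c <= k / 2.
Proof. by move=> c0; rewrite ler_pdivlMr ?mulr_gt0//; lra. Qed.

(* Both functions decay, so their Wronskian does; and it is nearly constant. *)
Lemma edge_wronskian_small (s0 k : R) : 1 <= s0 -> 0 < k ->
  exists2 dl, 0 < dl <= 1 & forall al v v1, 0 < al <= dl ->
    edge_solution al v v1 ->
    `|v s0 * airy1 s0 - v1 s0 * airy s0| <= k * (`|v s0| + `|v1 s0|).
Proof.
(* At L = t + 1 the Wronskian is at most 3 / t times the norm at s0, so 6 / k makes it half of the
   target; [dl] bounds the drift between s0 and L by the other half. *)
move=> s01 k0; pose t := Num.max s0 (6 / k).
have ts0 : s0 <= t by rewrite le_max lexx.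
have tk : 6 / k <= t by rewrite le_max lexx orbT.
have t0 : 0 < t by lra.
pose L := t + 1; pose c := (L ^+ 2 + 1) * L.
have c0 : 0 < c by rewrite mulr_gt0 ?ltr_wpDl ?sqr_ge0// /L; lra.
exists (Num.min 1 (k / (2 * c))).
  by rewrite lt_min ltr01 ge_min lexx divr_gt0// mulr_gt0.
move=> al v v1 /andP[al0]; rewrite le_min => /andP[al1 alc] sol.
have al01 : 0 < al <= 1 by rewrite al0.
set r : R := `|v s0| + `|v1 s0|.
have sL : s0 <= L by rewrite /L; lra.
have [dv dv1 _] := sol.
pose W s := v s * airy1 s - v1 s * airy s.
have r0 : 0 <= r by rewrite addr_ge0.
(* The terms s v Ai cancel in the derivative of the Wronskian; only the defect remains. *)
have Wd : `|W L - W s0| <= al ^+ 2 * (L ^+ 2 + 1) * r * L - al ^+ 2 * (L ^+ 2 + 1) * r * s0.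
  apply: (@derive_dominated R W (fun s => - (edge_defect al s * (v s * airy s)))
    (fun s => al ^+ 2 * (L ^+ 2 + 1) * r * s) (fun=> al ^+ 2 * (L ^+ 2 + 1) * r)
    s0 L sL) => s /andP[s0s sLs].
  - have := dv s; have := dv1 s; have := airy_derive s; have := airy1_derive s => ? ? ? ?.
    by rewrite /W; derive_tac; ring.
  - by derive_tac; ring.
  - rewrite normrN normrM ler_pM ?edge_defect_le//; first by rewrite ger0_norm; lra.
    rewrite normrM -[leRHS]mulr1 ler_pM//; last by apply: airy_le1; lra.
    have [vs _] := edge_solution_le al01 sol s01 s0s.
    by apply: (le_trans vs); rewrite lerDl.
have [vL v1L] := edge_solution_le al01 sol s01 sL.
have WL : `|W L| <= r * (3 / t).
  have t1 : 1 <= t by lra.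
  have a1L := airy1_decay t1; rewrite -/L in a1L.
  have L0 : 0 < L by rewrite /L; lra.
  have aL : `|airy L| <= 1 / t.
    by apply: le_trans (airy_decay L0) _; rewrite ler_pM2l// lef_pV2// ?posrE// /L; lra.
  have -> : r * (3 / t) = r * (2 / t) + r * (1 / t) by ring.
  rewrite /W; apply: le_trans (ler_normB _ _) _; rewrite (normrM (v L)) (normrM (v1 L)) lerD// ler_pM//.
    by apply: (le_trans vL); rewrite lerDl.
  by apply: (le_trans v1L); rewrite lerDr.
have k3 : r * (3 / t) <= r * (k / 2).
  rewrite ler_wpM2l// ler_pdivrMr//; move: tk; rewrite ler_pdivrMr// => ?.
  by lra.
have k4 : al ^+ 2 * (L ^+ 2 + 1) * r * (L - s0) <= r * (k / 2).
  have : al ^+ 2 * (L ^+ 2 + 1) * (L - s0) <= k / 2.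
    apply: (@le_trans _ _ (al * c)).
      have L2 : 0 <= L ^+ 2 + 1 by rewrite addr_ge0 ?sqr_ge0.
      have al2 : al ^+ 2 <= al by rewrite expr2 ler_piMl// ltW.
      rewrite /c mulrA; apply: ler_pM.
      - by apply: mulr_ge0 => //; exact: sqr_ge0.
      - by rewrite subr_ge0.
      - by rewrite ler_wpM2r.
      - by lra.
    exact: le_div_half.
  move=> /(ler_wpM2l r0); congr (_ <= _); ring.
rewrite -/(W s0); move: Wd WL k3 k4; rewrite -mulrBr mulrDr !ler_norml; nra.
Qed.

(** The coefficient of the orthogonal projection of the Cauchy data (v, v')(s0) on (Ai, Ai')(s0). *)
Definition airy_scale (s0 : R) (v v1 : R -> R) : R :=
  (v s0 * airy s0 + v1 s0 * airy1 s0) / (airy s0 ^+ 2 + airy1 s0 ^+ 2).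

(** A small Wronskian makes the data at s0 nearly parallel to those of Ai. The difference v / l - Ai
    solves the perturbed equation with forcing defect * Ai, and the backward Gronwall estimate
    carries its smallness down to m. *)
Lemma edge_solution_near_airy (m s0 e : R) : 1 <= s0 -> 0 < e ->
  exists2 dl, 0 < dl <= 1 & forall al v v1, 0 < al <= dl ->
    edge_solution al v v1 -> 0 < `|v s0| + `|v1 s0| ->
    airy_scale s0 v v1 != 0 /\
    forall s, m <= s <= s0 ->
      `|v s / airy_scale s0 v v1 - airy s| <= e /\
      `|v1 s / airy_scale s0 v v1 - airy1 s| <= e.
Proof.
move=> s01 e0; have s00 : 0 <= s0 by lra.
have := airy_sqr_gt0 s00; set A := airy s0; set A1 := airy1 s0; set n2 := _ + _ => n20.
pose L : R := `|m| + s0; pose B : R := L + (L ^+ 2 + 1).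
have L0 : 0 <= L by rewrite addr_ge0.
pose X := expR ((2 + B) * (s0 - m)); have X0 : 0 < X by exact: expR_gt0.
pose Y := expR ((2 + L) * (s0 - m)); have Y0 : 0 < Y by exact: expR_gt0.
pose K : R := Num.sqrt (Y * n2).
have K0 : 0 <= K by exact: sqrtr_ge0.
(* The first bound keeps the scale [l] away from 0, the second leaves e^2 / 2 for the initial error
   after amplification by [X]. *)
pose k2 := Num.min (n2 / 4) (e ^+ 2 / (8 * X)).
have k20 : 0 < k2 by rewrite lt_min !divr_gt0 ?exprn_gt0 ?mulr_gt0.
have k2n : 4 * k2 <= n2 by have : k2 <= n2 / 4 by [rewrite ge_min lexx]; lra.
have k2X : X * (4 * k2) <= e ^+ 2 / 2.
  have : k2 <= e ^+ 2 / (8 * X) by rewrite ge_min lexx orbT.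
  by rewrite ler_pdivlMr ?mulr_gt0//; lra.
have sk0 : 0 < Num.sqrt k2 by rewrite sqrtr_gt0.
have [d1 /andP[d10 d11] small] := edge_wronskian_small s01 sk0.
(* The forcing contributes al^4 (c - 1) <= al c, made at most e^2 / 2 by the choice of the threshold
   on al. *)
pose c := X * ((L ^+ 2 + 1) * K) ^+ 2 + 1.
have c0 : 0 < c by rewrite ltr_wpDl// mulr_ge0 ?sqr_ge0// ltW.
exists (Num.min d1 (e ^+ 2 / (2 * c))).
  by rewrite lt_min d10 divr_gt0 ?mulr_gt0 ?exprn_gt0//= ge_min d11.
move=> al v v1 /andP[al0]; rewrite le_min => /andP[ald alc] sol r0.
have al1 : al <= 1 by rewrite (le_trans ald).
have al01 : 0 < al <= 1 by rewrite al0.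
have ald1 : 0 < al <= d1 by rewrite al0.
have := small al v v1 ald1 sol; rewrite -/A -/A1.
set W := v s0 * A1 - v1 s0 * A; set r : R := _ + _ => Wr.
have rr : r ^+ 2 <= 2 * (v s0 ^+ 2 + v1 s0 ^+ 2).
  rewrite -(real_normK (num_real (v s0))) -(real_normK (num_real (v1 s0))).
  by have := sqr_ge0 (`|v s0| - `|v1 s0|); rewrite /r; lra.
have W2 : W ^+ 2 <= k2 * r ^+ 2.
  rewrite -(real_normK (num_real W)) -[k2](sqr_sqrtr (ltW k20)) -exprMn.
  by rewrite lerXn2r ?nnegrE// mulr_ge0 ?sqrtr_ge0// ltW.
set l := airy_scale s0 v v1.
have ln : l * n2 = v s0 * A + v1 s0 * A1 by rewrite /l /airy_scale divfK// gt_eqF.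
(* Lagrange's identity: with a small Wronskian the inner product must be large, hence l != 0. *)
have lagrange : (l * n2) ^+ 2 + W ^+ 2 = (v s0 ^+ 2 + v1 s0 ^+ 2) * n2.
  by rewrite ln /W /n2; ring.
have r20 : 0 < r ^+ 2 by rewrite exprn_gt0.
have l2 : n2 / 4 * r ^+ 2 <= (l * n2) ^+ 2.
  have : r ^+ 2 * n2 <= 2 * (v s0 ^+ 2 + v1 s0 ^+ 2) * n2 by rewrite ler_wpM2r// ltW.
  have : 4 * (k2 * r ^+ 2) <= n2 * r ^+ 2 by rewrite mulrA ler_wpM2r// ltW.
  by move: lagrange W2; lra.
have l0 : l != 0.
  apply/eqP => l0; move: l2; rewrite l0 mul0r expr0n leNgt.
  by rewrite mulr_gt0// divr_gt0.
have l20 : 0 < l ^+ 2 by rewrite lt_neqAle sqr_ge0 andbT eq_sym expf_eq0.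
have Wl : (W / l) ^+ 2 <= 4 * k2 * n2.
  rewrite expr_div_n ler_pdivrMr//; apply: (le_trans W2).
  have -> : 4 * k2 * n2 * l ^+ 2 = k2 * (4 / n2 * (l * n2) ^+ 2).
    by field; rewrite gt_eqF.
  rewrite ler_wpM2l//; first exact: ltW.
  have -> : r ^+ 2 = 4 / n2 * (n2 / 4 * r ^+ 2) by field; rewrite gt_eqF.
  by rewrite ler_wpM2l// divr_ge0// ltW.
pose D s := v s / l - airy s; pose D1 s := v1 s / l - airy1 s.
(* The remainder of the projection is orthogonal to (Ai, Ai')(s0), so its coordinates are multiples
   of the Wronskian. *)
have D0 : D s0 ^+ 2 + D1 s0 ^+ 2 <= 4 * k2.
  have -> : D s0 = A1 * (W / l) / n2.
    rewrite /D -/A; apply: (mulIf (lt0r_neq0 n20)).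
    rewrite divfK ?gt_eqF// mulrBl mulrAC; apply: (mulIf l0).
    have -> : (v s0 * n2 / l - A * n2) * l = v s0 * n2 - A * (l * n2) by field.
    by rewrite ln mulrA divfK// /W /n2; ring.
  have -> : D1 s0 = - A * (W / l) / n2.
    rewrite /D1 -/A1; apply: (mulIf (lt0r_neq0 n20)).
    rewrite divfK ?gt_eqF// mulrBl mulrAC; apply: (mulIf l0).
    have -> : (v1 s0 * n2 / l - A1 * n2) * l = v1 s0 * n2 - A1 * (l * n2) by field.
    by rewrite ln -[RHS]mulrA divfK// /W /n2; ring.
  have -> : (A1 * (W / l) / n2) ^+ 2 + (- A * (W / l) / n2) ^+ 2
      = (W / l) ^+ 2 / n2.
    by rewrite /n2; field; rewrite l0 gt_eqF.
  by rewrite ler_pdivrMr.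
have [dv dv1 _] := sol.
split=> // s /andP[ms ss0].
have sL t : s <= t <= s0 -> `|t| <= L.
  move=> /andP[st ts0]; rewrite /L ler_norml.
  by have := ler_norm (- m); have := normr_ge0 m; rewrite normrN; lra.
have AK t : s <= t <= s0 -> `|airy t| <= K.
  move=> /andP[st ts0].
  rewrite -[leLHS]ger0_norm// -sqrtr_sqr real_normK ?num_real// ler_wsqrtr//.
  have le := @gronwall_backward (@airy R) (@airy1 R) id (fun=> 0) t s0 L 0 ts0.
  have : airy t ^+ 2 + airy1 t ^+ 2 <= expR ((2 + L) * (s0 - t)) * (n2 + 0 ^+ 2).
    apply: le => x /andP[tx xs0].
    - exact: airy_derive.
    - by rewrite addr0; exact: airy1_derive.
    - by apply: sL; rewrite (le_trans st).
    - by rewrite normr0.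
  rewrite expr0n addr0; have : expR ((2 + L) * (s0 - t)) * n2 <= Y * n2.
    by rewrite ler_wpM2r ?(ltW n20)// ler_expR ler_wpM2l ?addr_ge0// lerD2l lerN2 (le_trans ms).
  move=> le1 le2; apply: le_trans (le_trans le2 le1).
  by rewrite lerDl sqr_ge0.
have main : D s ^+ 2 + D1 s ^+ 2 <= e ^+ 2.
  have le := @gronwall_backward D D1 (fun t => t + edge_defect al t)
    (fun t => edge_defect al t * airy t) s s0 B (al ^+ 2 * (L ^+ 2 + 1) * K) ss0.
  have : D s ^+ 2 + D1 s ^+ 2 <= expR ((2 + B) * (s0 - s)) *
      (D s0 ^+ 2 + D1 s0 ^+ 2 + (al ^+ 2 * (L ^+ 2 + 1) * K) ^+ 2).
    apply: le => t ts.
    - have := dv t; have := airy_derive t => ? ?.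
      by rewrite /D; derive_tac; rewrite /D1; ring.
    - have := dv1 t; have := airy1_derive t => ? ?.
      by rewrite /D1; derive_tac; rewrite /D; ring.
    - apply: le_trans (ler_normD _ _) _; rewrite lerD ?sL//.
      apply: le_trans (edge_defect_le al01 (sL t ts)) _.
      by rewrite ler_piMl ?addr_ge0 ?sqr_ge0// expr_le1// ltW.
    - by rewrite normrM ler_pM ?AK// edge_defect_le// sL.
  have h2 : X * (al ^+ 2 * (L ^+ 2 + 1) * K) ^+ 2 <= e ^+ 2 / 2.
    have -> : X * (al ^+ 2 * (L ^+ 2 + 1) * K) ^+ 2 = al ^+ 4 * (c - 1).
      by rewrite /c; ring.
    have : al ^+ 4 * (c - 1) <= al * c.
      rewrite ler_pM ?exprn_ge0 ?(ltW al0)//.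
      + by rewrite /c addrK mulr_ge0 ?sqr_ge0// ltW.
      + by rewrite exprS ler_piMr ?(ltW al0)// exprn_ile1 ?(ltW al0).
      + by rewrite gerBl.
    have : al * c <= e ^+ 2 / 2.
      exact: le_div_half.
    by move=> /[swap]; exact: le_trans.
  have XX : expR ((2 + B) * (s0 - s)) <= X.
    by rewrite ler_expR ler_wpM2l ?lerD2l ?lerN2// !addr_ge0 ?sqr_ge0.
  set Z := D s0 ^+ 2 + D1 s0 ^+ 2 + _ => DZ.
  have Z0 : 0 <= Z by rewrite !addr_ge0 ?sqr_ge0.
  apply: (le_trans DZ); apply: (@le_trans _ _ (X * Z)); first by rewrite ler_wpM2r.
  rewrite /Z mulrDr [leRHS](splitr (e ^+ 2)) lerD// (le_trans _ k2X)//.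
  by rewrite ler_wpM2l// ltW.
rewrite -/(D s) -/(D1 s); split.
- rewrite -[leLHS]ger0_norm// -[e]ger0_norm ?(ltW e0)// -ler_sqr ?nnegrE//.
  by rewrite !real_normK ?num_real//; rewrite (le_trans _ main)// lerDl sqr_ge0.
- rewrite -[leLHS]ger0_norm// -[e]ger0_norm ?(ltW e0)// -ler_sqr ?nnegrE//.
  by rewrite !real_normK ?num_real//; rewrite (le_trans _ main)// lerDr sqr_ge0.
Qed.

End AiryEquation.

(** * Hermite polynomials *)

(** The ring is arbitrary so that x may be real, complex, or the indeterminate, giving values and
    polynomials at once. *)
Fixpoint hermite (A : comNzRingType) (n : nat) (x : A) : A :=
  match n with
  | 0 => 1
  | m.+1 => match m with
            | 0 => x
            | k.+1 => x * hermite m x - m%:R * hermite k x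
            end
  end.

Arguments hermite {A} n x.

Section Hermite.

Lemma hermiteSS (A : comNzRingType) n (x : A) :
  hermite n.+2 x = x * hermite n.+1 x - n.+1%:R * hermite n x.
Proof. by []. Qed.

Lemma hermiteS (A : comNzRingType) n (x : A) :
  hermite n.+1 x = x * hermite n x - n%:R * hermite n.-1 x.
Proof. by case: n => [|n] //=; rewrite mulr1 mul0r subr0. Qed.

Lemma rmorph_hermite (A B : comNzRingType) (f : {rmorphism A -> B}) n x :
  f (hermite n x) = hermite n (f x).
Proof.
elim/ltn_ind: n => -[|[|n]] IH; [exact: rmorph1 | by [] |].
by rewrite !hermiteSS rmorphB !rmorphM rmorph_nat !IH.
Qed.

Lemma horner_hermite (A : comNzRingType) n (x : A) :
  (hermite n 'X).[x] = hermite n x.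
Proof. by rewrite -horner_evalE rmorph_hermite /= horner_evalE hornerX. Qed.

Lemma deriv_hermite (A : comNzRingType) n :
  (hermite n 'X : {poly A})^`() = n%:R * hermite n.-1 'X.
Proof.
elim/ltn_ind: n => -[|[|n]] IH.
- by rewrite derivC mul0r.
- by rewrite derivX mulr1.
- rewrite hermiteSS derivB derivM derivX mul1r -!polyC_natr deriv_mulC !polyC_natr.
  rewrite !IH// [n.+2.-1]/= [n.+1.-1]/=.
  have -> : hermite n.+1 'X = 'X * hermite n 'X - n%:R * hermite n.-1 'X :> {poly A}.
    exact: hermiteS.
  ring.
Qed.

Variable F : numFieldType.
Implicit Types (x y c : F) (a b : nat -> F).

(** Taking sequences instead of points lets one sum serve for S_n and, with [dhermite], for its
    partial derivatives. *)
Definition kernel_sum a b n : F := \sum_(k < n.+1) a k * b k / (k`!)%:R.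

Definition dhermite n x : F := n%:R * hermite n.-1 x.

Lemma fact_neq0 n : (n`!)%:R != 0 :> F.
Proof. by rewrite pnatr_eq0 -lt0n fact_gt0. Qed.

Lemma kernel_sumS a b n : kernel_sum a b n.+1 =
  kernel_sum a b n + a n.+1 * b n.+1 / (n.+1`!)%:R.
Proof. by rewrite /kernel_sum big_ord_recr. Qed.

Lemma kernel_sum0 a b : kernel_sum a b 0 = a 0%N * b 0%N.
Proof. by rewrite /kernel_sum big_ord1 fact0 divr1. Qed.

(** The usual formula with He_n written as He_{n+1}' / (n + 1), the form that becomes a Wronskian of
    Airy functions. *)
Lemma christoffel_darboux n x y :
  hermite n.+1 x * dhermite n.+1 y - dhermite n.+1 x * hermite n.+1 y =
  (x - y) * (n.+1`!)%:R * kernel_sum (hermite ^~ x) (hermite ^~ y) n.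
Proof.
elim: n => [|n IH].
  by rewrite kernel_sum0 /dhermite /= !mulr1 mul1r.
have -> : hermite n.+2 x * dhermite n.+2 y - dhermite n.+2 x * hermite n.+2 y =
    n.+2%:R * ((x - y) * (hermite n.+1 x * hermite n.+1 y) +
      (hermite n.+1 x * dhermite n.+1 y - dhermite n.+1 x * hermite n.+1 y)).
  by rewrite /dhermite !hermiteSS /=; ring.
rewrite IH kernel_sumS.
have -> : (n.+2`!)%:R = n.+2%:R * (n.+1`!)%:R :> F by rewrite factS natrM.
have := fact_neq0 n.+1; set f := (n.+1`!)%:R => f0.
by field.
Qed.

(** Since x - d/dx raises He_k to He_{k+1}, applying it in both variables gives sum_j j He_j(x)
    He_j(y) / j! up to j = n + 1. By Christoffel-Darboux the difference quotient is S_0 + ... +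
    S_{n-1}; with the extra S_n it completes every weight j to n + 1. *)
Lemma kernel_sum_creation n x y : x != y ->
  (x * y + 1) * kernel_sum (hermite ^~ x) (hermite ^~ y) n
  - x * kernel_sum (hermite ^~ x) (dhermite ^~ y) n
  - y * kernel_sum (dhermite ^~ x) (hermite ^~ y) n
  + kernel_sum (dhermite ^~ x) (dhermite ^~ y) n
  + (kernel_sum (hermite ^~ x) (dhermite ^~ y) n
     - kernel_sum (dhermite ^~ x) (hermite ^~ y) n) / (x - y)
  = n.+1%:R * kernel_sum (hermite ^~ x) (hermite ^~ y) n.+1.
Proof.
move=> xy; have xy0 : x - y != 0 by rewrite subr_eq0.
elim: n => [|n IH].
  rewrite !kernel_sumS !kernel_sum0 /dhermite /= (_ : (1`!)%N = 1%N)//.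
  by field.
rewrite !(kernel_sumS _ _ n).
set S := kernel_sum (hermite ^~ x) _ n in IH *; set S01 := kernel_sum _ _ n in IH *.
set S10 := kernel_sum _ _ n in IH *; set S11 := kernel_sum _ _ n in IH *.
have CD := christoffel_darboux n x y; rewrite -/S in CD.
rewrite kernel_sumS; rewrite kernel_sumS -/S in IH *.
have hx := hermiteS n.+1 x; have hy := hermiteS n.+1 y.
rewrite -/(dhermite n.+1 x) in hx; rewrite -/(dhermite n.+1 y) in hy.
rewrite hx hy.
set h := hermite n.+1 x in IH CD *; set h' := dhermite n.+1 x in IH CD *.
set k := hermite n.+1 y in IH CD *; set k' := dhermite n.+1 y in IH CD *.
have f0 := fact_neq0 n.+1; have n20 : n.+2%:R != 0 :> F by rewrite pnatr_eq0.
set f := (n.+1`!)%:R in f0 IH CD *.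
have -> : (n.+2`!)%:R = n.+2%:R * f by rewrite factS natrM.
have -> : n.+2%:R = n.+1%:R + 1 :> F by rewrite -natr1.
rewrite -natr1 in n20; set m := n.+1%:R in n20 IH *.
transitivity (m * (S + h * k / f) + (h * k' - h' * k) / f / (x - y)
  + ((x * h - h') * (y * k - k') + h * k) / f).
  by rewrite -IH; field; rewrite f0.
by rewrite CD; clearbody m; field; rewrite fact_neq0 n20.
Qed.

(* The value of E (det(x - X_n) det(y - X_n)), with a k = He_k(x), b k = He_k(y) and
   c the fourth moment of Q minus 3/4. *)
Definition wigner_sum c a b n : F :=
  \sum_(m < n.+1 | (m.*2 <= n)%N)
     (n`!)%:R * c ^+ m / (m`!)%:R * kernel_sum a b (n - m.*2).

Lemma wigner_sum0 c a b : wigner_sum c a b 0 = a 0%N * b 0%N.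
Proof.
by rewrite /wigner_sum big_mkcond big_ord1 /= kernel_sum0 fact0 expr0 divr1 !mul1r.
Qed.

Lemma wigner_sum_widen c a b n N : (n <= N)%N -> wigner_sum c a b n =
  \sum_(m < N.+1 | (m.*2 <= n)%N)
     (n`!)%:R * c ^+ m / (m`!)%:R * kernel_sum a b (n - m.*2).
Proof.
move=> nN; rewrite /wigner_sum.
rewrite (big_ord_widen_cond N.+1 (fun m => (m.*2 <= n)%N) (fun m =>
  (n`!)%:R * c ^+ m / (m`!)%:R * kernel_sum a b (n - m.*2)))//.
apply: eq_bigl => m; rewrite andb_idr// ltnS; apply: leq_trans.
by rewrite -addnn leq_addr.
Qed.

(** Termwise, [kernel_sum_creation] gives the weight n + 1 - 2 m. The sum of order n - 1, reindexed
    from m to m + 1, supplies the missing 2 m. *)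
Lemma wigner_sum_rec c n x y : x != y ->
  let f a b := wigner_sum c a b n in
  (x * y + 1) * f (hermite ^~ x) (hermite ^~ y)
  - x * f (hermite ^~ x) (dhermite ^~ y)
  - y * f (dhermite ^~ x) (hermite ^~ y)
  + f (dhermite ^~ x) (dhermite ^~ y)
  + (f (hermite ^~ x) (dhermite ^~ y) - f (dhermite ^~ x) (hermite ^~ y)) / (x - y)
  + 2 * c * n%:R * wigner_sum c (hermite ^~ x) (hermite ^~ y) n.-1
  = wigner_sum c (hermite ^~ x) (hermite ^~ y) n.+1.
Proof.
move=> xy /=; set a := hermite ^~ x; set b := hermite ^~ y.
set a' := dhermite ^~ x; set b' := dhermite ^~ y.
set Z := 2 * c * n%:R * _.
rewrite !(@wigner_sum_widen c _ _ n n.+1)//.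
rewrite !mulr_sumr -!sumrN -!big_split/= mulr_suml -big_split /=.
pose S m := if (m.*2 <= n.+1)%N then kernel_sum a b (n.+1 - m.*2) else 0.
transitivity (\sum_(m < n.+2) ((n`!)%:R * c ^+ m / (m`!)%:R * (n.+1%:R - m.*2%:R) * S m)
  + Z).
  congr (_ + _); rewrite big_mkcond; apply: eq_bigr => m _; rewrite /S.
  case: ifPn => [mn|]; last first.
    (* At 2 m = n + 1 the right side has a term that the left lacks, but its weight vanishes. *)
    rewrite -ltnNge leq_eqVlt => /orP[/eqP <-|mn].
      by rewrite subrr mulr0 mul0r.
    by rewrite leqNgt mn mulr0.
  rewrite leqW// subSn// -natrB ?leqW// subSn// -[RHS]mulrA.
  by rewrite /a /b -(kernel_sum_creation _ xy); ring.
have -> : wigner_sum c a b n.+1 =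
    \sum_(m < n.+2) (n.+1`!)%:R * c ^+ m / (m`!)%:R * S m.
  rewrite /wigner_sum big_mkcond; apply: eq_bigr => m _; rewrite /S.
  by case: ifP => //; rewrite mulr0.
suff -> : Z =
    \sum_(m < n.+2) (n`!)%:R * c ^+ m / (m`!)%:R * m.*2%:R * S m.
  rewrite -big_split /=; apply: eq_bigr => m _.
  by rewrite factS natrM; ring.
rewrite /Z big_ord_recl /= mulr0 mul0r add0r {Z}.
case: n {xy} @S => [|n] S; first by rewrite mulr0 mul0r big_ord1 /S mulr0.
rewrite (@wigner_sum_widen c _ _ n n.+1)// mulr_sumr big_mkcond /=.
apply: eq_bigr => m _; rewrite /S doubleS !ltnS.
case: ifP => mn; last by rewrite mulr0.
rewrite !subSS (_ : bump 0 m = m.+1)//.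
have -> : m.*2.+2%:R = 2 * m.+1%:R :> F by rewrite -natrM mul2n.
rewrite (factS n) (factS m) !natrM exprS.
have m0 := fact_neq0 m; have m1 : m.+1%:R != 0 :> F by rewrite pnatr_eq0.
set i := m.+1%:R in m1 *; set g := (m`!)%:R in m0 *; clearbody i g.
by field; rewrite m0 m1.
Qed.

Lemma wigner_sumC c a b n : wigner_sum c a b n = wigner_sum c b a n.
Proof.
apply: eq_bigr => m _; congr (_ * _); apply: eq_bigr => k _.
by rewrite [a k * _]mulrC.
Qed.

(** The sum as a polynomial in its second variable, to be differentiated formally and extended from
    y != x to y = x. *)
Definition wigner_poly c a n : {poly F} :=
  \sum_(m < n.+1 | (m.*2 <= n)%N) ((n`!)%:R * c ^+ m / (m`!)%:R) *:
     \sum_(k < (n - m.*2).+1) (a k / (k`!)%:R) *: hermite k 'X.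

Lemma horner_wigner_poly c a n y :
  (wigner_poly c a n).[y] = wigner_sum c a (hermite ^~ y) n.
Proof.
rewrite horner_sum; apply: eq_bigr => m _; rewrite hornerZ horner_sum.
congr (_ * _); apply: eq_bigr => k _.
by rewrite hornerZ horner_hermite mulrAC.
Qed.

Lemma deriv_wigner_poly c a n y :
  (wigner_poly c a n)^`().[y] = wigner_sum c a (dhermite ^~ y) n.
Proof.
rewrite raddf_sum horner_sum; apply: eq_bigr => m _ /=.
rewrite derivZ hornerZ raddf_sum horner_sum.
congr (_ * _); apply: eq_bigr => k _ /=.
rewrite derivZ hornerZ deriv_hermite hornerM horner_hermite -polyC_natr hornerC.
by rewrite /dhermite mulrAC.
Qed.

End Hermite.

Arguments dhermite {F} n x.

(** * Characteristic polynomial of a bordered matrix *)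

Section Matrices.
Variable C : numFieldType.

Lemma deriv_prod n (f : 'I_n -> {poly C}) : (\prod_(i < n) f i)^`() =
  \sum_(i < n) (f i)^`() * \prod_(j < n | j != i) f j.
Proof.
elim: n f => [|n IH] f; first by rewrite !big_ord0 derivC.
rewrite big_ord_recl derivM IH big_ord_recl; congr (_ + _).
  by rewrite [in RHS]big_mkcond big_ord_recl /= mul1r.
rewrite mulr_sumr; apply: eq_bigr => i _.
rewrite [in RHS]big_mkcond big_ord_recl /= -big_mkcond /= mulrCA.
by congr (_ * (_ * _)); apply: eq_bigl => j; rewrite (inj_eq lift_inj).
Qed.

(** Jacobi's formula, obtained from the Leibniz expansion by sorting permutations by the image of
    the differentiated row. *)
Lemma deriv_det n (M : 'M[{poly C}]_n) : (\det M)^`() =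
  \sum_i \sum_j (M i j)^`() * cofactor M i j.
Proof.
rewrite /determinant raddf_sum /=.
have -> : \sum_i \sum_j (M i j)^`() * cofactor M i j =
    \sum_i \sum_(s : {perm 'I_n}) (M i (s i))^`() *
      ((-1) ^+ s * \prod_(k | k != i) M k (s k)).
  apply: eq_bigr => i _; rewrite [RHS](partition_big (fun s : {perm 'I_n} => s i) xpredT)//=.
  apply: eq_bigr => j _; rewrite expand_cofactor mulr_sumr.
  apply: eq_bigr => s /eqP <-; congr (_ * (_ * _)).
  by apply: eq_bigl => k; rewrite eq_sym.
rewrite exchange_big; apply: eq_bigr => s _ /=.
rewrite -(rmorph_sign (@polyC C)) deriv_mulC deriv_prod mulr_sumr.
by apply: eq_bigr => i _; rewrite mulrCA.
Qed.

Lemma trace_adj_char_poly n (M : 'M[C]_n) :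
  \tr (\adj (char_poly_mx M)) = (char_poly M)^`().
Proof.
rewrite /char_poly deriv_det; apply: eq_bigr => i _; rewrite mxE.
rewrite (bigD1 i)//= big1 ?addr0 => [|j ji]; rewrite !mxE.
  by rewrite eqxx derivB derivX derivC subr0 mul1r.
by rewrite eq_sym (negbTE ji) sub0r derivN derivC oppr0 mul0r.
Qed.

Lemma adj_char_poly_diag n (M : 'M[C]_n.+1) i :
  (\adj (char_poly_mx M)) i i = char_poly (row' i (col' i M)).
Proof.
rewrite mxE /cofactor addnn -mul2n exprM sqrrN !expr1n mul1r.
by rewrite row'_col'_char_poly_mx.
Qed.

(* Schur complement without inverse: multiply by a unitriangular-type matrix
   and cancel the monic polynomial char_poly of the lower right block. *)
Lemma char_poly_border n (M : 'M[C]_(1 + n)) :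
  let Y := drsubmx M in
  char_poly M = ('X - (M 0 0)%:P) * char_poly Y -
    \sum_i \sum_j (M 0 (rshift 1 i))%:P * (M (rshift 1 j) 0)%:P *
      (\adj (char_poly_mx Y)) i j.
Proof.
move=> Y; set A := \adj (char_poly_mx Y).
pose B : 'M[{poly C}]_(1 + n) := char_poly_mx M.
have YE : drsubmx B = char_poly_mx Y.
  by apply/matrixP => i j; rewrite !mxE (inj_eq (@rshift_inj _ _)).
pose u := ursubmx B; pose v := dlsubmx B; pose a := ulsubmx B.
pose T : 'M[{poly C}]_(1 + n) := block_mx (char_poly Y)%:M 0 (- A *m v) 1%:M.
have BT : B *m T = block_mx (char_poly Y *: a - u *m A *m v) u 0 (char_poly_mx Y).
  rewrite -[B]submxK -/u -/v -/a YE /T mulmx_block; congr block_mx.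
  - by rewrite mul_mx_scalar mulNmx mulmxN mulmxA.
  - by rewrite mulmx0 add0r mulmx1.
  - rewrite mul_mx_scalar mulNmx mulmxN mulmxA /A mul_mx_adj mul_scalar_mx.
    by rewrite -/(char_poly Y) subrr.
  - by rewrite mulmx0 add0r mulmx1.
have Y0 : char_poly Y != 0 by exact/monic_neq0/char_poly_monic.
have := congr1 (fun M => \det M) BT; rewrite det_mulmx /T det_lblock det_ublock.
rewrite det1 mulr1 det_scalar expr1 => /(mulIf Y0); rewrite -/(char_poly M) => ->.
rewrite det_mx11 !mxE; congr (_ + _).
  have -> : lshift n 0 = 0 :> 'I_(1 + n) by exact/val_inj.
  by rewrite mulrC eqxx.
congr (- _); transitivity (\sum_j \sum_i u 0 i * A i j * v j 0).
  by apply: eq_bigr => j _; rewrite mxE mulr_suml.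
rewrite exchange_big; apply: eq_bigr => i _; apply: eq_bigr => j _.
rewrite /u /v !mxE.
have -> : lshift n 0 = 0 :> 'I_(1 + n) by exact/val_inj.
have -> : (0 == rshift 1 i) = false by [].
have -> : (rshift 1 j == 0) = false by [].
by rewrite !sub0r; ring.
Qed.

Definition adj_at n (Y : 'M[C]_n) (x : C) : 'M[C]_n := \adj (x%:M - Y).

Lemma horner_char_poly n (Y : 'M[C]_n) x : (char_poly Y).[x] = \det (x%:M - Y).
Proof.
rewrite -horner_evalE /char_poly -det_map_mx; congr (\det _).
by apply/matrixP => i j; rewrite !mxE /= horner_evalE hornerD hornerN hornerMn hornerX hornerC.
Qed.

Lemma horner_adj n (Y : 'M[C]_n) x i j :
  ((\adj (char_poly_mx Y)) i j).[x] = adj_at Y x i j.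
Proof.
rewrite -horner_evalE.
have -> : horner_eval x ((\adj (char_poly_mx Y)) i j) =
    map_mx (horner_eval x) (\adj (char_poly_mx Y)) i j by rewrite [RHS]mxE.
rewrite map_mx_adj; congr (\adj _ i j).
by apply/matrixP => k l; rewrite !mxE /= horner_evalE hornerD hornerN hornerMn hornerX hornerC.
Qed.

Lemma trace_adj_at n (Y : 'M[C]_n) x : \tr (adj_at Y x) = (char_poly Y)^`().[x].
Proof.
rewrite -trace_adj_char_poly /mxtrace horner_sum; apply: eq_bigr => i _.
by rewrite horner_adj.
Qed.

(** The resolvent identity multiplied by both determinants, hence valid also at eigenvalues. *)
Lemma adj_resolvent n (Y : 'M[C]_n) x y : x != y ->
  \tr (adj_at Y x *m adj_at Y y) =
  ((char_poly Y).[x] * (char_poly Y)^`().[y] -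
   (char_poly Y)^`().[x] * (char_poly Y).[y]) / (x - y).
Proof.
move=> xy; have xy0 : x - y != 0 by rewrite subr_eq0.
set A := adj_at Y x; set B := adj_at Y y.
apply: (mulIf xy0); rewrite divfK// mulrC -linearZ /=.
have -> : (x - y) *: (A *m B) = (char_poly Y).[x] *: B - (char_poly Y).[y] *: A.
  have -> : (x - y) *: (A *m B) = A *m (x%:M - Y) *m B - A *m ((y%:M - Y) *m B).
    rewrite -!mulmxA -mulmxBr -mulmxBl opprB addrA subrK.
    by rewrite -raddfB /= mul_scalar_mx -scalemxAr.
  rewrite mul_adj_mx mul_mx_adj -!horner_char_poly mul_scalar_mx mul_mx_scalar.
  by [].
by rewrite raddfB /= !mxtraceZ !trace_adj_at; ring.
Qed.

Lemma poly_ext (p q : {poly C}) : (forall x, p.[x] = q.[x]) -> p = q.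
Proof.
move=> pq; apply/eqP; rewrite -subr_eq0; apply/eqP.
pose rs := [seq (i%:R : C) | i <- iota 0 (size (p - q))].
apply: (@roots_geq_poly_eq0 _ _ rs).
- by apply/allP => x _; rewrite rootE hornerD hornerN pq subrr.
- rewrite map_inj_uniq ?iota_uniq// => i j /eqP; rewrite eqr_nat => /eqP; exact.
- by rewrite size_map size_iota.
Qed.

Lemma poly_ext_but (a : C) (p q : {poly C}) :
  (forall x, x != a -> p.[x] = q.[x]) -> p = q.
Proof.
move=> pq; apply: (mulIf (negbT (polyXsubC_eq0 a))).
apply: poly_ext => x; rewrite !hornerM hornerXsubC.
by have [->|/pq ->] := eqVneq x a; first by rewrite subrr !mulr0.
Qed.

End Matrices.

(** * Mean characteristic polynomials over finite configurations *)

Section WeightedConfigurations.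
Variables (C : numFieldType) (O K : finType) (w : O -> C).
Hypothesis w_sum1 : \sum_o w o = 1.

(* w is a signed weight: the mean is only a linear functional. *)
Definition mean (F : {ffun K -> O} -> C) : C :=
  \sum_(c : {ffun K -> O}) (\prod_k w (c k)) * F c.

Lemma eq_mean F G : F =1 G -> mean F = mean G.
Proof. by move=> FG; apply: eq_bigr => c _; rewrite FG. Qed.

Lemma meanD F G : mean (fun c => F c + G c) = mean F + mean G.
Proof. by rewrite -big_split; apply: eq_bigr => c _; rewrite mulrDr. Qed.

Lemma meanN F : mean (fun c => - F c) = - mean F.
Proof. by rewrite -sumrN; apply: eq_bigr => c _; rewrite mulrN. Qed.

Lemma meanB F G : mean (fun c => F c - G c) = mean F - mean G.
Proof. by rewrite meanD meanN. Qed.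

Lemma meanZ a F : mean (fun c => a * F c) = a * mean F.
Proof. by rewrite mulr_sumr; apply: eq_bigr => c _; rewrite mulrCA. Qed.

Lemma mean_sum (I : finType) (F : I -> _) :
  mean (fun c => \sum_i F i c) = \sum_i mean (F i).
Proof. by rewrite exchange_big; apply: eq_bigr => c _; rewrite mulr_sumr. Qed.

Lemma mean_prod (g : K -> O -> C) :
  mean (fun c => \prod_k g k (c k)) = \prod_k \sum_o w o * g k o.
Proof. by rewrite bigA_distr_bigA; apply: eq_bigr => c _; rewrite big_split. Qed.

Lemma mean_cst a : mean (fun=> a) = a.
Proof.
transitivity (mean (fun=> a * 1)); first by apply: eq_mean => c; rewrite mulr1.
rewrite meanZ; transitivity (a * mean (fun c => \prod_(k : K) 1)).
  by congr (_ * _); apply: eq_mean => c; rewrite big1.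
rewrite (mean_prod (fun _ _ => 1)) big1 ?mulr1// => k _; rewrite -[RHS]w_sum1.
by apply: eq_bigr => o _; rewrite mulr1.
Qed.

Lemma mean_coords p (k_ : 'I_p -> K) (f : 'I_p -> O -> C) : injective k_ ->
  mean (fun c => \prod_i f i (c (k_ i))) = \prod_i \sum_o w o * f i o.
Proof.
move=> kI.
transitivity (mean (fun c => \prod_k \prod_(i | k_ i == k) f i (c k))).
  apply: eq_mean => c; rewrite (partition_big k_ xpredT)//=.
  by apply: eq_bigr => k _; apply: eq_bigr => i /eqP <-.
rewrite (mean_prod (fun k o => \prod_(i | k_ i == k) f i o)).
rewrite [RHS](partition_big k_ xpredT)//=; apply: eq_bigr => k _.
have [i /eqP ik|no] := pickP (fun i => k_ i == k).
  have one : (fun j => k_ j == k) =1 pred1 i.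
    by move=> j; rewrite -ik (inj_eq kI).
  by under eq_bigr do rewrite (eq_bigl _ _ one) big_pred1_eq; rewrite (eq_bigl _ _ one) big_pred1_eq.
rewrite [RHS]big_pred0// -[RHS]w_sum1; apply: eq_bigr => o _.
by rewrite big_pred0 ?mulr1.
Qed.

(* Swapping the coordinates outside J between two independent copies. *)
Lemma mean_indep (J : {pred K}) (F G : {ffun K -> O} -> C) :
  (forall c c' : {ffun K -> O}, (forall k, k \in J -> c k = c' k) -> F c = F c') ->
  (forall c c' : {ffun K -> O}, (forall k, k \notin J -> c k = c' k) -> G c = G c') ->
  mean (fun c => F c * G c) = mean F * mean G.
Proof.
move=> FJ GJ.
pose W (c : {ffun K -> O}) := \prod_k w (c k).
pose glue (c c' : {ffun K -> O}) := [ffun k => if k \in J then c k else c' k].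
pose swap (p : {ffun K -> O} * {ffun K -> O}) := (glue p.1 p.2, glue p.2 p.1).
have swapK : involutive swap.
  move=> [c c']; rewrite /swap /=; congr (_, _); apply/ffunP => k;
    by rewrite !ffunE; case: (k \in J).
have Wswap p : W (swap p).1 * W (swap p).2 = W p.1 * W p.2.
  rewrite /W -!big_split; apply: eq_bigr => k _ /=; rewrite !ffunE.
  by case: ifP => // _; rewrite mulrC.
transitivity (\sum_p W p.1 * W p.2 * (F p.1 * G p.2)); last first.
  rewrite -(pair_bigA _ (fun c c' => W c * W c' * (F c * G c'))) /= mulr_suml.
  by apply: eq_bigr => c _; rewrite mulr_sumr; apply: eq_bigr => c' _; rewrite mulrACA.
rewrite (reindex_inj (inv_inj swapK)) /=.
transitivity (\sum_p W p.1 * W p.2 * (F p.1 * G p.1)).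
  rewrite -(pair_bigA _ (fun c c' => W c * W c' * (F c * G c))) /=.
  apply: eq_bigr => c _; rewrite -/(W c) -[LHS]mulr1 -(mean_cst 1) /mean mulr_sumr.
  by apply: eq_bigr => c' _; rewrite -/(W c') mulr1 mulrAC.
apply: eq_bigr => p _; rewrite Wswap; congr (_ * (_ * _)).
  by apply: FJ => k kJ; rewrite /swap ffunE kJ.
by apply: GJ => k kJ; rewrite /swap ffunE (negbTE kJ).
Qed.

End WeightedConfigurations.

(** * Recursion for the mean of a product of two characteristic polynomials *)

Section WignerRecursion.
Variables (C : numFieldType) (O : finType) (w z zc d : O -> C) (kap : C) (N : nat).
Hypothesis w_sum1 : \sum_o w o = 1.
(** [z] and [zc] stand for an off-diagonal entry and its conjugate, which enter only through these
    joint moments. A standard complex Gaussian has E|z|^4 = 2, so [kap] is half the excess over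
    it. *)
Definition pair_moment (a b : nat) : C := \sum_o w o * (z o ^+ a * zc o ^+ b).
Local Notation mom := pair_moment.
Hypothesis mom10 : mom 1 0 = 0.
Hypothesis mom01 : mom 0 1 = 0.
Hypothesis mom20 : mom 2 0 = 0.
Hypothesis mom11 : mom 1 1 = 1.
Hypothesis mom22 : mom 2 2 = 2 + 2 * kap.
Hypothesis d_mean : \sum_o w o * d o = 0.
Hypothesis d_sqr : \sum_o w o * d o ^+ 2 = 1.

Local Notation config := {ffun 'I_N * 'I_N -> O}.
Local Notation E := (@mean C O ('I_N * 'I_N)%type w).

(** The embedding [r] keeps blocks and principal minors in the same form over one configuration
    space. Entries are ordered by position, not by [r i]. *)
Definition config_mx n (r : 'I_n -> 'I_N) (c : config) : 'M[C]_n :=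
  \matrix_(i, j) if (i < j)%N then z (c (r i, r j))
    else if i == j then d (c (r i, r i)) else zc (c (r j, r i)).

Lemma config_mx_drsubmx n (r : 'I_(1 + n) -> 'I_N) c :
  drsubmx (config_mx r c) = config_mx (fun i => r (rshift 1 i)) c.
Proof.
by apply/matrixP => i j; rewrite !mxE /= ltnS (inj_eq (@rshift_inj _ _)).
Qed.

Lemma config_mx_minor n (r : 'I_n.+1 -> 'I_N) c i :
  row' i (col' i (config_mx r c)) = config_mx (r \o lift i) c.
Proof.
apply/matrixP => j k; rewrite !mxE /= (inj_eq lift_inj).
by rewrite [(bump _ _ < _)%N]ltnNge leq_bump2 -ltnNge.
Qed.

Section Row.
Variables (n : nat) (r : 'I_(1 + n) -> 'I_N).
Hypothesis r_inj : injective r.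

Let u (c : config) i := z (c (r 0, r (rshift 1 i))).
Let v (c : config) i := zc (c (r 0, r (rshift 1 i))).

Lemma mean_row (h : O -> C) (a b : 'I_n -> nat) :
  E (fun c => h (c (r 0, r 0)) * \prod_i (u c i ^+ a i * v c i ^+ b i)) =
  (\sum_o w o * h o) * \prod_i mom (a i) (b i).
Proof.
pose f (i : 'I_(1 + n)) o := match fintype.split i with
  | inl _ => h o | inr m => z o ^+ a m * zc o ^+ b m end.
have kI : injective (fun i => (r 0, r i)) by move=> i j [/r_inj].
transitivity (E (fun c => \prod_i f i (c (r 0, r i)))).
  apply: eq_mean => c; rewrite big_split_ord big_ord1 /= /f (unsplitK (inl _)).
  have -> : lshift n 0 = 0 :> 'I_(1 + n) by exact/val_inj.
  by congr (_ * _); apply: eq_bigr => i _; rewrite (unsplitK (inr _)).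
rewrite (mean_coords w_sum1 f kI) big_split_ord big_ord1 /= /f (unsplitK (inl _)).
by congr (_ * _); apply: eq_bigr => i _; rewrite (unsplitK (inr _)).
Qed.

(** Wick's formula for the mean of u_i v_j u_k v_l, corrected by a cumulant term when all indices
    agree. *)
Let row_pairing (i j k l : 'I_n) : C :=
  (i == j)%:R * (k == l)%:R + (i == l)%:R * (j == k)%:R +
  2 * kap * ((i == j)%:R * (j == k)%:R * (k == l)%:R).

Lemma mom00 : mom 0 0 = 1.
Proof.
by rewrite /pair_moment -[RHS]w_sum1; apply: eq_bigr => o _; rewrite !expr0 !mulr1.
Qed.

Lemma prod_mom4 (i j k l : 'I_n) :
  \prod_(m < n) mom ((m == i) + (m == k))%N ((m == j) + (m == l))%N =
  row_pairing i j k l.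
Proof.
have mom_eq (m m1 m2 : 'I_n) : mom ((m == m1) + (m == m2))%N ((m == m1) + (m == m2))%N =
    if m1 == m2 then if m == m1 then 2 + 2 * kap else 1 else 1.
  have [<-|m12] := eqVneq m1 m2.
    by case: (m == m1); [exact: mom22 | exact: mom00].
  have [->|mm1] := eqVneq m m1; first by rewrite (negbTE m12); exact: mom11.
  by case: (m == m2); [exact: mom11 | exact: mom00].
rewrite /row_pairing; have [<-|ik] := eqVneq i k.
  have [<-|jl] := eqVneq j l.
    have [<-|ij] := eqVneq i j.
      rewrite (bigD1 i)//= big1 => [|m mi]; first by rewrite mom_eq !eqxx /=; ring.
      by rewrite mom_eq eqxx (negbTE mi).
    rewrite (bigD1 i)//= eqxx (negbTE ij) mom20 /=; ring.
  have [ji|ji] := eqVneq j i.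
    rewrite (bigD1 l)//= ji; rewrite ji in jl.
    by rewrite (eq_sym l) (negbTE jl) eqxx mom01 /=; ring.
  rewrite (bigD1 j)//= (negbTE ji) (negbTE jl) eqxx mom01 /=; ring.
have ki : (k == i) = false by rewrite eq_sym; exact: negbTE.
have [<-|ij] := eqVneq i j.
  have [<-|kl] := eqVneq k l.
    rewrite big1 => [|m _]; last by rewrite mom_eq (negbTE ik).
    by rewrite (negbTE ik) /=; ring.
  rewrite (bigD1 k)//= ki eqxx (negbTE kl) mom10 (negbTE ik) /=; ring.
have [<-|il] := eqVneq i l.
  have [->|jk] := eqVneq j k.
    rewrite big1 => [|m _]; first by rewrite ki /=; ring.
    by rewrite [X in mom _ X]addnC mom_eq (negbTE ik).
  rewrite (bigD1 k)//= ki eqxx (eq_sym k j) (negbTE jk) mom10 /=; ring.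
rewrite (bigD1 i)//= eqxx (negbTE ik) (negbTE ij) (negbTE il) mom10 /=; ring.
Qed.

Lemma prod_mom2 (k l : 'I_n) :
  \prod_(m < n) mom (m == k) (m == l) = (k == l)%:R.
Proof.
have [<-|kl] := eqVneq k l.
  by rewrite big1// => m _; case: (m == k); [exact: mom11 | exact: mom00].
by rewrite (bigD1 k)//= eqxx (negbTE kl) mom10 mul0r.
Qed.

Lemma prod_expr_delta (x : 'I_n -> C) i : \prod_m x m ^+ (m == i) = x i.
Proof.
rewrite (bigD1 i)//= eqxx expr1 big1 ?mulr1// => m /negbTE ->.
exact: expr0.
Qed.

Let Y (c : config) := config_mx (fun i => r (rshift 1 i)) c.

Lemma mean_row_indep (F : config -> C) (G : 'M[C]_n -> C) :
  (forall c c' : config, (forall i, c (r 0, r i) = c' (r 0, r i)) -> F c = F c') ->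
  E (fun c => F c * G (Y c)) = E F * E (G \o Y).
Proof.
move=> FJ; apply: (mean_indep w_sum1 (J := [pred k | k.1 == r 0])).
  by move=> c c' cc; apply: FJ => i; apply: cc; rewrite inE.
move=> c c' cc /=; congr (G _); apply/matrixP => i j; rewrite !mxE.
by rewrite !cc// inE /= (inj_eq r_inj).
Qed.

Lemma mean_row0 h (G : 'M[C]_n -> C) :
  E (fun c => h (c (r 0, r 0)) * G (Y c)) = (\sum_o w o * h o) * E (G \o Y).
Proof.
rewrite (mean_row_indep (F := fun c => h (c (r 0, r 0)))) => [|c c' ->//].
congr (_ * _); have := mean_row h (fun=> 0%N) (fun=> 0%N).
have -> : \prod_(i < n) mom 0 0 = 1 by apply: big1 => *; exact: mom00.
rewrite mulr1 => <-.
by apply: eq_mean => c; rewrite big1 ?mulr1// => i _; rewrite !expr0 mulr1.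
Qed.

Lemma mean_row2 h k l (G : 'M[C]_n -> C) :
  E (fun c => h (c (r 0, r 0)) * (u c k * v c l) * G (Y c)) =
  (\sum_o w o * h o) * (k == l)%:R * E (G \o Y).
Proof.
rewrite (mean_row_indep (F := fun c => h (c (r 0, r 0)) * (u c k * v c l))); last first.
  by move=> c c' cc; rewrite /u /v !cc.
congr (_ * _); rewrite -prod_mom2 -mean_row; apply: eq_mean => c.
by rewrite big_split /= !prod_expr_delta.
Qed.

Lemma mean_row4 h i j k l (G : 'M[C]_n -> C) :
  E (fun c => h (c (r 0, r 0)) * (u c i * v c j * (u c k * v c l)) * G (Y c)) =
  (\sum_o w o * h o) * row_pairing i j k l * E (G \o Y).
Proof.
rewrite (mean_row_indep (F := fun c => h (c (r 0, r 0)) *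
  (u c i * v c j * (u c k * v c l)))); last first.
  by move=> c c' cc; rewrite /u /v !cc.
congr (_ * _); rewrite -prod_mom4 -mean_row; apply: eq_mean => c.
under [in RHS]eq_bigr do rewrite !exprD.
by rewrite !big_split /= !prod_expr_delta; ring.
Qed.

Lemma sum_row_pairing (e : 'I_n -> 'I_n -> 'I_n -> 'I_n -> C) :
  \sum_i \sum_j \sum_k \sum_l row_pairing i j k l * e i j k l =
  \sum_i \sum_k e i i k k + \sum_i \sum_j e i j j i +
  2 * kap * \sum_i e i i i i.
Proof.
have delta (f : 'I_n -> C) i : \sum_j (i == j)%:R * f j = f i.
  rewrite (bigD1 i)//= eqxx mul1r big1 ?addr0// => j /negbTE.
  by rewrite eq_sym => ->; rewrite mul0r.
rewrite mulr_sumr -!big_split; apply: eq_bigr => i _ /=.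
rewrite -(delta (fun j => \sum_k e i j k k)) -(delta (fun j => 2 * kap * e i j j j)).
rewrite -!big_split; apply: eq_bigr => j _ /=.
rewrite -(delta (fun k => e i j k i) j) -(delta (fun k => e i j k k) j).
rewrite !mulr_sumr -!big_split; apply: eq_bigr => k _ /=.
rewrite -(delta (fun l => e i j k l) i) -(delta (fun l => e i j k l) k).
rewrite !mulr_sumr -!big_split; apply: eq_bigr => l _ /=.
by rewrite /row_pairing; ring.
Qed.

Lemma char_poly_config_border c x :
  (char_poly (config_mx r c)).[x] =
  (x - d (c (r 0, r 0))) * (char_poly (Y c)).[x] -
  \sum_i \sum_j u c i * v c j * adj_at (Y c) x i j.
Proof.
rewrite char_poly_border hornerD hornerN hornerM hornerXsubC.
rewrite config_mx_drsubmx -/(Y c) mxE ltnn eqxx; congr (_ - _).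
rewrite horner_sum; apply: eq_bigr => i _; rewrite horner_sum; apply: eq_bigr => j _.
by rewrite !hornerM !hornerC horner_adj !mxE.
Qed.

(** In the product of two border formulas the first row is independent of the block. Its second
    moments turn the mixed terms into traces of adjugates, that is, derivatives; by [row_pairing]
    the quartic term becomes tr A tr B, tr AB and the products of diagonal entries. *)
Lemma mean_char_poly_border x y :
  E (fun c => (char_poly (config_mx r c)).[x] * (char_poly (config_mx r c)).[y]) =
  (x * y + 1) * E (fun c => (char_poly (Y c)).[x] * (char_poly (Y c)).[y])
  - x * E (fun c => (char_poly (Y c)).[x] * (char_poly (Y c))^`().[y])
  - y * E (fun c => (char_poly (Y c))^`().[x] * (char_poly (Y c)).[y])
  + E (fun c => (char_poly (Y c))^`().[x] * (char_poly (Y c))^`().[y])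
  + E (fun c => \tr (adj_at (Y c) x *m adj_at (Y c) y))
  + 2 * kap * \sum_i E (fun c => adj_at (Y c) x i i * adj_at (Y c) y i i).
Proof.
pose D c := d (c (r 0, r 0)).
pose p c := (char_poly (Y c)).[x]; pose q c := (char_poly (Y c)).[y].
pose A c := adj_at (Y c) x; pose B c := adj_at (Y c) y.
transitivity (E (fun c => (x - D c) * (y - D c) * (p c * q c)
  - \sum_k \sum_l (x - D c) * (u c k * v c l) * (p c * B c k l)
  - \sum_i \sum_j (y - D c) * (u c i * v c j) * (A c i j * q c)
  + \sum_i \sum_j \sum_k \sum_l
     1 * (u c i * v c j * (u c k * v c l)) * (A c i j * B c k l))).
  apply: eq_mean => c; rewrite !char_poly_config_border -/(D c) -/(p c) -/(q c).
  rewrite -/(A c) -/(B c); set S := \sum_i _; set S' := \sum_i _ in S *.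
  set T := \sum_i \sum_j u c i * v c j * B c i j.
  have -> : \sum_k \sum_l (x - D c) * (u c k * v c l) * (p c * B c k l) =
      (x - D c) * p c * T.
    rewrite mulr_sumr; apply: eq_bigr => i _; rewrite mulr_sumr.
    by apply: eq_bigr => j _; ring.
  have -> : \sum_i \sum_j (y - D c) * (u c i * v c j) * (A c i j * q c) =
      (y - D c) * q c * S.
    rewrite mulr_sumr; apply: eq_bigr => i _; rewrite mulr_sumr.
    by apply: eq_bigr => j _; ring.
  have -> : \sum_i \sum_j \sum_k \sum_l
     1 * (u c i * v c j * (u c k * v c l)) * (A c i j * B c k l) = S * T.
    rewrite mulr_suml; apply: eq_bigr => i _; rewrite mulr_suml.
    apply: eq_bigr => j _; rewrite mulr_sumr; apply: eq_bigr => k _.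
    by rewrite mulr_sumr; apply: eq_bigr => l _; ring.
  by ring.
have dE a : \sum_o w o * (a - d o) = a.
  under eq_bigr do rewrite mulrBr.
  by rewrite sumrB -mulr_suml w_sum1 mul1r d_mean subr0.
have ddE : \sum_o w o * ((x - d o) * (y - d o)) = x * y + 1.
  rewrite -d_sqr -[x * y]mul1r -{1}w_sum1 mulr_suml.
  have -> : \sum_o w o * ((x - d o) * (y - d o)) = \sum_o (w o * (x * y)
      + w o * d o ^+ 2 - (x + y) * (w o * d o)) by apply: eq_bigr => o _; ring.
  by rewrite sumrB big_split /= -mulr_sumr d_mean mulr0 subr0.
have delta (f : 'I_n -> C) i : \sum_j (i == j)%:R * f j = f i.
  rewrite (bigD1 i)//= eqxx mul1r big1 ?addr0// => j /negbTE.
  by rewrite eq_sym => ->; rewrite mul0r.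
have t1 : E (fun c => (x - D c) * (y - D c) * (p c * q c)) =
    (x * y + 1) * E (fun c => p c * q c).
  rewrite -ddE; exact: (mean_row0 (fun o => (x - d o) * (y - d o))
    (fun M => (char_poly M).[x] * (char_poly M).[y])).
have t2 : E (fun c => \sum_k \sum_l (x - D c) * (u c k * v c l) * (p c * B c k l)) =
    x * E (fun c => p c * (char_poly (Y c))^`().[y]).
  rewrite mean_sum; under eq_bigr => k _.
    rewrite mean_sum; under eq_bigr => l _.
      rewrite (mean_row2 (fun o => x - d o) k l
        (fun M => (char_poly M).[x] * adj_at M y k l)) dE -mulrA; over.
    rewrite -mulr_sumr delta; over.
  rewrite -mulr_sumr -mean_sum; congr (_ * _); apply: eq_mean => c /=.
  by rewrite -mulr_sumr -trace_adj_at.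
have t3 : E (fun c => \sum_i \sum_j (y - D c) * (u c i * v c j) * (A c i j * q c)) =
    y * E (fun c => (char_poly (Y c))^`().[x] * q c).
  rewrite mean_sum; under eq_bigr => k _.
    rewrite mean_sum; under eq_bigr => l _.
      rewrite (mean_row2 (fun o => y - d o) k l
        (fun M => adj_at M x k l * (char_poly M).[y])) dE -mulrA; over.
    rewrite -mulr_sumr delta; over.
  rewrite -mulr_sumr -mean_sum; congr (_ * _); apply: eq_mean => c /=.
  by rewrite -mulr_suml -trace_adj_at.
have t4 : E (fun c => \sum_i \sum_j \sum_k \sum_l
     1 * (u c i * v c j * (u c k * v c l)) * (A c i j * B c k l)) =
    E (fun c => (char_poly (Y c))^`().[x] * (char_poly (Y c))^`().[y])
    + E (fun c => \tr (A c *m B c))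
    + 2 * kap * \sum_i E (fun c => A c i i * B c i i).
  pose e i j k l := E (fun c => A c i j * B c k l).
  transitivity (\sum_i \sum_j \sum_k \sum_l row_pairing i j k l * e i j k l).
    rewrite mean_sum; apply: eq_bigr => i _; rewrite mean_sum; apply: eq_bigr => j _.
    rewrite mean_sum; apply: eq_bigr => k _; rewrite mean_sum; apply: eq_bigr => l _.
    rewrite (mean_row4 (fun=> 1) i j k l (fun M => adj_at M x i j * adj_at M y k l)).
    by under eq_bigr do rewrite mulr1; rewrite w_sum1 mul1r.
  rewrite sum_row_pairing; congr (_ + _ + _).
    transitivity (\sum_i E (fun c => \sum_k A c i i * B c k k)).
      by apply: eq_bigr => i _; rewrite mean_sum.
    rewrite -mean_sum; apply: eq_mean => c; rewrite -!trace_adj_at mulr_suml.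
    by apply: eq_bigr => i _; rewrite mulr_sumr.
  transitivity (\sum_i E (fun c => \sum_j A c i j * B c j i)).
    by apply: eq_bigr => i _; rewrite mean_sum.
  by rewrite -mean_sum; apply: eq_mean => c; apply: eq_bigr => i _; rewrite mxE.
by rewrite meanD !meanB t1 t2 t3 t4 !addrA addrAC.
Qed.

Lemma mean_char_poly_border1 x :
  E (fun c => (char_poly (config_mx r c)).[x]) =
  x * E (fun c => (char_poly (Y c)).[x]) - E (fun c => (char_poly (Y c))^`().[x]).
Proof.
pose D (c : config) := d (c (r 0, r 0)).
transitivity (E (fun c => (x - D c) * (char_poly (Y c)).[x] -
    \sum_k \sum_l 1 * (u c k * v c l) * adj_at (Y c) x k l)).
  apply: eq_mean => c; rewrite char_poly_config_border; congr (_ - _).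
  by apply: eq_bigr => i _; apply: eq_bigr => j _; rewrite mul1r.
rewrite meanB (mean_row0 (fun o => x - d o) (fun M => (char_poly M).[x])).
congr (_ * _ - _).
  under eq_bigr do rewrite mulrBr.
  by rewrite sumrB -mulr_suml w_sum1 mul1r d_mean subr0.
rewrite mean_sum; transitivity (\sum_i E (fun c => adj_at (Y c) x i i)).
  apply: eq_bigr => i _; rewrite mean_sum (bigD1 i)//= big1 => [|j /negbTE ji].
    rewrite addr0 (mean_row2 (fun=> 1) i i (fun M => adj_at M x i i)) eqxx mulr1.
    by under eq_bigr do rewrite mulr1; rewrite w_sum1 mul1r.
  rewrite (mean_row2 (fun=> 1) i j (fun M => adj_at M x i j)) eq_sym ji.
  by rewrite mulr0 mul0r.
by rewrite -mean_sum; apply: eq_mean => c; rewrite -trace_adj_at.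
Qed.

End Row.

(** A mean is a finite sum, so both sides are polynomials in y: equality off one point extends to
    that point and to derivatives. *)
Lemma mean_horner_deriv (a : C) (G : config -> C) (F : config -> {poly C}) p :
  (forall y, y != a -> E (fun c => G c * (F c).[y]) = p.[y]) ->
  forall y, E (fun c => G c * (F c).[y]) = p.[y] /\
    E (fun c => G c * (F c)^`().[y]) = p^`().[y].
Proof.
move=> Ep; pose q := \sum_(c : config) ((\prod_k w (c k)) * G c) *: F c.
have qE y : q.[y] = E (fun c => G c * (F c).[y]).
  by rewrite horner_sum; apply: eq_bigr => c _; rewrite hornerZ mulrA.
have -> : p = q by apply: (@poly_ext_but _ a) => y ya; rewrite -Ep// qE.
move=> y; split=> //; rewrite /q raddf_sum horner_sum.
by apply: eq_bigr => c _ /=; rewrite derivZ hornerZ mulrA.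
Qed.

Lemma mean_char_poly n (r : 'I_n -> 'I_N) x : injective r ->
  E (fun c => (char_poly (config_mx r c)).[x]) = hermite n x.
Proof.
elim: n r x => [|n IH] r x rI.
  transitivity (E (fun=> 1)); last exact: mean_cst.
  by apply: eq_mean => c; rewrite horner_char_poly det_mx00.
have rI' : injective (fun i => r (rshift 1 i)) by move=> i j /rI /(@rshift_inj 1 n).
rewrite (mean_char_poly_border1 rI) IH// hermiteS; congr (_ - _).
have [|_] := @mean_horner_deriv (x + 1) (fun=> 1)
    (fun c => char_poly (config_mx (fun i => r (rshift 1 i)) c)) (hermite n 'X) _ x.
  move=> y _; rewrite horner_hermite -(IH _ y rI').
  by apply: eq_mean => c; rewrite mul1r.
rewrite deriv_hermite hornerM horner_hermite -polyC_natr hornerC => <-.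
by apply: eq_mean => c; rewrite mul1r.
Qed.

(** Stated for all injective [r], as the recursion uses it for the lower block and for every
    principal minor of that block. *)
Definition moment_identity n := forall (r : 'I_n -> 'I_N) x y, injective r ->
  E (fun c => (char_poly (config_mx r c)).[x] * (char_poly (config_mx r c)).[y]) =
  wigner_sum kap (hermite ^~ x) (hermite ^~ y) n.

Lemma moment_identity_deriv n : moment_identity n ->
  forall (r : 'I_n -> 'I_N) x y, injective r ->
  let p c := char_poly (config_mx r c) in
  [/\ E (fun c => (p c).[x] * (p c)^`().[y]) =
        wigner_sum kap (hermite ^~ x) (dhermite ^~ y) n,
      E (fun c => (p c)^`().[x] * (p c).[y]) =
        wigner_sum kap (dhermite ^~ x) (hermite ^~ y) n &
      E (fun c => (p c)^`().[x] * (p c)^`().[y]) =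
        wigner_sum kap (dhermite ^~ x) (dhermite ^~ y) n].
Proof.
move=> mi r x y rI p.
have d1 u v : E (fun c => (p c).[u] * (p c)^`().[v]) =
    wigner_sum kap (hermite ^~ u) (dhermite ^~ v) n.
  have [|_ ->] := @mean_horner_deriv (v + 1) (fun c => (p c).[u]) p
      (wigner_poly kap (hermite ^~ u) n) _ v; last exact: deriv_wigner_poly.
  by move=> t _; rewrite horner_wigner_poly mi.
have d2 u v : E (fun c => (p c)^`().[u] * (p c).[v]) =
    wigner_sum kap (dhermite ^~ u) (hermite ^~ v) n.
  by rewrite wigner_sumC -d1; apply: eq_mean => c; rewrite mulrC.
split=> //.
have [|_ ->] := @mean_horner_deriv (y + 1) (fun c => (p c)^`().[x]) p
    (wigner_poly kap (dhermite ^~ x) n) _ y; last exact: deriv_wigner_poly.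
by move=> t _; rewrite horner_wigner_poly d2.
Qed.

(** The diagonal adjugate entries are characteristic polynomials of order n - 1, hence two
    hypotheses. The recursion divides by x - y; the point y = x is recovered by polynomial
    extension. *)
Lemma moment_identity_step n : moment_identity n.-1 -> moment_identity n ->
  moment_identity n.+1.
Proof.
move=> mi0 mi1 r x y rI; rewrite -horner_wigner_poly.
apply: (@mean_horner_deriv x (fun c => (char_poly (config_mx r c)).[x]) _ _ _ y).1.
move=> {}y yx; have xy : x != y by rewrite eq_sym.
have rI' : injective (fun i => r (rshift 1 i)) by move=> i j /rI /(@rshift_inj 1 n).
rewrite horner_wigner_poly -wigner_sum_rec// (mean_char_poly_border rI) mi1//.
have [-> -> ->] := moment_identity_deriv mi1 x y rI'.
congr (_ + _ + _).
  have [<- <- _] := moment_identity_deriv mi1 x y rI'.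
  rewrite -meanB mulrC -meanZ; apply: eq_mean => c.
  by rewrite adj_resolvent// mulrC.
rewrite -[RHS]mulrA; congr (_ * _).
(* For n = 0 the predecessor is 0 again, but its term carries the factor n = 0. *)
case: n mi0 mi1 r rI {rI'} => [|n] mi0 mi1 r rI; first by rewrite big_ord0 mul0r.
rewrite mulr_natl.
transitivity (\sum_(i < n.+1) wigner_sum kap (hermite ^~ x) (hermite ^~ y) n);
  last by rewrite sumr_const card_ord.
apply: eq_bigr => i _.
rewrite -(mi0 (fun j => r (rshift 1 (lift i j))) x y); last first.
  by move=> j k /rI /(@rshift_inj 1 n.+1) /lift_inj.
by apply: eq_mean => c; rewrite -!horner_adj !adj_char_poly_diag config_mx_minor.
Qed.

Theorem mean_char_poly_mul n : moment_identity n.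
Proof.
suff : moment_identity n /\ moment_identity n.+1 by case.
have base : moment_identity 0.
  move=> r x y _; rewrite wigner_sum0 mulr1; transitivity (E (fun=> 1)).
    by apply: eq_mean => c; rewrite !horner_char_poly !det_mx00 mulr1.
  exact: mean_cst.
elim: n => [|n [IH0 IH1]]; first by split=> //; exact: moment_identity_step.
by split=> //; exact: moment_identity_step.
Qed.

End WignerRecursion.

(** * Transfer to the finite model *)

Section IndependentProducts.
Context d (T : measurableType d) (R : realType) (P : probability T R).
Local Open Scope ereal_scope.
Import HBNNSimple.

(** The standard extension: from indicators to simple functions by linearity, then to nonnegative
    functions by monotone convergence. *)
Lemma integral_factor_indic_ext (X : {RV P >-> R}) (h : T -> R) (c : R) :
  measurable_fun setT h -> (forall w, (0 <= h w)%R) ->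
  (forall A : set R, measurable A ->
     \int[P]_w (\1_A (X w) * h w)%:E = \int[P]_w (\1_A (X w))%:E * c%:E) ->
  forall g : R -> R, measurable_fun setT g -> (forall x, (0 <= g x)%R) ->
  \int[P]_w (g (X w) * h w)%:E = \int[P]_w (g (X w))%:E * c%:E.
Proof.
move=> mh h0 ind g mg g0.
have mX : measurable_fun setT X by [].
have mcomp (f : R -> R) : measurable_fun setT f -> measurable_fun setT (fun w => f (X w)).
  by move=> mf; exact: measurableT_comp.
pose good (f : R -> R) := \int[P]_w (f (X w) * h w)%:E = \int[P]_w (f (X w))%:E * c%:E.
have good_simple (s : seq R) (A : R -> set R) :
    (forall r, r \in s -> (0 <= r)%R) -> (forall r, measurable (A r)) ->
    good (fun x => \sum_(r <- s) r * \1_(A r) x)%R.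
  move=> s0 mA; elim: s s0 => [|r s IH] s0.
    rewrite /good; under eq_integral do rewrite big_nil mul0r.
    by under [in RHS]eq_integral do rewrite big_nil; rewrite !integral0 mul0e.
  have r0 : (0 <= r)%R by apply: s0; rewrite mem_head.
  have {}IH := IH (fun t ts => s0 t (mem_behead (s := r :: s) ts)).
  set f := (fun x => \sum_(r <- s) r * \1_(A r) x)%R in IH.
  have f0 x : (0 <= f x)%R.
    rewrite /f big_seq; apply: sumr_ge0 => t ts; apply: mulr_ge0.
      by apply: s0; rewrite inE ts orbT.
    by rewrite indicE ler0n.
  have mf : measurable_fun setT f.
    by apply: measurable_sum => ?; apply: measurable_funM => //; exact: measurable_indic.
  have mi : measurable_fun setT (\1_(A r) : R -> R) by exact: measurable_indic.
  have i0 x : (0 <= (\1_(A r) x : R))%R by rewrite indicE ler0n.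
  rewrite /good; under eq_integral do rewrite big_cons -/(f _) mulrDl -mulrA EFinD EFinM.
  under [in RHS]eq_integral do rewrite big_cons -/(f _) EFinD EFinM.
  have mih : measurable_fun setT (fun w => \1_(A r) (X w) * h w)%R.
    by apply: measurable_funM => //; exact: mcomp.
  have n1 w : setT w -> 0 <= r%:E * (\1_(A r) (X w) * h w)%:E.
    by move=> _; rewrite -EFinM lee_fin mulr_ge0// mulr_ge0.
  have m1 : measurable_fun setT (fun w => r%:E * (\1_(A r) (X w) * h w)%:E).
    by under eq_fun do rewrite -EFinM; apply/measurable_EFinP; exact: measurable_funM.
  have n2 w : setT w -> 0 <= (f (X w) * h w)%:E.
    by move=> _; rewrite lee_fin mulr_ge0.
  have m2 : measurable_fun setT (fun w => (f (X w) * h w)%:E).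
    by apply/measurable_EFinP; apply: measurable_funM => //; exact: mcomp.
  have n3 w : setT w -> 0 <= r%:E * (\1_(A r) (X w))%:E.
    by move=> _; rewrite -EFinM lee_fin mulr_ge0.
  have m3 : measurable_fun setT (fun w => r%:E * (\1_(A r) (X w))%:E).
    under eq_fun do rewrite -EFinM; apply/measurable_EFinP.
    by apply: measurable_funM => //; exact: mcomp.
  have n4 w : setT w -> 0 <= (f (X w))%:E by move=> _; rewrite lee_fin.
  have m4 : measurable_fun setT (fun w => (f (X w))%:E).
    by apply/measurable_EFinP; exact: mcomp.
  rewrite (ge0_integralD _ measurableT n1 m1 n2 m2).
  rewrite (ge0_integralD _ measurableT n3 m3 n4 m4).
  rewrite ge0_muleDl; last 2 first.
  - by apply: integral_ge0 => w _; rewrite -EFinM lee_fin mulr_ge0.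
  - by apply: integral_ge0 => w _; rewrite lee_fin.
  rewrite /good in IH; rewrite IH; congr (_ + _).
  have n5 w : setT w -> 0 <= (\1_(A r) (X w) * h w)%:E by move=> _; rewrite lee_fin mulr_ge0.
  have m5 : measurable_fun setT (fun w => (\1_(A r) (X w) * h w)%:E) by exact/measurable_EFinP.
  have n6 w : setT w -> 0 <= (\1_(A r) (X w) : R)%:E by move=> _; rewrite lee_fin.
  have m6 : measurable_fun setT (fun w => (\1_(A r) (X w) : R)%:E).
    by apply/measurable_EFinP; exact: mcomp.
  rewrite (ge0_integralZl_EFin _ measurableT n5 m5 r0).
  rewrite (ge0_integralZl_EFin _ measurableT n6 m6 r0).
  by rewrite ind// muleA.
have mgE : measurable_fun setT (EFin \o g) by exact/measurable_EFinP.
pose f_ := nnsfun_approx measurableT mgE.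
have f_cvg x : (f_ n x)%:E @[n --> \oo] --> (g x)%:E.
  by apply: cvg_nnsfun_approx => // ? _; rewrite lee_fin.
have good_f n : good (f_ n).
  rewrite /good; under eq_integral do rewrite fimfunE fsbig_finite//=.
  under [in RHS]eq_integral do rewrite fimfunE fsbig_finite//=.
  apply: (good_simple _ (fun r => f_ n @^-1` [set r])) => // r.
  by rewrite in_fset_set// inE => -[x _ <-].
have lhs : \int[P]_w (f_ n (X w) * h w)%:E @[n --> \oo] --> \int[P]_w (g (X w) * h w)%:E.
  have -> : \int[P]_w (g (X w) * h w)%:E =
      \int[P]_w (lim ((f_ n (X w) * h w)%:E @[n --> \oo])).
    apply: eq_integral => w _; apply/esym/cvg_lim => //.
    rewrite EFinM; under eq_fun do rewrite EFinM.
    by apply: cvgeZr => //; exact: f_cvg.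
  apply: cvg_monotone_convergence => //.
  - by move=> n; apply/measurable_EFinP/measurable_funM => //; exact: mcomp.
  - by move=> n w _; rewrite lee_fin mulr_ge0.
  - move=> w _ m n mn; rewrite lee_fin ler_wpM2r//.
    exact/lefP/nd_nnsfun_approx.
have rhs : \int[P]_w (f_ n (X w))%:E * c%:E @[n --> \oo] --> \int[P]_w (g (X w))%:E * c%:E.
  have c1 : \int[P]_w (f_ n (X w))%:E @[n --> \oo] --> \int[P]_w (g (X w))%:E.
    have -> : \int[P]_w (g (X w))%:E = \int[P]_w (lim ((f_ n (X w))%:E @[n --> \oo])).
      by apply: eq_integral => w _; apply/esym/cvg_lim => //; exact: f_cvg.
    apply: cvg_monotone_convergence => //.
    - by move=> n; apply/measurable_EFinP; exact: mcomp.
    - by move=> n w _; rewrite lee_fin.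
    - by move=> w _ m n mn; rewrite lee_fin; exact/lefP/nd_nnsfun_approx.
  exact: cvgeZr.
apply: cvg_unique lhs _ => //; apply: cvg_trans rhs.
by under eq_fun do rewrite good_f.
Qed.

Variables (I : finType) (D : {pred I}) (X : I -> {RV P >-> R}).
Hypothesis X_indep : mutually_independent D X.

Let measurable_compX i (f : R -> R) : measurable_fun setT f ->
  measurable_fun setT (fun w => f (X i w)).
Proof. by move=> mf; exact: measurableT_comp. Qed.

(** Induction on [s1]: when all factors are indicators this is the definition of independence, and
    each step turns one indicator into a function by [integral_factor_indic_ext]. *)
Lemma indep_prod_ge0_indic (g : I -> R -> R) :
  (forall i, measurable_fun setT (g i)) -> (forall i x, (0 <= g i x)%R) ->
  (forall i, i \in D -> \int[P]_w (g i (X i w))%:E < +oo) ->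
  forall (s1 s2 : seq I) (A : I -> set R), uniq (s1 ++ s2) ->
  {subset s1 ++ s2 <= D} -> (forall i, measurable (A i)) ->
  \int[P]_w (\prod_(i <- s1) g i (X i w) * \prod_(i <- s2) \1_(A i) (X i w))%:E =
  (\prod_(i <- s1) fine (\int[P]_w (g i (X i w))%:E)%E *
   \prod_(i <- s2) fine (P (X i @^-1` A i)))%:E.
Proof.
move=> mg g0 gfin; elim=> [|i s1 IH] s2 A /= us sD mA.
  under eq_integral do rewrite big_nil mul1r.
  rewrite big_nil mul1r.
  have -> : (fun w => (\prod_(i <- s2) (\1_(A i) (X i w) : R))%:E) =
      (fun w => (\1_(\bigcap_(i in [set` [set j in s2]%SET]) (X i @^-1` A i)) w : R)%:E).
    apply/funext => w; congr EFin; rewrite indicE.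
    have [|nw] := boolP (w \in _).
      rewrite inE => wA; rewrite big_seq big1// => i is2.
      by rewrite indicE mem_set//; apply: wA => /=; rewrite inE.
    suff [i is2 niA] : exists2 i, i \in s2 & X i w \notin A i.
      by rewrite (big_rem i)//= indicE (negbTE niA) mul0r.
    apply/not_exists2P => all; move/negP: nw; apply; rewrite inE => i /=.
    rewrite inE => is2; have [//|] := all i.
    by move/negP; rewrite negbK inE.
  rewrite integral_indic// ?setIT; last first.
    apply: fin_bigcap_measurable => // i _.
    by rewrite -[X in measurable X]setTI; apply: (measurable_funP (X i)).
  transitivity (\prod_(i in [set j in s2]%SET) P (X i @^-1` A i)).
    by apply: X_indep => // i; rewrite inE => /sD.
  rewrite -prodEFin (eq_bigl (fun i => i \in s2)) => [|i]; last by rewrite inE.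
  rewrite big_uniq//=; apply: eq_bigr => i _; rewrite fineK// fin_num_measure//.
  by rewrite -[X in measurable X]setTI; apply: (measurable_funP (X i)).
move: us => /andP[is12 us].
have iD : i \in D by apply: sD; rewrite mem_head.
have sD' : {subset s1 ++ s2 <= D} by move=> j js; apply: sD; rewrite inE js orbT.
pose h w := (\prod_(i <- s1) g i (X i w) * \prod_(i <- s2) \1_(A i) (X i w))%R.
have mh : measurable_fun setT h.
  apply: measurable_funM; apply: measurable_prod => j _; apply: measurable_compX => //.
have h0 w : (0 <= h w)%R.
  by rewrite mulr_ge0// prodr_ge0// => j _; rewrite indicE ler0n.
pose c := (\prod_(i <- s1) fine (\int[P]_w (g i (X i w))%:E)%E *
   \prod_(i <- s2) fine (P (X i @^-1` A i)))%R.
have ext := @integral_factor_indic_ext (X i) h c mh h0.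
under eq_integral do rewrite big_cons -mulrA -/(h _).
rewrite big_cons -mulrA EFinM fineK; last first.
  by rewrite ge0_fin_numE ?gfin// integral_ge0// => w _; rewrite lee_fin.
apply: ext => // B mB.
(* The index i moves to the list of indicators, with B as its set. *)
pose A' j := if j == i then B else A j.
have is1 : i \notin s1 by apply: contra is12; rewrite mem_cat => ->.
have is2 : i \notin s2 by apply: contra is12; rewrite mem_cat => ->; rewrite orbT.
have A's2 j : j \in s2 -> A' j = A j.
  by rewrite /A'; case: eqP => // -> /idPn; rewrite is2.
have A'i : A' i = B by rewrite /A' eqxx.
have mpre j (E : set R) : measurable E -> measurable (X j @^-1` E).
  by move=> mE; rewrite -[X in measurable X]setTI; apply: (measurable_funP (X j)).
have -> : \int[P]_w (\1_B (X i w) : R)%:E = P (X i @^-1` B).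
  transitivity (\int[P]_w (\1_(X i @^-1` B) w : R)%:E) => //.
  by rewrite integral_indic ?setIT//; exact: mpre.
have -> : \int[P]_w (\1_B (X i w) * h w)%:E = \int[P]_w
    (\prod_(j <- s1) g j (X j w) * \prod_(j <- i :: s2) \1_(A' j) (X j w))%:E.
  apply: eq_integral => w _; congr EFin; rewrite big_cons A'i mulrCA /h.
  congr (_ * (_ * _))%R; rewrite !big_seq; apply: eq_bigr => j js.
  by rewrite A's2.
rewrite IH.
- have -> : (\prod_(j <- i :: s2) fine (P (X j @^-1` A' j)) =
      fine (P (X i @^-1` B)) * \prod_(j <- s2) fine (P (X j @^-1` A j)))%R.
    rewrite big_cons A'i; congr (_ * _)%R; rewrite !big_seq.
    by apply: eq_bigr => j /A's2 ->.
  by rewrite mulrCA EFinM fineK// fin_num_measure//; exact: mpre.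
- by rewrite uniq_catC /= mem_cat negb_or is1 is2 uniq_catC us.
- by move=> j; rewrite mem_cat inE orbCA -mem_cat -in_cons; exact: sD.
- by move=> j; rewrite /A'; case: ifP.
Qed.

Definition has_integral (f : T -> R) (m : R) : Prop :=
  P.-integrable setT (EFin \o f) /\ \int[P]_w (f w)%:E = m%:E.

Lemma has_integral_ext f g m : f =1 g -> has_integral f m -> has_integral g m.
Proof. by move=> /funext ->. Qed.

Lemma has_integralZ f m (a : R) : has_integral f m ->
  has_integral (fun w => a * f w)%R (a * m).
Proof.
move=> [fi fm]; split.
  by apply: eq_integrable (integrableZl measurableT a fi).
under eq_integral do rewrite EFinM.
by rewrite (integralZl measurableT fi) fm.
Qed.

Lemma has_integralD f g m n : has_integral f m -> has_integral g n ->
  has_integral (fun w => f w + g w)%R (m + n).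
Proof.
move=> [fi fm] [gi gn]; split.
  by apply: eq_integrable (integrableD measurableT fi gi).
under eq_integral do rewrite EFinD.
by rewrite (integralD measurableT fi gi) fm gn.
Qed.

Lemma has_integral0 : has_integral (fun=> 0%R) 0.
Proof. by split; [exact: integrable0 | rewrite integral0]. Qed.

Lemma has_integral_sum (K : Type) (s : seq K) (f : K -> T -> R) (m : K -> R) :
  (forall k, has_integral (f k) (m k)) ->
  has_integral (fun w => \sum_(k <- s) f k w)%R (\sum_(k <- s) m k)%R.
Proof.
move=> fm; elim: s => [|k s IH].
  by rewrite big_nil; apply: has_integral_ext has_integral0 => w; rewrite big_nil.
rewrite big_cons; apply: has_integral_ext (has_integralD (fm k) IH) => w.
by rewrite big_cons.
Qed.

Lemma has_integral_indep_ge0 (J : {set I}) (g : I -> R -> R) (m : I -> R) :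
  {subset J <= D} -> (forall i, measurable_fun setT (g i)) ->
  (forall i x, (0 <= g i x)%R) ->
  (forall i, has_integral (fun w => g i (X i w)) (m i)) ->
  has_integral (fun w => \prod_(i in J) g i (X i w))%R (\prod_(i in J) m i)%R.
Proof.
move=> JD mg g0 gm.
have gfin i : \int[P]_w (g i (X i w))%:E < +oo by case: (gm i) => _ ->; exact: ltry.
have uJ : uniq (enum J ++ [::]) by rewrite cats0 enum_uniq.
have sJ : {subset enum J ++ [::] <= D}.
  by move=> i; rewrite cats0 mem_enum => /JD.
have := indep_prod_ge0_indic mg g0 (fun i _ => gfin i) uJ sJ (fun=> measurableT).
under eq_integral do rewrite big_nil mulr1 big_enum /=.
rewrite big_nil mulr1 big_enum /= => e.
have {}e : \int[P]_w (\prod_(i in J) g i (X i w))%:E = (\prod_(i in J) m i)%:E.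
  by rewrite e; congr EFin; apply: eq_bigr => i _; case: (gm i) => _ ->.
split=> //; apply/integrableP; split.
  apply/measurable_EFinP.
  under eq_fun do rewrite -big_enum /=.
  by apply: measurable_prod => i _; exact: measurable_compX.
under eq_integral => w _ do rewrite /= ger0_norm ?prodr_ge0//.
by rewrite e ltry.
Qed.

(** Each factor is split into positive and negative parts, and the product of differences is
    expanded over subsets into products of nonnegative functions. *)
Lemma has_integral_indep (J : {set I}) (f : I -> R -> R) (m : I -> R) :
  {subset J <= D} -> (forall i, measurable_fun setT (f i)) ->
  (forall i, i \in J -> has_integral (fun w => f i (X i w)) (m i)) ->
  has_integral (fun w => \prod_(i in J) f i (X i w))%R (\prod_(i in J) m i)%R.
Proof.
move=> JD mf fm.
(* Outside [J] both parts are the constant 1, so that every index has an integral. *)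
pose pos i x := if i \in J then Num.max (f i x) 0%R else 1%R.
pose neg i x := if i \in J then Num.max (- f i x)%R 0%R else 1%R.
have fE i x : i \in J -> f i x = (pos i x - neg i x)%R.
  move=> iJ; rewrite /pos /neg iJ; case: (leP 0%R (f i x)) => f0.
    by rewrite max_r ?subr0// oppr_le0.
  by rewrite max_l ?sub0r ?opprK// oppr_ge0 ltW.
have mpos i : measurable_fun setT (pos i).
  by rewrite /pos; case: (i \in J) => //; exact: measurable_maxr.
have mneg i : measurable_fun setT (neg i).
  rewrite /neg; case: (i \in J) => //; apply: measurable_maxr => //.
  exact: measurable_funN.
have pos0 i x : (0 <= pos i x)%R by rewrite /pos; case: ifP => // _; rewrite le_max lexx orbT.
have neg0 i x : (0 <= neg i x)%R by rewrite /neg; case: ifP => // _; rewrite le_max lexx orbT.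
have intg (g : I -> R -> R) i : measurable_fun setT (g i) ->
    (forall x, (0 <= g i x)%R) -> (i \in J -> forall x, (g i x <= `|f i x|)%R) ->
    (i \notin J -> g i = fun=> 1%R) ->
    exists a, has_integral (fun w => g i (X i w)) a.
  move=> mg g0 gle g1; have [iJ|iJ] := boolP (i \in J); last first.
    exists 1%R; rewrite g1//; split.
      exact: finite_measure_integrable_cst.
    by rewrite (integral_cst _ measurableT) mul1e; exact: probability_setT.
  have [fi _] := fm i iJ.
  have gi : P.-integrable setT (EFin \o (fun w => g i (X i w))).
    apply: (le_integrable measurableT) fi.
      by apply/measurable_EFinP; exact: measurable_compX.
    by move=> w _; rewrite /= lee_fin ger0_norm// gle.
  exists (fine (\int[P]_w (g i (X i w))%:E)); split=> //.
  by rewrite fineK//; exact: integrable_fin_num.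
have /choice[mp posm] i : exists a, has_integral (fun w => pos i (X i w)) a.
  apply: intg => //; last by rewrite /pos => /negbTE ->.
  by rewrite /pos => iJ x; rewrite iJ ge_max ler_norm normr_ge0.
have /choice[mn negm] i : exists a, has_integral (fun w => neg i (X i w)) a.
  apply: intg => //; last by rewrite /neg => /negbTE ->.
  by rewrite /neg => iJ x; rewrite iJ ge_max -normrN ler_norm normr_ge0.
have mE i : i \in J -> m i = (mp i - mn i)%R.
  move=> iJ; have [_ e1] := fm i iJ.
  have [_] := has_integralD (posm i) (has_integralZ (-1)%R (negm i)).
  under eq_integral do rewrite mulN1r -fE//.
  by rewrite e1 mulN1r => -[].
(* The value 0 kills every [K] that misses an index outside [J], so each subset of [J] is counted
   once. *)
pose sgn (K : {set I}) i : R := if i \in K then 1%R else if i \in J then (-1)%R else 0%R.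
have expand (a b : I -> R) : (\prod_(i in J) (a i - b i) =
    \sum_(K : {set I}) (\prod_i sgn K i) * \prod_(i in J) (if i \in K then a i else b i))%R.
  rewrite big_mkcond /=.
  transitivity (\prod_i ((if i \in J then a i else 1) + (if i \in J then - b i else 0)))%R.
    by apply: eq_bigr => i _; case: ifP => // _; rewrite addr0.
  rewrite bigA_distr; apply: eq_bigr => K _.
  rewrite [X in (_ * X)%R]big_mkcond -big_split /=; apply: eq_bigr => i _.
  rewrite /sgn; case: ifP => iK; case: ifP => iJ; rewrite ?mul1r ?mulr1//.
  by rewrite mulN1r.
rewrite (_ : (\prod_(i in J) m i = \prod_(i in J) (mp i - mn i))%R); last first.
  by apply: eq_bigr => i /mE.
rewrite expand; apply: has_integral_ext; last first.
  apply: has_integral_sum => K; apply: has_integralZ.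
  apply: (@has_integral_indep_ge0 J (fun i x => if i \in K then pos i x else neg i x)) => //.
  - by move=> i; case: (i \in K).
  - by move=> i x; case: (i \in K).
  - by move=> i; case: (i \in K).
move=> w /=; rewrite (eq_bigr (fun i => pos i (X i w) - neg i (X i w))%R) => [|i iJ].
  by rewrite expand.
exact: fE.
Qed.

End IndependentProducts.

(** * A signed five-point law with prescribed moments *)

Section Quadrature.
Variable R : realType.
Local Open Scope complex_scope.
Variables m3 m4 : R.

Definition law_moment (p : nat) : R := nth 0 [:: 1; 0; 2^-1; m3; m4] p.

Definition node (i : 'I_5) : R := i%:R - 2.

(* The signed weights on the nodes -2, ..., 2 that reproduce the moments. *)
Definition node_weight (i : 'I_5) : R :=
  let q := (m4 - 2^-1) / 12 in let p := 2^-1 - 4 * q in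
  nth 0 [:: (q - m3 / 6) / 2; (p + m3 / 3) / 2; 1 - p - q;
            (p - m3 / 3) / 2; (q + m3 / 6) / 2] i.

Lemma quadrature p : (p <= 4)%N ->
  \sum_i node_weight i * node i ^+ p = law_moment p.
Proof.
rewrite !big_ord_recl big_ord0 /node_weight /node /law_moment /=.
by case: p => [|[|[|[|[|//]]]]] _ /=; rewrite /bump /=; field.
Qed.

(** The two nodes of a pair model the real and imaginary parts of an entry; a diagonal entry reads
    only the first. *)
Definition pair_weight (o : 'I_5 * 'I_5) : R[i] :=
  (node_weight o.1 * node_weight o.2)%:C.
Definition offdiag_value (o : 'I_5 * 'I_5) : R[i] := node o.1 +i* node o.2.
Definition offdiag_conj (o : 'I_5 * 'I_5) : R[i] := node o.1 -i* node o.2.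
Definition diag_value (o : 'I_5 * 'I_5) : R[i] := (Num.sqrt 2 * node o.1)%:C.

Lemma quadrature2 p q : (p <= 4)%N -> (q <= 4)%N ->
  \sum_o pair_weight o * (node o.1 ^+ p * node o.2 ^+ q)%:C =
  (law_moment p * law_moment q)%:C.
Proof.
move=> p4 q4; rewrite -(quadrature p4) -(quadrature q4).
rewrite -(pair_bigA _ (fun i j => pair_weight (i, j) * (node i ^+ p * node j ^+ q)%:C)).
rewrite mulr_suml rmorph_sum /=; apply: eq_bigr => i _.
rewrite mulr_sumr rmorph_sum /=; apply: eq_bigr => j _.
by rewrite /pair_weight -rmorphM /=; congr (_%:C); ring.
Qed.

Lemma sum_pair_weight : \sum_o pair_weight o = 1.
Proof.
transitivity (\sum_o pair_weight o * (node o.1 ^+ 0 * node o.2 ^+ 0)%:C).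
  by apply: eq_bigr => o _; rewrite !expr0 mulr1 mulr1.
by rewrite quadrature2// mulr1.
Qed.

Let pair_sum (f : 'I_5 * 'I_5 -> R[i]) := \sum_o pair_weight o * f o.

Let pair_sumE f (s : seq (R[i] * nat * nat)) :
  (forall o, f o = \sum_(t <- s) t.1.1 * (node o.1 ^+ t.1.2 * node o.2 ^+ t.2)%:C) ->
  all (fun t => (t.1.2 <= 4)%N && (t.2 <= 4)%N) s ->
  pair_sum f = \sum_(t <- s) t.1.1 * (law_moment t.1.2 * law_moment t.2)%:C.
Proof.
move=> fE s4; rewrite /pair_sum.
transitivity (\sum_(t <- s) \sum_o
    t.1.1 * (pair_weight o * (node o.1 ^+ t.1.2 * node o.2 ^+ t.2)%:C)).
  rewrite exchange_big; apply: eq_bigr => o _; rewrite fE mulr_sumr.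
  by apply: eq_bigr => t _; rewrite mulrCA.
rewrite !big_seq; apply: eq_bigr => t /(allP s4)/andP[t1 t2].
by rewrite -mulr_sumr quadrature2.
Qed.

Let law_moment0 : law_moment 0 = 1. Proof. by []. Qed.
Let law_moment1 : law_moment 1 = 0. Proof. by []. Qed.
Let law_moment2 : law_moment 2 = 2^-1. Proof. by []. Qed.
Let law_moment4 : law_moment 4 = m4. Proof. by []. Qed.

Local Notation mom := (pair_moment pair_weight offdiag_value offdiag_conj).

Let term (a : R[i]) (p q : nat) := (a, p, q).

Ltac expand_pair_moment :=
  let o := fresh "o" in
  move=> o; rewrite !big_cons big_nil /offdiag_value /offdiag_conj /term;
  move: (node o.1) (node o.2) => x y; rewrite !exprS !expr0;
  apply/eqP; rewrite eq_complex /=; apply/andP; split; apply/eqP; ring.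

Lemma pair_moment10 : mom 1 0 = 0.
Proof.
rewrite /pair_moment -/(pair_sum _).
rewrite (pair_sumE (s := [:: term 1 1 0; term 'i 0 1]))//; last by expand_pair_moment.
rewrite !big_cons big_nil /= law_moment1.
by apply/eqP; rewrite eq_complex /=; apply/andP; split; apply/eqP; ring.
Qed.

Lemma pair_moment01 : mom 0 1 = 0.
Proof.
rewrite /pair_moment -/(pair_sum _).
rewrite (pair_sumE (s := [:: term 1 1 0; term (- 'i) 0 1]))//; last by expand_pair_moment.
rewrite !big_cons big_nil /= law_moment1.
by apply/eqP; rewrite eq_complex /=; apply/andP; split; apply/eqP; ring.
Qed.

Lemma pair_moment20 : mom 2 0 = 0.
Proof.
rewrite /pair_moment -/(pair_sum _).
rewrite (pair_sumE (s := [:: term 1 2 0; term (- 1) 0 2; term (2 * 'i) 1 1]))//;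
  last by expand_pair_moment.
rewrite !big_cons big_nil /= law_moment0 law_moment1 law_moment2.
by apply/eqP; rewrite eq_complex /=; apply/andP; split; apply/eqP; ring.
Qed.

Lemma pair_moment11 : mom 1 1 = 1.
Proof.
rewrite /pair_moment -/(pair_sum _).
rewrite (pair_sumE (s := [:: term 1 2 0; term 1 0 2]))//; last by expand_pair_moment.
rewrite !big_cons big_nil /= law_moment0 law_moment2.
by apply/eqP; rewrite eq_complex /=; apply/andP; split; apply/eqP; field.
Qed.

(** E|z|^4 = 2 m4 + 2 (1/2)^2 = 2 + 2 (m4 - 3/4) for real and imaginary parts of variance 1/2. *)
Definition kurtosis : R := m4 - 3 / 4.

Lemma pair_moment22 : mom 2 2 = 2 + 2 * kurtosis%:C.
Proof.
rewrite /pair_moment -/(pair_sum _) /kurtosis.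
rewrite (pair_sumE (s := [:: term 1 4 0; term 2 2 2; term 1 0 4]))//;
  last by expand_pair_moment.
rewrite !big_cons big_nil /= law_moment0 law_moment2 law_moment4.
by apply/eqP; rewrite eq_complex /=; apply/andP; split; apply/eqP; field.
Qed.

Lemma diag_value_mean : \sum_o pair_weight o * diag_value o = 0.
Proof.
rewrite -/(pair_sum _) (pair_sumE (s := [:: term (Num.sqrt 2)%:C 1 0]))//.
  rewrite big_cons big_nil /= law_moment1.
  by apply/eqP; rewrite eq_complex /=; apply/andP; split; apply/eqP; ring.
move=> o; rewrite big_cons big_nil /diag_value /term /= expr1 expr0.
by apply/eqP; rewrite eq_complex /=; apply/andP; split; apply/eqP; ring.
Qed.

Lemma diag_value_sqr : \sum_o pair_weight o * diag_value o ^+ 2 = 1.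
Proof.
rewrite -/(pair_sum _) (pair_sumE (s := [:: term 2 2 0]))//.
  rewrite big_cons big_nil /= law_moment2 law_moment0.
  by apply/eqP; rewrite eq_complex /=; apply/andP; split; apply/eqP; field.
move=> o; rewrite big_cons big_nil /diag_value /term /= -rmorphXn exprMn sqr_sqrtr//=.
by apply/eqP; rewrite eq_complex /= expr0; apply/andP; split; apply/eqP; ring.
Qed.

End Quadrature.

(** * From random entries to weighted configurations *)

Section Transfer.
Context d (T : measurableType d) (R : realType) (P : probability T R).
Context (Q : probability R R) (N : nat) (XRe XIm : 'I_N -> 'I_N -> {RV P >-> R}).
Local Open Scope complex_scope.
Local Notation var := ('I_N * 'I_N + 'I_N * 'I_N)%type.

Variables m3 m4 : R.
Hypothesis Q_moments : forall p, (p <= 4)%N ->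
  has_integral Q (fun x => x ^+ p) (law_moment m3 m4 p).
Hypothesis X_iid : wigner_iid Q XRe XIm.

Let X (k : var) : {RV P >-> R} := wigner_family XRe XIm k.

Local Notation config := {ffun 'I_N * 'I_N -> 'I_5 * 'I_5}.
Local Notation E := (@mean R[i] ('I_5 * 'I_5)%type ('I_N * 'I_N)%type (pair_weight m3 m4)).

Definition config_value (c : config) (k : var) : R :=
  match k with inl p => node R (c p).1 | inr p => node R (c p).2 end.

Lemma X_moments k p : k \in @wigner_index N -> (p <= 4)%N ->
  has_integral P (fun w => X k w ^+ p) (law_moment m3 m4 p).
Proof.
move=> kD p4; have [iQ eQ] := Q_moments p4.
have mp : measurable_fun setT (fun x : R => x ^+ p).
  exact: measurable_funX.
have mpE : measurable_fun setT (EFin \o (fun x : R => x ^+ p)) by exact/measurable_EFinP.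
have eq_law (f : R -> \bar R) : (\int[distribution P (X k)]_x f x = \int[Q]_x f x)%E.
  by apply: eq_measure_integral => A mA _; apply: X_iid.2.
have iX : P.-integrable setT (EFin \o (fun w => X k w ^+ p)).
  apply/integrableP; split.
    by apply/measurable_EFinP; apply: (measurableT_comp mp); exact: measurable_funPT.
  move/integrableP : iQ => [_]; rewrite -eq_law ge0_integral_distribution//.
  exact: measurableT_comp.
split=> //; rewrite -eQ -eq_law integral_distribution//.
Qed.

(** A function of all real variables is read both on the random family and on configurations; the
    complex expectation is held as two real integrals. *)
Definition transfers (F : (var -> R) -> R[i]) : Prop :=
  has_integral P (fun w => complex.Re (F (X ^~ w))) (complex.Re (E (F \o config_value))) /\
  has_integral P (fun w => complex.Im (F (X ^~ w))) (complex.Im (E (F \o config_value))).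

Lemma transfers_ext F G : F =1 G -> transfers F -> transfers G.
Proof. by move=> /funext ->. Qed.

Lemma transfersZ (a : R[i]) F : transfers F -> transfers (fun v => a * F v).
Proof.
case: a => a b [Fr Fi]; rewrite /transfers.
have -> : E ((fun v => (a +i* b) * F v) \o config_value) =
    (a +i* b) * E (F \o config_value) by rewrite -meanZ.
case e : (E (F \o config_value)) => [x y]; rewrite e /= in Fr Fi; split => /=.
  rewrite -mulNr; apply: has_integral_ext
    (has_integralD (has_integralZ a Fr) (has_integralZ (- b) Fi)) => w /=.
  by case: (F _) => r s /=; rewrite mulNr.
apply: has_integral_ext
    (has_integralD (has_integralZ a Fi) (has_integralZ b Fr)) => w /=.
by case: (F _).
Qed.

Lemma transfers_sum (I : finType) (F : I -> (var -> R) -> R[i]) :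
  (forall i, transfers (F i)) -> transfers (fun v => \sum_i F i v).
Proof.
move=> tF; rewrite /transfers.
have -> : E ((fun v => \sum_i F i v) \o config_value) =
    \sum_i E (F i \o config_value) by rewrite -mean_sum.
split.
  rewrite raddf_sum; apply: has_integral_ext
    (has_integral_sum _ (fun i => (tF i).1)) => w /=.
  by rewrite raddf_sum.
rewrite raddf_sum; apply: has_integral_ext
  (has_integral_sum _ (fun i => (tF i).2)) => w /=.
by rewrite raddf_sum.
Qed.

(** Independence on one side and the product weight on the other reduce both means to single moments
    of order at most 4, where the two laws agree. *)
Lemma transfers_monomial (e : var -> nat) : (forall k, (e k <= 4)%N) ->
  (forall k, k \notin @wigner_index N -> e k = 0%N) ->
  transfers (fun v => (\prod_k v k ^+ e k)%:C).
Proof.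
move=> e4 e0; pose J := [set k in @wigner_index N]%SET.
have restr (v : var -> R) : \prod_k v k ^+ e k = \prod_(k in J) v k ^+ e k.
  rewrite [RHS]big_mkcond; apply: eq_bigr => k _; rewrite inE.
  by case: ifPn => // /e0 ->; rewrite expr0.
have mE : E ((fun v => (\prod_k v k ^+ e k)%:C) \o config_value) =
    (\prod_(k in J) law_moment m3 m4 (e k))%:C.
  have -> : \prod_(k in J) law_moment m3 m4 (e k) = \prod_k law_moment m3 m4 (e k).
    rewrite big_mkcond; apply: eq_bigr => k _; rewrite inE.
    by case: ifPn => // /e0 ->.
  rewrite [in RHS]big_sumType /= -[in RHS]big_split rmorph_prod /=.
  transitivity (E (fun c => \prod_p (node R (c p).1 ^+ e (inl p) *
      node R (c p).2 ^+ e (inr p))%:C)).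
    by apply: eq_mean => c /=; rewrite big_sumType /= -big_split rmorph_prod.
  rewrite (mean_prod _ (fun p o => (node R o.1 ^+ e (inl p) * node R o.2 ^+ e (inr p))%:C)).
  by apply: eq_bigr => p _; rewrite quadrature2.
rewrite /transfers mE /=; split; last first.
  by apply: has_integral_ext (has_integral0 P).
apply: has_integral_ext (has_integral_indep X_iid.1 (J := J)
    (f := fun k x => x ^+ e k) (m := fun k => law_moment m3 m4 (e k)) _ _ _).
- by move=> w /=; rewrite restr.
- by move=> k; rewrite inE.
- by move=> k; exact: measurable_funX.
- by move=> k; rewrite inE => kD; exact: X_moments.
Qed.

Definition wigner_entry (v : var -> R) (i j : 'I_N) : R[i] :=
  if (i < j)%N then v (inl (i, j)) +i* v (inr (i, j))
  else if i == j then (Num.sqrt 2 * v (inl (i, i)))%:C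
  else v (inl (j, i)) -i* v (inr (j, i)).

(* An entry minus a constant, as a combination of monomials of degree at most 1. *)
Let entry_var (i j : 'I_N) (o : 'I_3) : option var :=
  let p := if (i < j)%N then (i, j) else (j, i) in
  nth None [:: None; Some (inl p); if i == j then None else Some (inr p)] o.

Let entry_coef (i j : 'I_N) (a : R[i]) (o : 'I_3) : R[i] :=
  nth 0 [:: - a; if i == j then (Num.sqrt 2)%:C else 1;
    if (i < j)%N then 'i else if i == j then 0 else - 'i] o.

Let entryE v i j a : wigner_entry v i j - a =
  \sum_o entry_coef i j a o * (oapp v 1 (entry_var i j o))%:C.
Proof.
rewrite !big_ord_recl big_ord0 /entry_coef /entry_var /wigner_entry /=.
have [ij|ji|ij] := ltngtP i j.
- have -> : (i == j) = false by apply/negbTE; rewrite neq_ltn ij.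
  by case: a => a b; apply/eqP; rewrite eq_complex /=; apply/andP; split; apply/eqP; ring.
- have -> : (i == j) = false by apply/negbTE; rewrite neq_ltn ji orbT.
  by case: a => a b; apply/eqP; rewrite eq_complex /=; apply/andP; split; apply/eqP; ring.
- have -> : j = i by exact/val_inj.
  rewrite eqxx.
  by case: a => a b; apply/eqP; rewrite eq_complex /=; apply/andP; split; apply/eqP; ring.
Qed.

Let prod_vars (I : finType) (u : I -> option var) (v : var -> R) :
  \prod_r oapp v 1 (u r) = \prod_k v k ^+ #|[set r | u r == Some k]%SET|.
Proof.
transitivity (\prod_r \prod_(k | u r == Some k) v k).
  apply: eq_bigr => r _; case: (u r) => [k|] /=; last by rewrite big_pred0.
  rewrite (eq_bigl (pred1 k)) ?big_pred1_eq//.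
rewrite (exchange_big_dep predT)//=; apply: eq_bigr => k _.
by rewrite prodr_const; congr (_ ^+ _); apply: eq_card => r; rewrite !inE.
Qed.

(** A real variable attached to (p, q) occurs only in entries of row p or row q. With each row taken
    at most twice its exponent is at most 4, whatever the columns. *)
Lemma transfers_entries (I : finType) (row col : I -> 'I_N) (a : I -> R[i]) :
  (forall i, (#|[set r | row r == i]%SET| <= 2)%N) ->
  transfers (fun v => \prod_r (wigner_entry v (row r) (col r) - a r)).
Proof.
move=> row2.
apply: (@transfers_ext (fun v => \sum_(f : {ffun I -> 'I_3})
   (\prod_r entry_coef (row r) (col r) (a r) (f r)) *
   (\prod_k v k ^+ #|[set r | entry_var (row r) (col r) (f r) == Some k]%SET|)%:C)).
  move=> v; under [RHS]eq_bigr do rewrite entryE.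
  rewrite bigA_distr_bigA; apply: eq_bigr => f _.
  by rewrite -prod_vars big_split rmorph_prod.
apply: transfers_sum => f; apply: transfersZ; apply: transfers_monomial => k.
  pose k1 := match k with inl p => p.1 | inr p => p.1 end.
  pose k2 := match k with inl p => p.2 | inr p => p.2 end.
  apply: (@leq_trans #|[set r | row r == k1]%SET :|: [set r | row r == k2]%SET|).
    apply/subset_leq_card/fintype.subsetP => r; rewrite !inE /entry_var.
    case: (f r) => -[|[|[|//]]] //= _.
      move=> /eqP[]; rewrite /k1 /k2 => <- /=; case: ifP => _ /=; by rewrite eqxx ?orbT.
    rewrite /=; case: (row r == col r) => //= /eqP[]; rewrite /k1 /k2 => <- /=.
    by case: ifP => _ /=; rewrite eqxx ?orbT.
  by rewrite (leq_trans (leq_card_setU _ _))// (leq_add (row2 _) (row2 _)).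
move=> kD; apply/eqP; rewrite cards_eq0; apply/eqP/setP => r; rewrite !inE.
apply: contraNF kD => /eqP; rewrite /entry_var.
case: (f r) => -[|[|[|//]]] //= _.
  by case=> <-; rewrite /wigner_index unfold_in /=; case: ltnP => // /ltnW.
rewrite /=; have [//|ne [<-]] := eqVneq (row r) (col r); rewrite /wigner_index unfold_in /=.
by case: ltnP => // ji; rewrite ltn_neqAle ji andbT eq_sym.
Qed.

Definition wigner_det (v : var -> R) (x : R[i]) : R[i] :=
  \det (\matrix_(i, j) wigner_entry v i j - x%:M).

Let wigner_detE v x : wigner_det v x = \sum_(s : {perm 'I_N})
  (-1) ^+ s * \prod_i (wigner_entry v i (s i) - x *+ (i == s i)).
Proof.
by apply: eq_bigr => s _; congr (_ * _); apply: eq_bigr => i _; rewrite !mxE.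
Qed.

Lemma transfers_det x : transfers (wigner_det ^~ x).
Proof.
apply: transfers_ext (transfers_sum (F := fun (s : {perm 'I_N}) v =>
  (-1) ^+ s * \prod_i (wigner_entry v i (s i) - x *+ (i == s i))) _).
  by move=> v; rewrite wigner_detE.
move=> s; apply: transfersZ.
apply: (@transfers_entries _ id s (fun i => x *+ (i == s i))) => i.
rewrite (_ : [set r | id r == i]%SET = [set i]%SET) ?cards1//.
by apply/setP => j; rewrite !inE.
Qed.

Lemma transfers_det_mul x y : transfers (fun v => wigner_det v x * wigner_det v y).
Proof.
apply: transfers_ext (transfers_sum (F := fun (s : {perm 'I_N} * {perm 'I_N}) v =>
  ((-1) ^+ s.1 * (-1) ^+ s.2) *
  \prod_(r : 'I_N * bool) (wigner_entry v r.1 ((if r.2 then s.1 else s.2) r.1)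
    - (if r.2 then x *+ (r.1 == s.1 r.1) else y *+ (r.1 == s.2 r.1)))) _).
  move=> v; rewrite !wigner_detE mulr_suml.
  rewrite -(pair_bigA _ (fun s s' : {perm 'I_N} => (-1) ^+ s * (-1) ^+ s' *
    \prod_(r : 'I_N * bool) (wigner_entry v r.1 ((if r.2 then s else s') r.1)
      - (if r.2 then x *+ (r.1 == s r.1) else y *+ (r.1 == s' r.1))))) /=.
  apply: eq_bigr => s _.
  rewrite mulr_sumr; apply: eq_bigr => s' _; rewrite mulrACA; congr (_ * _).
  rewrite -(pair_bigA _ (fun i b => wigner_entry v i ((if b then s else s') i)
    - (if b then x *+ (i == s i) else y *+ (i == s' i)))) /= -big_split.
  by apply: eq_bigr => i _; rewrite big_bool.
move=> s; apply: transfersZ.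
apply: (@transfers_entries _ fst (fun r => (if r.2 then s.1 else s.2) r.1)) => i.
rewrite (_ : [set r | r.1 == i]%SET = finset.setX [set i]%SET [set: bool]%SET).
  by rewrite cardsX cards1 cardsT card_bool.
by apply/setP => -[j b]; rewrite !inE andbT.
Qed.

End Transfer.

Section PowerMoments.
Context (R : realType) (Q : probability R R).
Hypothesis Q_mean : (\int[Q]_x x%:E = 0)%E.
Hypothesis Q_var : (\int[Q]_x (x ^+ 2)%:E = (2^-1)%:E)%E.
Hypothesis Q_fourth : (\int[Q]_x (x ^+ 4)%:E < +oo)%E.

(** All these powers are dominated by 1 + x^4; the third moment is kept as an unspecified number. *)
Lemma power_moments p : (p <= 4)%N -> has_integral Q (fun x => x ^+ p)
  (law_moment (fine (\int[Q]_x (x ^+ 3)%:E)) (fine (\int[Q]_x (x ^+ 4)%:E)) p).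
Proof.
move=> p4.
have mX q : measurable_fun setT (fun x : R => x ^+ q) by exact: measurable_funX.
have x4_ge0 (x : R) : 0 <= x ^+ 4 by rewrite -[4%N]/(2 * 2)%N exprM sqr_ge0.
have i4 : Q.-integrable setT (EFin \o (fun x : R => x ^+ 4)).
  apply/integrableP; split; first exact/measurable_EFinP.
  by under eq_integral => x _ do rewrite /= ger0_norm//.
have i1 : Q.-integrable setT (EFin \o (fun=> 1 : R)).
  exact: finite_measure_integrable_cst.
have ip : Q.-integrable setT (EFin \o (fun x : R => x ^+ p)).
  apply: (le_integrable measurableT) (integrableD measurableT i1 i4).
    exact/measurable_EFinP.
  move=> x _; rewrite /= lee_fin normrX [leRHS]ger0_norm ?addr_ge0//.
  have -> : x ^+ 4 = `|x| ^+ 4 by rewrite -normrX ger0_norm.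
  have [x1|x1] := leP `|x| 1.
    by rewrite (le_trans (exprn_ile1 _ (normr_ge0 x) x1))// lerDl exprn_ge0.
  by rewrite (le_trans (ler_weXn2l (ltW x1) p4))// lerDr.
split=> //; have fin := integrable_fin_num measurableT ip.
case: p p4 ip fin => [|[|[|[|[|//]]]]] _ _ /= fin.
- under eq_integral do rewrite expr0.
  by rewrite (integral_cst _ measurableT) mul1e; exact: probability_setT.
- exact: Q_mean.
- exact: Q_var.
- by rewrite fineK.
- by rewrite fineK.
Qed.

End PowerMoments.

(** * Exact covariance of the characteristic determinants *)

Section DeterminantCovariance.
Context d (T : measurableType d) (R : realType) (P : probability T R).
Context (Q : probability R R) (N : nat) (XRe XIm : 'I_N -> 'I_N -> {RV P >-> R}).
Local Open Scope complex_scope.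

Variables m3 m4 : R.
Hypothesis Q_moments : forall p, (p <= 4)%N ->
  has_integral Q (fun x => x ^+ p) (law_moment m3 m4 p).
Hypothesis X_iid : wigner_iid Q XRe XIm.

Local Notation D := (char_det XRe XIm).
Local Notation config_matrix c := (config_mx (@offdiag_value R)
  (@offdiag_conj R) (@diag_value R) (id : 'I_N -> 'I_N) c).

Let wigner_det_wigner w x :
  wigner_det (fun k => wigner_family XRe XIm k w) x%:C = (D x w)%:C.
Proof. exact: wigner_det_real. Qed.

Let wigner_det_config c (x : R) : wigner_det (config_value R c) x%:C =
  (-1) ^+ N * (char_poly (config_matrix c)).[x%:C] :> R[i].
Proof.
by rewrite horner_char_poly -detZ scaleN1r opprB.
Qed.

Lemma has_integral_char_det x : has_integral P (D x) ((-1) ^+ N * hermite N x).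
Proof.
have [t _] := transfers_det Q_moments X_iid x%:C; move: t.
have -> : (fun w => complex.Re (wigner_det ((wigner_family XRe XIm)^~ w) x%:C)) = D x.
  by apply/funext => w; rewrite wigner_det_wigner.
congr (has_integral _ _ _).
rewrite (eq_mean _ (fun c => wigner_det_config c x)) meanZ.
rewrite (mean_char_poly (sum_pair_weight m3 m4) (pair_moment10 _ _)
  (pair_moment11 _ _) (diag_value_mean _ _))//.
by rewrite -(rmorph_hermite (@real_complex R)) -(rmorph_sign (@real_complex R)) -rmorphM.
Qed.

Lemma has_integral_char_det_mul x y : has_integral P (fun w => D x w * D y w)
  (wigner_sum (kurtosis m4) (hermite ^~ x) (hermite ^~ y) N).
Proof.
have [t _] := transfers_det_mul Q_moments X_iid x%:C y%:C; move: t.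
have -> : (fun w => complex.Re (wigner_det ((wigner_family XRe XIm)^~ w) x%:C *
    wigner_det ((wigner_family XRe XIm)^~ w) y%:C)) = (fun w => D x w * D y w).
  by apply/funext => w; rewrite !wigner_det_wigner -rmorphM.
congr (has_integral _ _ _).
transitivity (complex.Re (mean (pair_weight m3 m4) (fun c =>
    (char_poly (config_matrix c)).[x%:C] * (char_poly (config_matrix c)).[y%:C]))).
  congr complex.Re; apply: eq_mean => c /=.
  by rewrite !wigner_det_config mulrACA -expr2 sqrr_sign mul1r.
rewrite (mean_char_poly_mul (sum_pair_weight m3 m4) (pair_moment10 _ _)
  (pair_moment01 _ _) (pair_moment20 _ _) (pair_moment11 _ _) (pair_moment22 _ _)
  (diag_value_mean _ _) (diag_value_sqr _ _))//.
suff -> : wigner_sum (kurtosis m4)%:C (hermite^~ x%:C) (hermite^~ y%:C) N =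
    (wigner_sum (kurtosis m4) (hermite ^~ x) (hermite ^~ y) N)%:C by [].
rewrite /wigner_sum rmorph_sum; apply: eq_bigr => m _.
rewrite /kernel_sum !rmorphM rmorphXn fmorphV !rmorph_nat rmorph_sum; congr (_ * _).
apply: eq_bigr => k _; rewrite !rmorphM fmorphV rmorph_nat.
by rewrite !(rmorph_hermite (@real_complex R)).
Qed.

Lemma fine_covariance_char_det x y : fine (covariance P (D x) (D y)) =
  wigner_sum (kurtosis m4) (hermite ^~ x) (hermite ^~ y) N
  - hermite N x * hermite N y.
Proof.
have dx := has_integral_char_det x; have dy := has_integral_char_det y.
rewrite covariance.unlock !expectation.unlock dx.2 dy.2 /=.
set a := (-1) ^+ N * hermite N x; set b := (-1) ^+ N * hermite N y.
have c1 : has_integral P (fun=> a * b) (a * b).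
  split; first exact: finite_measure_integrable_cst.
  by rewrite (integral_cst _ measurableT) [X in (_ * X)%E]probability_setT mule1.
have h := has_integralD (has_integral_char_det_mul x y) (has_integralD
  (has_integralZ (- a) dy) (has_integralD (has_integralZ (- b) dx) c1)).
transitivity (fine (\int[P]_w (D x w * D y w + (- a * D y w + (- b * D x w + a * b)))%:E)%E).
  congr fine; apply: eq_integral => w _; congr EFin => /=.
  by change ((D x w - a) * (D y w - b) = D x w * D y w + (- a * D y w + (- b * D x w + a * b))); ring.
rewrite h.2 /= -/a -/b.
have -> : hermite N x * hermite N y = a * b.
  by rewrite /a /b mulrACA -expr2 sqrr_sign mul1r.
by ring.
Qed.

End DeterminantCovariance.

(** * Edge asymptotics *)

Section HermiteFunctions.
Variable R : realType.
Implicit Types (x s : R) (n : nat).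

Lemma derive_hermite n x : has_deriv (hermite n) x (dhermite n x).
Proof.
elim/ltn_ind: n => -[|[|n]] IH.
- by rewrite /dhermite mul0r; exact: derive_const.
- by rewrite /dhermite mulr1; exact: derive_var.
have h1 := IH n.+1 (ltnSn _); have h0 := IH n (ltnW (ltnSn _)).
apply: (@has_deriv_eq _ (fun y => y * hermite n.+1 y - n.+1%:R * hermite n y)).
  by derive_tac.
by rewrite /dhermite [n.+2.-1]/= [n.+1.-1]/= (hermiteS n); ring.
Qed.

(** Hermite's equation y'' = x y' - n y, with y'' expressed through [dhermite]. *)
Lemma hermite_ode n x :
  n%:R * dhermite n.-1 x = x * dhermite n x - n%:R * hermite n x.
Proof.
case: n => [|n]; first by rewrite /dhermite !mul0r mulr0 subr0.
by rewrite (hermiteS n) /dhermite [n.+1.-1]/=; ring.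
Qed.

Lemma derive_dhermite n x : has_deriv (dhermite n) x (n%:R * dhermite n.-1 x).
Proof.
apply: has_deriv_eq (derive_mul (derive_const _ _) (derive_hermite n.-1 x)) _.
by rewrite mul0r add0r.
Qed.

Lemma norm_le_gauss (t x : R) : 0 < t -> `|x| <= (1 + t^-1) * expR (t * x ^+ 2).
Proof.
move=> t0; have ti : 0 < t^-1 by rewrite invr_gt0.
apply: (@le_trans _ _ ((1 + t^-1) * (1 + t * x ^+ 2))); last first.
  by rewrite ler_pM2l ?addr_gt0// expR_ge1Dx.
have -> : (1 + t^-1) * (1 + t * x ^+ 2) = 1 + x ^+ 2 + t^-1 + t * x ^+ 2.
  by field; exact: lt0r_neq0.
have : 0 <= t * x ^+ 2 by rewrite mulr_ge0 ?sqr_ge0 ?ltW.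
rewrite -real_normK ?num_real//; move: `|x| => y ty; nra.
Qed.

(** Every rate t is treated at once because the induction spends half of the exponent on the factor
    x; the case t = 1/4 bounds Hermite functions. *)
Lemma hermite_le_gauss n (t : R) : 0 < t ->
  exists2 C, 0 <= C & forall x, `|hermite n x| <= C * expR (t * x ^+ 2).
Proof.
elim/ltn_ind: n t => -[|[|n]] IH t t0.
- exists 1 => // x; rewrite mul1r normr1.
  by rewrite (le_trans _ (expR_ge1Dx _))// lerDl mulr_ge0 ?sqr_ge0 ?ltW.
- exists (1 + t^-1) => [|x]; last exact: norm_le_gauss.
  by rewrite addr_ge0// invr_ge0 ltW.
have t2 : 0 < t / 2 by rewrite divr_gt0.
have [C1 C10 h1] := IH n.+1 (ltnSn _) _ t2.
have [C0 C00 h0] := IH n (ltnW (ltnSn _)) _ t0.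
pose A := (1 + (t / 2)^-1); have A0 : 0 <= A by rewrite addr_ge0// invr_ge0 ltW.
exists (A * C1 + n.+1%:R * C0) => [|x]; first by rewrite addr_ge0 ?mulr_ge0.
rewrite hermiteSS (le_trans (ler_normB _ _))// !normrM normr_nat mulrDl.
rewrite -[n.+1%:R * C0 * _]mulrA; apply: lerD; last by rewrite ler_wpM2l.
have -> : expR (t * x ^+ 2) = expR (t / 2 * x ^+ 2) * expR (t / 2 * x ^+ 2).
  by rewrite -expRD; congr expR; field.
by rewrite mulrACA ler_pM// norm_le_gauss.
Qed.

Definition gauss x : R := expR (- (x ^+ 2 / 4)).

Definition hermite_fun n x : R := hermite n x * gauss x.

Definition hermite_fun1 n x : R := (dhermite n x - x / 2 * hermite n x) * gauss x.

Lemma derive_gauss x : has_deriv gauss x (- (x / 2) * gauss x).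
Proof.
apply: has_deriv_eq; first by rewrite /gauss; derive_tac.
by rewrite /gauss; field.
Qed.

Lemma derive_hermite_fun n x : has_deriv (hermite_fun n) x (hermite_fun1 n x).
Proof.
apply: has_deriv_eq (derive_mul (derive_hermite n x) (derive_gauss x)) _.
by rewrite /hermite_fun1; ring.
Qed.

Lemma derive_hermite_fun1 n x : has_deriv (hermite_fun1 n) x
  ((x ^+ 2 / 4 - n%:R - 2^-1) * hermite_fun n x).
Proof.
have dx := derive_mul (derive_var x) (derive_const 2^-1 x).
apply: has_deriv_eq (derive_mul (derive_sub (derive_dhermite n x)
  (derive_mul dx (derive_hermite n x))) (derive_gauss x)) _.
by rewrite hermite_ode /hermite_fun; field.
Qed.

Lemma hermite_fun_bounded n : exists B, forall x, `|hermite_fun n x| <= B.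
Proof.
have [C C0 h] := @hermite_le_gauss n 4^-1 ltac:(by []).
exists C => x; rewrite /hermite_fun normrM [`|gauss x|]ger0_norm ?expR_ge0//.
apply: (@le_trans _ _ (C * expR (4^-1 * x ^+ 2) * gauss x)).
  by rewrite ler_wpM2r ?expR_ge0.
by rewrite -mulrA /gauss -expRD mulrC [4^-1 * _]mulrC subrr expR0 mul1r.
Qed.

(** The confluent Christoffel-Darboux formula He'^2 - He He'', with He'' eliminated by Hermite's
    equation. *)
Lemma kernel_sum_diag n x : dhermite n.+1 x ^+ 2
    - x * dhermite n.+1 x * hermite n.+1 x + n.+1%:R * hermite n.+1 x ^+ 2 =
  (n.+1`!)%:R * kernel_sum (hermite ^~ x) (hermite ^~ x) n.
Proof.
elim: n => [|n IH].
  by rewrite kernel_sum0 /dhermite /= (_ : (1`!)%N = 1%N)//; ring.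
rewrite kernel_sumS factS natrM.
have f0 := fact_neq0 R n.+1.
transitivity (n.+2%:R * ((n.+1`!)%:R * kernel_sum (hermite^~ x) (hermite^~ x) n
  + hermite n.+1 x ^+ 2)); last by field.
by rewrite -IH hermiteSS /dhermite [n.+2.-1]/= [n.+1.-1]/=; ring.
Qed.

Lemma kernel_sum_ge1 n x : 1 <= kernel_sum (hermite ^~ x) (hermite ^~ x) n.
Proof.
rewrite /kernel_sum big_ord_recl /= fact0 divr1 mulr1 lerDl.
by apply: sumr_ge0 => k _; rewrite divr_ge0// -expr2 sqr_ge0.
Qed.

(** A common zero of He_n and He_n' would annihilate the diagonal kernel, which is at least 1. *)
Lemma hermite_fun_neq0 n x : (0 < n)%N ->
  0 < `|hermite_fun n x| + `|hermite_fun1 n x|.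
Proof.
case: n => [//|n] _; rewrite lt_neqAle addr_ge0 ?normr_ge0// andbT eq_sym.
apply/eqP => /eqP; rewrite paddr_eq0// !normr_eq0 /hermite_fun /hermite_fun1.
have /negbTE g0 : gauss x != 0 by rewrite gt_eqF ?expR_gt0.
rewrite !mulf_eq0 g0 !orbF => /andP[/eqP h0]; rewrite h0 mulr0 subr0 => /eqP d0.
have := kernel_sum_diag n x; rewrite h0 d0 expr0n /= !mulr0 subr0 addr0.
move/esym/eqP; rewrite mulf_eq0 (negbTE (fact_neq0 _ _)) /=.
by rewrite gt_eqF// (lt_le_trans ltr01 (kernel_sum_ge1 _ _)).
Qed.

End HermiteFunctions.

Section EdgeScaling.
Variable R : realType.
Implicit Types (s mu nu e : R).

Definition edge_width (N : nat) : R := (N%:R `^ 6^-1)^-1.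

Local Notation al := edge_width.

Lemma edge_width_gt0 N : (0 < N)%N -> 0 < al N.
Proof. by move=> N0; rewrite invr_gt0 powR_gt0// ltr0n. Qed.

Lemma edge_width6 N : (0 < N)%N -> al N ^+ 6 * N%:R = 1.
Proof.
move=> N0; rewrite /al exprVn -powR_mulrn ?powR_ge0// -powRrM mulVf//.
by rewrite powRr1// mulVf// pnatr_eq0 -lt0n.
Qed.

Lemma edge_width3 N : (0 < N)%N -> al N ^+ 3 * Num.sqrt N%:R = 1.
Proof.
move=> N0; have a0 := edge_width_gt0 N0.
apply/eqP; rewrite -(@eqrXn2 _ 2)// ?mulr_ge0 ?sqrtr_ge0 ?exprn_ge0 ?ltW//.
by rewrite expr1n exprMn sqr_sqrtr// -exprM edge_width6.
Qed.

Lemma edge_pointE N s : edge_point N s = 2 * Num.sqrt N%:R + s * al N.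
Proof. by []. Qed.

Lemma edge_width_small e : 0 < e -> \forall N \near \oo, (0 < N)%N /\ al N <= e.
Proof.
move=> e0; near=> N.
have N0 : (0 < N)%N by near: N; exact: nbhs_infty_gt.
split=> //; have a0 := edge_width_gt0 N0.
rewrite leNgt; apply/negP => ea.
have : (e ^+ 6)^-1 <= N%:R by near: N; exact: nbhs_infty_ger.
rewrite leNgt => /negP; apply.
rewrite -[ltRHS]mul1r ltr_pdivlMr ?exprn_gt0// mulrC -[ltRHS](edge_width6 N0).
by rewrite ltr_pM2r ?ltr0n// ltrXn2r// ltW.
Unshelve. all: by end_near. Qed.

Lemma edge_width_cvg0 : al N @[N --> \oo] --> 0.
Proof.
apply/cvgrPdist_le => e e0; near=> N; rewrite sub0r normrN.
have [N0 ae] : (0 < N)%N /\ al N <= e by near: N; exact: edge_width_small.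
by rewrite ger0_norm// ltW// edge_width_gt0.
Unshelve. all: by end_near. Qed.

(** The cross term of the square is s al^3 sqrt N = s: this exact identity dictates the scale
    N^{-1/6}. *)
Lemma edge_point_sqr N s : (0 < N)%N ->
  al N ^+ 2 * (edge_point N s ^+ 2 / 4 - N%:R) = s + al N ^+ 4 / 4 * s ^+ 2.
Proof.
move=> N0; rewrite edge_pointE; have := edge_width3 N0.
have : Num.sqrt N%:R ^+ 2 = N%:R :> R by rewrite sqr_sqrtr.
move: (al N) (Num.sqrt _) => a r <- ar.
transitivity (s * (a ^+ 3 * r) + a ^+ 4 / 4 * s ^+ 2); first by field.
by rewrite ar mulr1.
Qed.

Definition edge_hermite N s : R := hermite_fun N (edge_point N s).
Definition edge_hermite1 N s : R := al N * hermite_fun1 N (edge_point N s).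

Lemma edge_hermite_solution N : (0 < N)%N ->
  edge_solution (al N) (edge_hermite N) (edge_hermite1 N).
Proof.
move=> N0.
have dp s : has_deriv (fun t => 2 * Num.sqrt N%:R + t * al N) s (al N).
  apply: has_deriv_eq (derive_add (derive_const _ _)
    (derive_mul (derive_var s) (derive_const (al N) s))) _.
  by rewrite mul1r mulr0 addr0 add0r.
split=> [s|s|].
- by apply: has_deriv_eq; [exact: (derive_comp (derive_hermite_fun _ _) (dp s)) |
    rewrite mulrC].
- apply: has_deriv_eq.
    exact: (derive_mul (derive_const _ _) (derive_comp (derive_hermite_fun1 _ _) (dp s))).
  rewrite mul0r add0r -edge_pointE -/(edge_hermite N s).
  transitivity ((s + al N ^+ 4 / 4 * s ^+ 2 - al N ^+ 2 / 2) * edge_hermite N s).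
    by rewrite -edge_point_sqr//; ring.
  by rewrite /edge_defect addrA.
- by have [B hB] := hermite_fun_bounded R N; exists B => s _; exact: hB.
Qed.

Variable s0 : R.
Hypothesis s0_ge1 : 1 <= s0.

(** Its size and sign stay unknown; being nonzero for large N is enough, since it cancels in the
    correlation. *)
Definition edge_scale N : R := airy_scale s0 (edge_hermite N) (edge_hermite1 N).

Lemma edge_hermite_near_airy s e : s <= s0 -> 0 < e ->
  \forall N \near \oo, edge_scale N != 0 /\
    (`|edge_hermite N s / edge_scale N - airy s| <= e /\
     `|edge_hermite1 N s / edge_scale N - airy1 s| <= e).
Proof.
move=> ss0 e0; have [dl /andP[dl0 _] near_airy] := edge_solution_near_airy s s0_ge1 e0.
near=> N; have [N0 ad] : (0 < N)%N /\ al N <= dl by near: N; exact: edge_width_small.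
have a0 := edge_width_gt0 N0.
have [||l0 h] := near_airy (al N) _ _ _ (edge_hermite_solution N0).
- by rewrite a0.
- have := hermite_fun_neq0 (edge_point N s0) N0.
  rewrite /edge_hermite /edge_hermite1 (normrM (al N)) (gtr0_norm a0).
  move: (normr_ge0 (hermite_fun N (edge_point N s0)))
    (normr_ge0 (hermite_fun1 N (edge_point N s0))).
  move: `|hermite_fun N _| `|hermite_fun1 N _| => u v; rewrite le_eqVlt => /orP[].
    by move=> /eqP <- v0; rewrite !add0r => v1; rewrite mulr_gt0.
  by move=> u0 v0 _; rewrite ltr_wpDr// mulr_ge0// ltW.
- by split=> //; apply: h; rewrite lexx.
Unshelve. all: by end_near. Qed.

End EdgeScaling.

(** * Limit of the Christoffel-Darboux kernel at the edge *)

Section EdgeKernel.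
Variables (R : realType) (s0 : R).
Hypothesis s0_ge1 : 1 <= s0.
Implicit Types (s t e C : R) (N k : nat).

Local Notation al := (@edge_width R).
Local Notation lam := (edge_scale s0).

Lemma cvg_near_eq (u v : nat -> R) (l : R) :
  (\forall N \near \oo, u N = v N) -> v N @[N --> \oo] --> l ->
  u N @[N --> \oo] --> l.
Proof.
by move=> uv vl; apply: cvg_trans vl; apply: near_eq_cvg; near=> N;
  apply/esym; near: N.
Unshelve. all: by end_near. Qed.

(** The normalizing factor is that of level [N] for every degree [k], so it comes out of sums over
    [k]. *)
Definition scaled_hermite N k s : R :=
  hermite k (edge_point N s) * (gauss (edge_point N s) / lam N).

Local Notation hn := scaled_hermite.

Definition scaled_hermite1 N s : R := al N * (dhermite N (edge_point N s)
  - edge_point N s / 2 * hermite N (edge_point N s)) * (gauss (edge_point N s) / lam N).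

Local Notation hp := scaled_hermite1.

Lemma edge_scale_neq0 : \forall N \near \oo, lam N != 0.
Proof.
near=> N; suff [] : lam N != 0 /\ (`|edge_hermite N s0 / lam N - airy s0| <= 1 /\
     `|edge_hermite1 N s0 / lam N - airy1 s0| <= 1) by [].
by near: N; exact: edge_hermite_near_airy.
Unshelve. all: by end_near. Qed.

Lemma scaled_hermite_cvg s : s <= s0 -> hn N N s @[N --> \oo] --> airy s.
Proof.
move=> ss0; apply/cvgrPdist_le => e e0; near=> N.
have [_ []] : lam N != 0 /\ (`|edge_hermite N s / lam N - airy s| <= e /\
     `|edge_hermite1 N s / lam N - airy1 s| <= e).
  by near: N; exact: edge_hermite_near_airy.
by rewrite distrC /hn mulrA.
Unshelve. all: by end_near. Qed.

Lemma scaled_hermite1_cvg s : s <= s0 -> hp N s @[N --> \oo] --> airy1 s.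
Proof.
move=> ss0; apply/cvgrPdist_le => e e0; near=> N.
have [_ [_]] : lam N != 0 /\ (`|edge_hermite N s / lam N - airy s| <= e /\
     `|edge_hermite1 N s / lam N - airy1 s| <= e).
  by near: N; exact: edge_hermite_near_airy.
by rewrite distrC /hp /edge_hermite1 /hermite_fun1 !mulrA.
Unshelve. all: by end_near. Qed.

Definition scaled_kernel N j s t : R :=
  al N ^+ 2 * (N`!)%:R * kernel_sum (hn N ^~ s) (hn N ^~ t) j.

Local Notation kern := scaled_kernel.

Lemma kernel_sum_scale (a b : nat -> R) (p q : R) n :
  kernel_sum (fun k => a k * p) (fun k => b k * q) n = p * q * kernel_sum a b n.
Proof. by rewrite /kernel_sum mulr_sumr; apply: eq_bigr => k _; ring. Qed.

Lemma scaled_kernelE N j s t : kern N j s t = al N ^+ 2 * (N`!)%:R *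
  ((gauss (edge_point N s) / lam N) * (gauss (edge_point N t) / lam N) *
   kernel_sum (hermite ^~ (edge_point N s)) (hermite ^~ (edge_point N t)) j).
Proof. by rewrite -kernel_sum_scale. Qed.

(** Christoffel-Darboux in edge coordinates. The parts - x/2 He of the two derivatives cancel up to
    (x - y) / 2 = al (s - t) / 2, which leaves a correction of order al^2. *)
Lemma scaled_kernel_offdiag N s t : (0 < N)%N ->
  (s - t) * kern N N.-1 s t = hn N N s * hp N t - hp N s * hn N N t
    - al N ^+ 2 * (s - t) / 2 * hn N N s * hn N N t.
Proof.
case: N => [//|n] _; rewrite scaled_kernelE [n.+1.-1]/=.
have := christoffel_darboux n (edge_point n.+1 s) (edge_point n.+1 t).
have : edge_point n.+1 s - edge_point n.+1 t = al n.+1 * (s - t).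
  by rewrite !edge_pointE; ring.
rewrite /scaled_hermite /scaled_hermite1.
move: (edge_point _ s) (edge_point _ t) (gauss _ / _) (gauss _ / _) => x y g g' xy.
rewrite xy; set K := kernel_sum _ _ n.
move: (hermite _ x) (hermite _ y) (dhermite _ x) (dhermite _ y) => h h' d d' CD.
transitivity (al n.+1 * g * g' * (al n.+1 * (s - t) * (n.+1)`!%:R * K)); first by ring.
rewrite -CD; have -> : al n.+1 ^+ 2 * (s - t) = al n.+1 * (x - y) by rewrite xy; ring.
by field.
Qed.

Lemma scaled_kernel_diag N s : (0 < N)%N ->
  kern N N.-1 s s = hp N s ^+ 2 - (s + al N ^+ 4 / 4 * s ^+ 2) * hn N N s ^+ 2.
Proof.
case: N => [//|n] N0; rewrite scaled_kernelE [n.+1.-1]/= -edge_point_sqr//.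
have := kernel_sum_diag n (edge_point n.+1 s).
rewrite /scaled_hermite /scaled_hermite1.
move: (edge_point _ s) (gauss _ / _) => x g.
set K := kernel_sum _ _ n; move: (hermite _ x) (dhermite _ x) => h d CD.
transitivity (al n.+1 ^+ 2 * g ^+ 2 * ((n.+1)`!%:R * K)); first by ring.
by rewrite -CD; field.
Qed.

(** The Airy kernel with its diagonal value Ai'^2 - Ai Ai'' in closed form. *)
Definition airy_limit s t : R := if s == t then airy1 s ^+ 2 - s * airy s ^+ 2
  else (airy s * airy1 t - airy1 s * airy t) / (s - t).

Lemma edge_width_expn_cvg0 k : al N ^+ k.+1 @[N --> \oo] --> 0.
Proof.
have := @edge_width_cvg0 R => a0.
elim: k => [|k IH]; first by under eq_fun do rewrite expr1.
under eq_fun do rewrite exprS; rewrite -[nbhs 0]/(nbhs (0 : R)) -(mulr0 (0 : R)).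
exact: cvgM.
Qed.

Let cvg_diagonal (u p w : nat -> R) (a b c d : R) :
  u N @[N --> \oo] --> a -> p N @[N --> \oo] --> b -> w N @[N --> \oo] --> 0 ->
  p N * p N - (c + w N / 4 * d) * (u N * u N) @[N --> \oo] -->
  b * b - (c + 0 / 4 * d) * (a * a).
Proof.
move=> ua pb w0; apply: cvgB; first exact: cvgM.
apply: cvgM; last exact: cvgM.
apply: cvgD; first exact: cvg_cst.
by apply: cvgM; last exact: cvg_cst; apply: cvgM => //; exact: cvg_cst.
Qed.

Let cvg_wronskian (u u1 v v1 w : nat -> R) (a a1 b b1 c d : R) :
  u N @[N --> \oo] --> a -> u1 N @[N --> \oo] --> a1 ->
  v N @[N --> \oo] --> b -> v1 N @[N --> \oo] --> b1 -> w N @[N --> \oo] --> 0 ->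
  c * (u N * v1 N - u1 N * v N - w N * d * (u N * v N)) @[N --> \oo] -->
  c * (a * b1 - a1 * b - 0 * d * (a * b)).
Proof.
move=> ua ua1 vb vb1 w0; apply: cvgM; first exact: cvg_cst.
apply: cvgB; first by apply: cvgB; exact: cvgM.
by apply: cvgM; last exact: cvgM; apply: cvgM => //; exact: cvg_cst.
Qed.

Lemma scaled_kernel_cvg1 s t : s <= s0 -> t <= s0 ->
  kern N N.-1 s t @[N --> \oo] --> airy_limit s t.
Proof.
move=> ss0 ts0; rewrite /airy_limit.
have hs := scaled_hermite_cvg ss0; have ht := scaled_hermite_cvg ts0.
have ps := scaled_hermite1_cvg ss0; have pt := scaled_hermite1_cvg ts0.
case: eqVneq => [<-|st].
  have -> : airy1 s ^+ 2 - s * airy s ^+ 2 =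
      airy1 s * airy1 s - (s + 0 / 4 * s ^+ 2) * (airy s * airy s) by ring.
  apply: (@cvg_near_eq _ (fun N => hp N s * hp N s
      - (s + al N ^+ 4 / 4 * s ^+ 2) * (hn N N s * hn N N s))).
    near=> N; rewrite scaled_kernel_diag; first by rewrite -!expr2.
    by near: N; exact: nbhs_infty_gt.
  exact: (@cvg_diagonal (fun N => hn N N s) (hp ^~ s) (fun N => al N ^+ 4) _ _
    s (s ^+ 2) hs ps (edge_width_expn_cvg0 3)).
have st0 : s - t != 0 by rewrite subr_eq0.
have -> : (airy s * airy1 t - airy1 s * airy t) / (s - t) = (s - t)^-1 *
    (airy s * airy1 t - airy1 s * airy t - 0 * ((s - t) / 2) * (airy s * airy t)).
  by field.
apply: (@cvg_near_eq _ (fun N => (s - t)^-1 * (hn N N s * hp N t - hp N s * hn N N t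
    - al N ^+ 2 * ((s - t) / 2) * (hn N N s * hn N N t)))).
  near=> N; apply: (mulfI st0); rewrite scaled_kernel_offdiag.
    by field.
  by near: N; exact: nbhs_infty_gt.
exact: (@cvg_wronskian (fun N => hn N N s) (hp ^~ s) (fun N => hn N N t) (hp ^~ t)
  (fun N => al N ^+ 2) _ _ _ _ _ _ hs ps ht pt (edge_width_expn_cvg0 1)).
Unshelve. all: by end_near. Qed.

(** The summand of degree N - k of the scaled kernel: the falling factorial is N! / (N - k)!. *)
Definition kernel_term N k s t : R :=
  al N ^+ 2 * (N ^_ k)%:R * (hn N (N - k) s * hn N (N - k) t).

Local Notation term := kernel_term.

Let factor_ge0 N k : 0 <= al N ^+ 2 * (N ^_ k)%:R.
Proof. by rewrite mulr_ge0 ?sqr_ge0 ?ler0n. Qed.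

Lemma kernel_term_ge0 N k s : 0 <= term N k s s.
Proof. by rewrite /term -expr2 mulr_ge0// sqr_ge0. Qed.

Lemma kernel_term_le N k s t : `|term N k s t| <= term N k s s + term N k t t.
Proof.
rewrite /term normrM -mulrDr [X in X * _]ger0_norm//; apply: ler_wpM2l => //.
move: (hn _ _ s) (hn _ _ t) => a b; rewrite ler_norml; nra.
Qed.

Lemma scaled_kernelS N k s t : (k < N)%N ->
  kern N (N - k) s t = kern N (N - k.+1) s t + term N k s t.
Proof.
move=> kN; have Nk : (N - k = (N - k.+1).+1)%N by rewrite subnSK.
rewrite /scaled_kernel /kernel_term Nk kernel_sumS -Nk mulrDr; congr (_ + _).
rewrite -(ffact_fact (ltnW kN)) natrM; have := fact_neq0 R (N - k).
by move: ((N - k)`!%:R) => f f0; field.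
Qed.

Lemma edge_point_sqr_le N s : (0 < N)%N -> al N <= 1 ->
  edge_point N s ^+ 2 <= (8 + 2 * s ^+ 2) * N%:R.
Proof.
move=> N0 a1; have a0 := edge_width_gt0 R N0; rewrite edge_pointE.
have N1 : 1 <= N%:R :> R by rewrite ler1n.
have : Num.sqrt N%:R ^+ 2 = N%:R :> R by rewrite sqr_sqrtr.
move: (Num.sqrt N%:R) => r rN.
have : (s * al N) ^+ 2 <= s ^+ 2 * N%:R.
  rewrite exprMn ler_wpM2l ?sqr_ge0// (le_trans _ N1)//.
  by rewrite expr_le1// ltW.
rewrite -rN; move: (s * al N) => u; have := sqr_ge0 (2 * r - u); nra.
Qed.

(** The three-term recurrence read downward, (n + 1) He_n = x He_{n+1} - He_{n+2}, with x^2 of order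
    N and N <= 2 (n + 1). Degrees below N then need no asymptotics of their own. *)
Lemma kernel_term_rec N k s : ((k.+1).*2 <= N)%N -> al N <= 1 ->
  term N k.+2 s s <= 4 * (8 + 2 * s ^+ 2) * term N k.+1 s s + 4 * term N k s s.
Proof.
move=> kN a1; have N0 : (0 < N)%N by rewrite (leq_trans _ kN).
have x2 := edge_point_sqr_le s N0 a1.
have k1N : (k.+1 < N)%N by rewrite (leq_trans _ kN)// -addnn addSn addnS !ltnS leq_addl.
have [n Nn] : exists n, (N = n + k.+2)%N by exists (N - k.+2)%N; rewrite subnK.
have kn : (k <= n)%N.
  by move: kN; rewrite Nn -addnn !addnS !addSn !ltnS leq_add2r.
have e0 : (N - k = n.+2)%N by rewrite Nn -!addSnnS addnK.
have e1 : (N - k.+1 = n.+1)%N by rewrite Nn -(addSnnS n k.+1) addnK.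
have e2 : (N - k.+2 = n)%N by rewrite Nn addnK.
have f1 : al N ^+ 2 * (N ^_ k.+1)%:R = al N ^+ 2 * (N ^_ k)%:R * n.+2%:R.
  by rewrite ffactnSr e0 natrM mulrA.
have f2 : al N ^+ 2 * (N ^_ k.+2)%:R = al N ^+ 2 * (N ^_ k)%:R * n.+2%:R * n.+1%:R.
  by rewrite ffactnSr e1 natrM mulrA f1.
rewrite /kernel_term f2 f1 e0 e1 e2.
have A0 := factor_ge0 N k.
have hrec : n.+1%:R * hn N n s = edge_point N s * hn N n.+1 s - hn N n.+2 s.
  by rewrite /scaled_hermite hermiteSS; ring.
move: A0 x2 hrec; move: (al N ^+ 2 * _) (edge_point N s) => A x A0 x2 hrec.
move: (hn N n s) (hn N n.+1 s) (hn N n.+2 s) hrec => h0 h1 h2 hrec.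
have m1 : 1 <= n.+1%:R :> R by rewrite ler1n.
have Nm : N%:R <= 2 * n.+1%:R :> R.
  rewrite -natrM ler_nat Nn mul2n -addnn !addnS !addSn !ltnS.
  by rewrite leq_add2l.
have -> : (n.+2)%:R = n.+1%:R + 1 :> R by rewrite -natr1.
move: (n.+1%:R) m1 Nm hrec => m m1 Nm hrec.
have m0 : 0 < m by lra.
rewrite -[leLHS](@mulfK _ m) ?lt0r_neq0// ler_pdivrMr//.
have -> : A * (m + 1) * m * (h0 * h0) * m = A * ((m + 1) * (m * h0) ^+ 2) by ring.
rewrite hrec.
have -> : (4 * (8 + 2 * s ^+ 2) * (A * (m + 1) * (h1 * h1)) + 4 * (A * (h2 * h2))) * m
  = A * ((4 * (8 + 2 * s ^+ 2) * ((m + 1) * (h1 * h1)) + 4 * (h2 * h2)) * m) by ring.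
apply: ler_wpM2l => //.
have i1 : (x * h1 - h2) ^+ 2 <= 2 * (x ^+ 2 * h1 ^+ 2) + 2 * h2 ^+ 2.
  by rewrite -exprMn; have := sqr_ge0 (x * h1 + h2); move: (x * h1) => z; nra.
have i2 : x ^+ 2 * h1 ^+ 2 <= (8 + 2 * s ^+ 2) * (2 * m) * h1 ^+ 2.
  rewrite ler_wpM2r ?sqr_ge0// (le_trans x2)// ler_wpM2l//.
  by rewrite addr_ge0// mulr_ge0// sqr_ge0.
apply: (@le_trans _ _ ((m + 1) * (2 * ((8 + 2 * s ^+ 2) * (2 * m) * h1 ^+ 2) + 2 * h2 ^+ 2))).
  apply: ler_wpM2l; first by lra.
  by apply: (le_trans i1); lra.
have -> : (m + 1) * (2 * ((8 + 2 * s ^+ 2) * (2 * m) * h1 ^+ 2) + 2 * h2 ^+ 2) =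
  4 * (8 + 2 * s ^+ 2) * ((m + 1) * (h1 * h1)) * m + 2 * (m + 1) * h2 ^+ 2 by ring.
rewrite [leRHS]mulrDl lerD2l -expr2 [leRHS]mulrAC ler_wpM2r ?sqr_ge0//; lra.
Qed.

(** Starts the downward recurrence: N He_{N-1} = He_N' is controlled by the convergence of the
    derivative. *)
Lemma kernel_term1_le N s : (0 < N)%N -> al N <= 1 ->
  term N 1 s s <= 2 * al N ^+ 6 * hp N s ^+ 2
    + (4 + s ^+ 2) * al N ^+ 2 * hn N N s ^+ 2.
Proof.
move=> N0 a1; have x2 := edge_point_sqr_le s N0 a1.
have N1 : 1 <= N%:R :> R by rewrite ler1n.
rewrite -(ler_pM2r (lt_le_trans ltr01 N1)) mulrDl.
have -> : 2 * al N ^+ 6 * hp N s ^+ 2 * N%:R = 2 * hp N s ^+ 2.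
  transitivity (2 * hp N s ^+ 2 * (al N ^+ 6 * N%:R)); first by ring.
  by rewrite edge_width6// mulr1.
have -> : term N 1 s s * N%:R =
    (hp N s + al N * (edge_point N s / 2 * hn N N s)) ^+ 2.
  rewrite /kernel_term ffactn1 subn1 /scaled_hermite /scaled_hermite1 /dhermite.
  by move: (gauss _ / _) => g; field.
have -> : (4 + s ^+ 2) * al N ^+ 2 * hn N N s ^+ 2 * N%:R =
    (8 + 2 * s ^+ 2) * N%:R * ((al N * hn N N s) ^+ 2 / 2) by field.
apply: (@le_trans _ _ (2 * hp N s ^+ 2
    + edge_point N s ^+ 2 * ((al N * hn N N s) ^+ 2 / 2))); last first.
  by rewrite lerD2l ler_wpM2r// divr_ge0// sqr_ge0.
have -> : edge_point N s ^+ 2 * ((al N * hn N N s) ^+ 2 / 2) =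
    2 * (al N * (edge_point N s / 2 * hn N N s)) ^+ 2 by field.
move: (hp N s) (al N * _) => a b; have := sqr_ge0 (a - b); nra.
Qed.

Lemma kernel_term_cvg0_diag k s : s <= s0 -> term N k s s @[N --> \oo] --> 0.
Proof.
move=> ss0; have hs := scaled_hermite_cvg ss0; have ps := scaled_hermite1_cvg ss0.
have a1 : \forall N \near \oo, (0 < N)%N /\ al N <= 1 by exact: edge_width_small.
have an k' := edge_width_expn_cvg0 k'.
suff : term N k s s @[N --> \oo] --> 0 /\ term N k.+1 s s @[N --> \oo] --> 0 by case.
elim: k => [|k [IH0 IH1]]; last first.
  split=> //; apply: (@squeeze_cvgr _ _ _ R (fun=> 0)
    (fun N => 4 * (8 + 2 * s ^+ 2) * term N k.+1 s s + 4 * term N k s s)).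
  - near=> N; rewrite kernel_term_ge0 kernel_term_rec//.
      by near: N; exact: nbhs_infty_ge.
    by have [] : (0 < N)%N /\ al N <= 1 by near: N.
  - exact: cvg_cst.
  - rewrite -[nbhs 0]/(nbhs (0 : R)).
    have -> : 0 = 4 * (8 + 2 * s ^+ 2) * 0 + 4 * 0 :> R by ring.
    by apply: cvgD; apply: cvgM => //; exact: cvg_cst.
split.
  rewrite -[nbhs 0]/(nbhs (0 : R)).
  have -> : 0 = 0 * 1 * (airy s * airy s) :> R by ring.
  apply: (@cvg_near_eq _ (fun N => al N ^+ 2 * 1 * (hn N N s * hn N N s))).
    by apply: nearW => N; rewrite /kernel_term ffactn0 subn0.
  apply: cvgM; last exact: cvgM.
  by apply: cvgM; [exact: an | exact: cvg_cst].
apply: (@squeeze_cvgr _ _ _ R (fun=> 0)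
  (fun N => 2 * al N ^+ 6 * (hp N s * hp N s)
    + (4 + s ^+ 2) * al N ^+ 2 * (hn N N s * hn N N s))).
- near=> N; rewrite kernel_term_ge0 -!expr2.
  have [N0 aN] : (0 < N)%N /\ al N <= 1 by near: N.
  exact: kernel_term1_le.
- exact: cvg_cst.
- rewrite -[nbhs 0]/(nbhs (0 : R)).
  have -> : 0 = 2 * 0 * (airy1 s * airy1 s) + (4 + s ^+ 2) * 0 * (airy s * airy s) :> R.
    by ring.
  apply: cvgD; (apply: cvgM; [apply: cvgM; [exact: cvg_cst|exact: an]|exact: cvgM]).
Unshelve. all: by end_near. Qed.

Lemma kernel_term_cvg0 k s t : s <= s0 -> t <= s0 ->
  term N k s t @[N --> \oo] --> 0.
Proof.
move=> ss0 ts0; apply/cvgr0Pnorm_le => e e0.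
have small u : u <= s0 -> \forall N \near \oo, term N k u u <= e / 2.
  move=> us0; have /cvgr0Pnorm_le/(_ (e / 2)) := @kernel_term_cvg0_diag k u us0.
  rewrite divr_gt0// => /(_ erefl); apply: filterS => M.
  exact: le_trans (ler_norm _).
near=> N; apply: (le_trans (kernel_term_le _ _ _ _)); rewrite [leRHS](splitr e).
by apply: lerD; near: N; exact: small.
Unshelve. all: by end_near. Qed.

(** Kernels truncated at N - 1 and at N - k differ by a fixed number of summands, each tending to
    0. *)
Lemma scaled_kernel_cvg k s t : s <= s0 -> t <= s0 ->
  kern N (N - k) s t @[N --> \oo] --> airy_limit s t.
Proof.
move=> ss0 ts0; have t0 k' := kernel_term_cvg0 k' ss0 ts0.
have c1 : kern N (N - 1) s t @[N --> \oo] --> airy_limit s t.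
  by under eq_fun do rewrite subn1; exact: scaled_kernel_cvg1.
case: k => [|k].
  rewrite -[airy_limit s t]addr0.
  apply: (@cvg_near_eq _ (fun N => kern N (N - 1) s t + term N 0 s t)); last exact: cvgD.
  by near=> N; apply: scaled_kernelS; near: N; exact: nbhs_infty_gt.
elim: k => [//|k IH]; rewrite -[airy_limit s t]subr0.
apply: (@cvg_near_eq _ (fun N => kern N (N - k.+1) s t - term N k.+1 s t)); last exact: cvgB.
by near=> N; rewrite (@scaled_kernelS N k.+1) ?addrK//; near: N; exact: nbhs_infty_gt.
Unshelve. all: by end_near. Qed.

(** The domination for the sum over m: |a b| <= a^2 + b^2 termwise, and diagonal sums increase with
    [j]. *)
Lemma scaled_kernel_le N j s t : (j <= N)%N ->
  `|kern N j s t| <= kern N N s s + kern N N t t.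
Proof.
move=> jN; rewrite /scaled_kernel /kernel_sum -mulrDr normrM ger0_norm; last first.
  by rewrite mulr_ge0 ?sqr_ge0.
apply: ler_wpM2l; first by rewrite mulr_ge0 ?sqr_ge0.
rewrite -big_split /= (le_trans (ler_norm_sum _ _ _))//.
rewrite (big_ord_widen N.+1 (fun k => `|hn N k s * hn N k t / k`!%:R|))// big_mkcond.
apply: ler_sum => k _; rewrite -mulrDl.
have g0 : 0 <= (k`!%:R)^-1 :> R by rewrite invr_ge0.
case: ifP => _; last by rewrite mulr_ge0// addr_ge0// -expr2 sqr_ge0.
rewrite normrM (ger0_norm g0) ler_wpM2r//.
move: (hn _ _ s) (hn _ _ t) => a b; rewrite ler_norml; nra.
Qed.

End EdgeKernel.

(** * Dominated convergence for sums of growing length *)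

Section Tannery.
Variable R : realType.

Lemma tannery (c : nat -> R) (u : nat -> nat -> R) (M : R) :
  cvgn (series (fun m => `|c m|)) ->
  (\forall N \near \oo, forall m, `|u N m| <= M) ->
  (forall m, u N m @[N --> \oo] --> 0) ->
  \sum_(m < N.+1) c m * u N m @[N --> \oo] --> 0.
Proof.
move=> cc uM u0; set s := series _ in cc; pose S := limn s.
have s_nd : {homo s : n m / (n <= m)%N >-> n <= m}.
  move=> m n mn; rewrite -subr_ge0 sub_series_geq//.
  by apply: sumr_ge0 => k _; exact: normr_ge0.
have sS n : s n <= S by exact: nondecreasing_cvgn_le.
have S0 : 0 <= S by apply: le_trans (sS 0%N); rewrite /s /series /= big_geq.
have M0 : 0 <= M.
  have [N uN] : exists N, forall m, `|u N m| <= M by exact: filter_ex uM.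
  exact: le_trans (normr_ge0 _) (uN 0%N).
have S1 : 0 < S + 1 by rewrite ltr_wpDl.
have M1 : 0 < M + 1 by rewrite ltr_wpDl.
apply/cvgr0Pnorm_le => e e0.
have [K sK] : exists K, S - s K <= e / 2 / (M + 1).
  have : \forall n \near \oo, `|S - s n| <= e / 2 / (M + 1).
    by move/cvgrPdist_le : cc; apply; rewrite !divr_gt0.
  by move=> /filter_ex[K hK]; exists K; exact: le_trans (ler_norm _) hK.
have small : \forall N \near \oo, forall m : 'I_K, `|u N m| <= e / 2 / (S + 1).
  apply: filter_forall => m; move/cvgr0Pnorm_le : (u0 m); apply.
  by rewrite !divr_gt0.
near=> N.
have uN : forall m, `|u N m| <= M by near: N.
have us : forall m : 'I_K, `|u N m| <= e / 2 / (S + 1) by near: N.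
have KN : (K <= N.+1)%N by apply: leqW; near: N; exact: nbhs_infty_ge.
apply: (le_trans (ler_norm_sum _ _ _)).
rewrite -(big_mkord xpredT (fun m => `|c m * u N m|)) (big_cat_nat (leq0n K) KN)//=.
rewrite [leRHS](splitr e); apply: lerD.
  apply: (@le_trans _ _ (\sum_(0 <= m < K) `|c m| * (e / 2 / (S + 1)))).
    rewrite !big_mkord; apply: ler_sum => m _.
    by rewrite normrM ler_wpM2l.
  rewrite -mulr_suml -[X in X * _]/(s K) mulrA ler_pdivrMr// [leRHS]mulrC.
  rewrite ler_wpM2r ?divr_ge0 ?(ltW e0)//.
  by rewrite (le_trans (sS K))// lerDl.
apply: (@le_trans _ _ (\sum_(K <= m < N.+1) `|c m| * M)).
  by apply: ler_sum => m _; rewrite normrM ler_wpM2l.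
rewrite -mulr_suml -(sub_series_geq (fun m => `|c m|))// -/s.
apply: (@le_trans _ _ (e / 2 / (M + 1) * M)).
  by rewrite ler_wpM2r// (le_trans _ sK)// lerD2r.
by rewrite mulrAC ler_pdivrMr// ler_wpM2l ?divr_ge0 ?(ltW e0)// lerDl.
Unshelve. all: by end_near. Qed.

End Tannery.

(** * Positivity and continuous extension of the Airy kernel *)

Section AiryKernel.
Variable R : realType.
Implicit Types (s t : R).

(** The sign is inherited from the Hermite kernels, which are sums of squares on the diagonal. *)
Lemma airy_limit_ge0 s : 0 <= airy_limit s s.
Proof.
pose s0 := Num.max 1 s.
have s01 : 1 <= s0 by rewrite le_max lexx.
have ss0 : s <= s0 by rewrite le_max lexx orbT.
have c := scaled_kernel_cvg1 s01 ss0 ss0.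
rewrite -(cvg_lim (@Rhausdorff R) c); apply: limr_ge; first by apply/cvg_ex; exists (airy_limit s s).
apply: nearW => N; rewrite /scaled_kernel -mulrA mulr_ge0 ?sqr_ge0// mulr_ge0 ?ler0n//.
by apply: sumr_ge0 => k _; rewrite divr_ge0 ?ler0n// -expr2 sqr_ge0.
Qed.

Lemma derive_airy_limit s :
  has_deriv (fun s => airy1 s ^+ 2 - s * airy s ^+ 2) s (- airy s ^+ 2).
Proof.
have h := airy_derive s; have h1 := airy1_derive s.
apply: has_deriv_eq (derive_sub (derive_pow 2 h1)
  (derive_mul (derive_var s) (derive_pow 2 h))) _.
by rewrite /= expr1; ring.
Qed.

(* The diagonal is nonincreasing with derivative -Ai^2, so a zero would make
   Ai and Ai' vanish at a common point. *)
Lemma airy_limit_gt0 s : 0 < airy_limit s s.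
Proof.
pose f s := airy1 s ^+ 2 - s * airy s ^+ 2 : R.
have fE t : airy_limit t t = f t by rewrite /airy_limit eqxx.
have f0 t : 0 <= f t by rewrite -fE airy_limit_ge0.
have fle a b : a <= b -> f b <= f a.
  move=> ab; have [c _ e] := mean_value ab (fun t _ => derive_airy_limit t).
  by rewrite -subr_le0 e mulNr oppr_le0 mulr_ge0 ?sqr_ge0 ?subr_ge0.
rewrite fE lt_neqAle f0 andbT eq_sym; apply/eqP => fs.
have fz t : s <= t -> f t = 0 by move=> st; apply/le_anti; rewrite f0 -fs fle.
pose a := Num.max s 0.
have sa : s <= a by rewrite le_max lexx.
have a0 : 0 <= a by rewrite le_max lexx orbT.
have aa1 : a <= a + 1 by rewrite lerDl.
have [c /andP[ac _] e] := mean_value aa1 (fun t _ => derive_airy_limit t).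
have : f (a + 1) - f a = 0 by rewrite !fz ?subrr// (le_trans sa).
rewrite /f e addrAC subrr add0r mulr1 => /eqP; rewrite oppr_eq0 => /eqP ac0.
have := fz c (le_trans sa ac); rewrite /f ac0 mulr0 subr0 => a1c0.
by have := airy_sqr_gt0 (le_trans a0 ac); rewrite ac0 a1c0 addr0 ltxx.
Qed.

Lemma derive1_airy s : derive1 (@airy R) s = airy1 s.
Proof. by rewrite derive1E; apply: derive_val; exact: airy_derive. Qed.

Lemma airy_quotientE s t : airy_quotient (s, t) =
  (airy s * airy1 t - airy1 s * airy t) / (s - t).
Proof. by rewrite /airy_quotient /= !derive1_airy. Qed.

(** With t fixed the numerator vanishes at s = t, so the quotient is one of its derivatives: a
    continuous expression in (c, t), as the extension to the diagonal requires. *)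
Lemma airy_quotient_mean_value s t : s != t -> exists2 c : R,
  Num.min s t <= c <= Num.max s t &
  airy_quotient (s, t) = airy1 c * airy1 t - c * airy c * airy t.
Proof.
move=> st; pose f u := airy u * airy1 t - airy1 u * airy t : R.
have df u : has_deriv f u (airy1 u * airy1 t - u * airy u * airy t).
  apply: has_deriv_eq (derive_sub (derive_mul (airy_derive u) (derive_const _ _))
    (derive_mul (airy1_derive u) (derive_const _ _))) _.
  by ring.
have ft : f t = 0 by rewrite /f; ring.
rewrite airy_quotientE -/(f s); have [ts|ts] := leP t s.
  have [c cst e] := mean_value ts (fun u _ => df u); exists c => //.
  move: e; rewrite ft subr0 => ->; rewrite mulfK// subr_eq0//.
have [c cst e] := mean_value (ltW ts) (fun u _ => df u); exists c => //.
have -> : f s = - (f t - f s) by rewrite ft; ring.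
by rewrite e -mulrN opprB mulfK// subr_eq0.
Qed.

Lemma airy_kernelE s t : airy_kernel s t = airy_limit s t.
Proof.
rewrite /airy_kernel /airy_limit; case: eqVneq => [<-|_]; last exact: airy_quotientE.
set D := [set p : R * R | p.1 != p.2].
(* Makes the punctured filter proper, so that [lim] is determined by convergence. *)
have Dc : closure D (s, s).
  move=> B /nbhs_ballP[e /= e0 sB]; exists (s + e / 2, s); split.
    by rewrite /D /= -subr_eq0 addrAC subrr add0r gt_eqF// divr_gt0.
  apply: sB; split => /=; last exact: ballxx.
  rewrite /ball /= opprD addNKr normrN gtr0_norm ?divr_gt0//.
  by rewrite ltr_pdivrMr// ltr_pMr// ltr1n.
have pf := within_nbhs_proper Dc.
have ac (u : R) : {for u, continuous (@airy R)} by exact: derive_continuous (airy_derive u).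
have a1c (u : R) : {for u, continuous (@airy1 R)} by exact: derive_continuous (airy1_derive u).
pose g p : R := airy1 p.1 * airy1 p.2 - p.1 * airy p.1 * airy p.2.
have gc : g p @[p --> (s, s)] --> airy1 s ^+ 2 - s * airy s ^+ 2.
  have c1 : (fun p : R * R => p.1) p @[p --> (s, s)] --> s by exact: cvg_fst.
  have c2 : (fun p : R * R => p.2) p @[p --> (s, s)] --> s by exact: cvg_snd.
  have -> : airy1 s ^+ 2 - s * airy s ^+ 2 = airy1 s * airy1 s - s * airy s * airy s by ring.
  apply: cvgB.
    by apply: cvgM; [exact: (cvg_comp _ _ c1 (a1c s)) | exact: (cvg_comp _ _ c2 (a1c s))].
  apply: cvgM; last exact: (cvg_comp _ _ c2 (ac s)).
  by apply: cvgM => //; exact: (cvg_comp _ _ c1 (ac s)).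
apply: cvg_lim => //; apply/cvgrPdist_le => e e0.
move/cvgrPdist_le/(_ _ e0) : gc => /nbhs_ballP[r /= r0 hr].
apply/nbhs_ballP; exists r => //= -[x y] [/= bx by_] xy.
have [c /andP[c1 c2] ->] := airy_quotient_mean_value xy.
(* Lying between x and y, c is as close to s as they are. *)
apply: (hr (c, y)); split=> //=.
move: bx by_ c1 c2; rewrite /ball /= !ltr_norml !ge_min !le_max => /andP[x1 x2] /andP[y1 y2].
by move=> /orP[] c1 /orP[] c2; lra.
Qed.

End AiryKernel.

(** * Limit of the normalized covariance and of the correlation *)

Section EdgeCovariance.
Variables (R : realType) (s0 c : R).
Hypothesis s0_ge1 : 1 <= s0.
Implicit Types s t : R.

Local Notation al := (@edge_width R).
Local Notation lam := (edge_scale s0).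

Definition edge_covariance N s t : R :=
  wigner_sum c (hermite ^~ (edge_point N s)) (hermite ^~ (edge_point N t)) N
  - hermite N (edge_point N s) * hermite N (edge_point N t).

Definition edge_factor N s : R := al N * (gauss (edge_point N s) / lam N).

Let kernel_at N m s t : R :=
  if (m.*2 <= N)%N then scaled_kernel s0 N (N - m.*2) s t else 0.

(** The weights c^m / m! are exponential coefficients. Subtracting the common limit leaves terms
    tending to 0, as [tannery] asks, and the product of means is the top summand, negligible by
    itself. *)
Lemma edge_covarianceE N s t :
  edge_factor N s * edge_factor N t * edge_covariance N s t =
  \sum_(m < N.+1) exp_coeff c m * (kernel_at N m s t - airy_limit s t)
  + series (exp_coeff c) N.+1 * airy_limit s t - kernel_term s0 N 0 s t.
Proof.
rewrite /edge_covariance mulrBr; congr (_ - _); last first.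
  by rewrite /kernel_term ffactn0 subn0 /scaled_hermite /edge_factor; ring.
rewrite seriesEord /= mulr_suml -big_split /= /wigner_sum big_mkcond mulr_sumr.
apply: eq_bigr => m _; rewrite -mulrDr subrK /kernel_at.
case: ifP => _; last by rewrite !mulr0.
rewrite scaled_kernelE /edge_factor /exp_coeff /=.
by ring.
Qed.

Lemma edge_covariance_cvg s t : s <= s0 -> t <= s0 ->
  edge_factor N s * edge_factor N t * edge_covariance N s t @[N --> \oo] -->
  expR c * airy_limit s t.
Proof.
move=> ss0 ts0; under eq_fun do rewrite edge_covarianceE.
have -> : expR c * airy_limit s t = 0 + expR c * airy_limit s t - 0 by ring.
apply: cvgB; last exact: kernel_term_cvg0.
apply: cvgD; last first.
  apply: cvgM; last exact: cvg_cst.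
  have := is_cvg_series_exp_coeff c; rewrite -/(expR c) => h.
  by have := h; rewrite -cvg_shiftS.
pose M := airy_limit s s + 1 + (airy_limit t t + 1) + `|airy_limit s t|.
have top u : u <= s0 -> \forall N \near \oo,
    scaled_kernel s0 N N u u <= airy_limit u u + 1.
  move=> us0; have := scaled_kernel_cvg s0_ge1 0 us0 us0.
  under eq_fun do rewrite subn0.
  move=> /cvgrPdist_le/(_ 1 ltr01); apply: filterS => N.
  rewrite distrC => h; rewrite -lerBlDl; exact: le_trans (ler_norm _) h.
apply: (@tannery R (exp_coeff c) (fun N m => kernel_at N m s t - airy_limit s t) M).
- have := is_cvg_series_exp_coeff `|c|.
  suff -> : (fun m => `|exp_coeff c m|) = exp_coeff `|c| by [].
  apply/funext => m; rewrite /exp_coeff /= normrM normrX.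
  by rewrite [X in _ * X]ger0_norm// invr_ge0.
- near=> N => m; apply: (le_trans (ler_normB _ _)); apply: lerD => //.
  have t1 : scaled_kernel s0 N N s s <= airy_limit s s + 1 by near: N; exact: top.
  have t2 : scaled_kernel s0 N N t t <= airy_limit t t + 1 by near: N; exact: top.
  rewrite /kernel_at; case: ifP => _.
    by rewrite (le_trans (scaled_kernel_le _ _ _ _)) ?leq_subr ?lerD.
  by rewrite normr0 !addr_ge0 ?airy_limit_ge0.
- move=> m; rewrite -[nbhs 0]/(nbhs (0 : R)) -(subrr (airy_limit s t)).
  apply: cvgB; last exact: cvg_cst.
  apply: (@cvg_near_eq _ _ (fun N => scaled_kernel s0 N (N - m.*2) s t)); last exact: scaled_kernel_cvg.
  near=> N; rewrite /kernel_at ifT//; near: N; exact: nbhs_infty_ge.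
Unshelve. all: by end_near. Qed.

(** Both factors carry the same unknown sign of the scale, so correlations are not reversed. *)
Lemma edge_factor_sign N s t : (0 < N)%N -> lam N != 0 ->
  0 < edge_factor N s * edge_factor N t.
Proof.
move=> N0 l0; have a0 := edge_width_gt0 R N0.
have -> : edge_factor N s * edge_factor N t =
    (al N / lam N) ^+ 2 * (gauss (edge_point N s) * gauss (edge_point N t)).
  by rewrite /edge_factor; ring.
apply: mulr_gt0; last exact: mulr_gt0 (expR_gt0 _) (expR_gt0 _).
have q0 : al N / lam N != 0 by apply: mulf_neq0; [rewrite gt_eqF | rewrite invr_eq0].
by rewrite lt_neqAle sqr_ge0 andbT eq_sym sqrf_eq0.
Qed.

Lemma edge_correlation_cvg s t : s <= s0 -> t <= s0 ->
  edge_covariance N s t / (Num.sqrt (edge_covariance N s s) *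
    Num.sqrt (edge_covariance N t t)) @[N --> \oo] -->
  airy_limit s t / (Num.sqrt (airy_limit s s) * Num.sqrt (airy_limit t t)).
Proof.
move=> ss0 ts0.
pose F u v N := edge_factor N u * edge_factor N v * edge_covariance N u v.
have Fc u v : u <= s0 -> v <= s0 -> F u v N @[N --> \oo] --> expR c * airy_limit u v.
  exact: edge_covariance_cvg.
have sqrtF u : u <= s0 ->
    Num.sqrt (F u u N) @[N --> \oo] --> Num.sqrt (expR c * airy_limit u u).
  by move=> us0; apply: (cvg_comp _ _ (Fc u u us0 us0)); exact: sqrt_continuous.
have sqrt_gt0 u : 0 < Num.sqrt (expR c * airy_limit u u).
  by rewrite sqrtr_gt0 mulr_gt0 ?expR_gt0 ?airy_limit_gt0.
have -> : airy_limit s t / (Num.sqrt (airy_limit s s) * Num.sqrt (airy_limit t t)) =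
    expR c * airy_limit s t / (Num.sqrt (expR c * airy_limit s s) *
      Num.sqrt (expR c * airy_limit t t)).
  have e0 := expR_gt0 c.
  rewrite !sqrtrM ?(ltW e0)// mulrACA -expr2 sqr_sqrtr ?(ltW e0)//.
  by rewrite -mulf_div divff ?gt_eqF// mul1r.
apply: (@cvg_near_eq _ _ (fun N =>
    F s t N / (Num.sqrt (F s s N) * Num.sqrt (F t t N)))).
  near=> N.
  have N0 : (0 < N)%N by near: N; exact: nbhs_infty_gt.
  have l0 : lam N != 0 by near: N; exact: edge_scale_neq0.
  have g u v := edge_factor_sign u v N0 l0.
  have sF u : Num.sqrt (F u u N) =
      `|edge_factor N u| * Num.sqrt (edge_covariance N u u).
    by rewrite /F -expr2 sqrtrM ?sqr_ge0// sqrtr_sqr.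
  rewrite !sF mulrACA -normrM (gtr0_norm (g _ _)).
  by rewrite -mulf_div divff ?gt_eqF// mul1r.
apply: cvgM; first exact: Fc.
apply: cvgV; first by rewrite mulf_neq0// gt_eqF.
by apply: cvgM; exact: sqrtF.
Unshelve. all: by end_near. Qed.

End EdgeCovariance.

Theorem corollary1p2 (R : realType) (Q : probability R R)
    (Q_mean : (\int[Q]_x x%:E = 0)%E)
    (Q_var : (\int[Q]_x (x ^+ 2)%:E = (2^-1)%:E)%E)
    (Q_fourth : (\int[Q]_x (x ^+ 4)%:E < +oo)%E)
    (d : nat -> measure_display) (T : forall N, measurableType (d N))
    (P : forall N, probability (T N) R)
    (XRe XIm : forall N, 'I_N -> 'I_N -> {RV (P N) >-> R})
    (X_iid : forall N, (0 < N)%N -> wigner_iid Q (XRe N) (XIm N))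
    (mu nu : R) :
  let D N := char_det (XRe N) (XIm N) in
  let sigma N (x y : R) := correlation (P N) (D N x) (D N y) in
  sigma N (edge_point N mu) (edge_point N nu) @[N --> \oo] -->
  airy_kernel mu nu /
  (Num.sqrt (airy_kernel mu mu) * Num.sqrt (airy_kernel nu nu)).
Proof.
move=> D sigma; rewrite !airy_kernelE.
(* The matching point must lie where decay holds and to the right of both arguments. *)
pose s0 := Num.max 1 (Num.max mu nu).
have s01 : 1 <= s0 by rewrite le_max lexx.
have mu0 : mu <= s0 by rewrite !le_max lexx orbT.
have nu0 : nu <= s0 by rewrite !le_max lexx !orbT.
pose c := kurtosis (fine (\int[Q]_x (x ^+ 4)%:E)).
apply: cvg_near_eq (edge_correlation_cvg c s01 mu0 nu0).
near=> N; have N0 : (0 < N)%N by near: N; exact: nbhs_infty_gt.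
have cov x y := fine_covariance_char_det
  (power_moments Q_mean Q_var Q_fourth) (X_iid N N0) x y.
by rewrite /sigma /correlation /variance !cov.
Unshelve. all: by end_near. Qed.
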